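(* Let $f:\mathbb{R}\to\mathbb{R}$ be strictly convex, in the sense that $f''\geq\alpha>0$ for some constant $\alpha$. Consider the class of all monotone finite volume schemes of the form $$u_i^{n+1}=u_i^n-\lambda\big(F(u_i^n,u_{i+1}^n)-F(u_{i-1}^n,u_i^n)\big),\qquad u_i^0=\frac{1}{\Delta x}\int_{\mathcal{C}_i}u_0(x)\,dx\qquad(i\in\mathbb{Z},\ n\geq 0),$$ with $F(u,u)=f(u)$, that can be rewritten as $u^{n+1}=P\mathcal{A}\mathcal{S}_{\Delta t}u_{\Delta x}(t^n+)$ with a scheme-dependent projection operator $P$ satisfying $W_1(P\mathcal{A}v,v)\leq O(\Delta x^2)\,\mathrm{TV}(v)$, applied to initial data $u_0$ that are compactly supported and $\mathrm{Lip}^+$-bounded, i.e. for which there is a constant $C$ with $$\frac{u_0(x+z)-u_0(x)}{z}\leq C\qquad\text{for all }x,z\in\mathbb{R},\ z\neq 0.$$ Then the optimal convergence rate of this class of schemes, for this class of initial data, in the Wasserstein distance $W_1$ is $O(\Delta x)$; that is, the known first-order rate $W_1(u(t),u_{\Delta x}(t))\leq C_T\Delta x$ ($0\leq t\leq T$) cannot be improved: for every $T>0$ there exist a scheme in this class (with a fixed ratio $\lambda=\Delta t/\Delta x>0$), a compactly supported and $\mathrm{Lip}^+$-bounded initial datum $u_0$, and constants $c>0$, $\delta>0$ such that $$W_1\big(u(T),u_{\Delta x}(T)\big)\geq c\,\Delta x\qquad\text{for all }0<\Delta x<\delta,$$ where $u$ is the entropy solution of $u_t+f(u)_x=0$, $u(\cdot,0)=u_0$,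 and $u_{\Delta x}$ is the numerical approximation generated by the scheme from $u_0$.
   Context: The conservation law is $u_t+f(u)_x=0$ for $x\in\mathbb{R}$, $t>0$, with $u(x,0)=u_0(x)$; solutions are entropy solutions. $\mathcal{S}_t$ denotes the exact (entropy) evolution operator, $\mathcal{S}_tu(\cdot,s)=u(\cdot,s+t)$. Grid: $x_{i-1/2}$, $i\in\mathbb{Z}$, are equidistant points a distance $\Delta x$ apart, $\mathcal{C}_i=[x_{i-1/2},x_{i+1/2})$, $t^n=n\Delta t$ for $n=0,1,2,\dots$, and $\lambda=\Delta t/\Delta x$ is fixed as $\Delta x\to0$. The numerical approximation is the piecewise constant function $u_{\Delta x}(x,t)=u_i^n$ for $(x,t)\in\mathcal{C}_i\times[t^n,t^{n+1})$; $u_{\Delta x}(t^n+)$ denotes the numerical approximation computed at $t^n$. The numerical flux $F$ is consistent: $F(u,u)=f(u)$. The scheme is monotone if $u_i^{n+1}$ is a nondecreasing function of each of $u_{i-1}^n,u_i^n,u_{i+1}^n$ (on the range of the data); this holds if and only if $F$ is nondecreasing in its first argument and nonincreasing in its second and a suitable CFL condition (smallness of $\lambda$) is satisfied. The piecewise constant projection is $\mathcal{A}v(x)=\frac{1}{\Delta x}\int_{\mathcal{C}_i}v(y)\,dy$ for $x\in\mathcal{C}_i$. $\mathrm{TV}$ denotes total variation, and $O(\Delta x^2)\mathrm{TV}(v)$ means a bound $K\Delta x^2\,\mathrm{TV}(v)$ with $K$ independent of $v$ and $\Delta x$. The 1-Wasserstein distance between functions $u,v$ on $\mathbb{R}$ is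 $W_1(u,v)=\int_{\mathbb{R}}\left|\int_{-\infty}^x(u(y)-v(y))\,dy\right|dx$. The upper bound referred to as known is a theorem of Nessyahu, Tadmor and Tassa (for compactly supported, $\mathrm{Lip}^+$-bounded $u_0$ and monotone finite volume schemes of the form $u_i^{n+1}=u_i^n-\lambda\big(F(u_i^n,u_{i+1}^n)-F(u_{i-1}^n,u_i^n)\big)$, $u_i^0=\frac{1}{\Delta x}\int_{\mathcal{C}_i}u_0(x)\,dx$, with $F(u,u)=f(u)$, that can be rewritten as $u^{n+1}=P\mathcal{A}\mathcal{S}_{\Delta t}u_{\Delta x}(t^n+)$ with a scheme-dependent projection operator $P$ satisfying $W_1(P\mathcal{A}v,v)\leq O(\Delta x^2)\,\mathrm{TV}(v)$, and that are also discrete $\mathrm{Lip}^+$-stable, i.e. $\max_x\frac{u_{\Delta x}(x+\Delta x,t)-u_{\Delta x}(x,t)}{\Delta x}\leq C$ for all $t>0$); it is the rate whose optimality is asserted. *)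

(* Defs.v *)
From HB Require Import structures.
From mathcomp Require Import all_boot all_order all_algebra.
From mathcomp Require Import all_classical all_reals all_analysis.

Set Implicit Arguments.
Unset Strict Implicit.
Unset Printing Implicit Defensive.

Import Order.TTheory GRing.Theory Num.Theory.
Import numFieldNormedType.Exports.

Local Open Scope classical_set_scope.
Local Open Scope ring_scope.

(** * Entropy solutions of u_t + f(u)_x = 0

    A function of space and time is written [u x t].  Time-dependent solutions
    are considered on a strip R x [0, tau]; by Kruzkov's theorem they exist, are
    unique up to null sets in x at every time, and are the restrictions of the
    global entropy solution. *)

(* Nonnegative C^1 functions with compact support in R x ]0, tau[. *)
Definition test_function (R : realType) (tau : R) (phi : R -> R -> R) : Prop :=
  [/\ forall x t : R, derivable (fun y => phi y t) x 1 /\ derivable (phi x) t 1,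
      continuous (fun p : R * R => derive1 (fun y => phi y p.2) p.1),
      continuous (fun p : R * R => derive1 (phi p.1) p.2),
      forall x t : R, 0 <= phi x t &
      let supp := closure [set p : R * R | phi p.1 p.2 != 0] in
      compact supp /\ supp `<=` [set p | 0 < p.2 < tau]].

(* Left-hand side of Kruzkov's inequality for the constant k. *)
Definition kruzkov_integral (R : realType) (f : R -> R) (tau : R)
    (u : R -> R -> R) (k : R) (phi : R -> R -> R) : \bar R :=
  (\int[(@lebesgue_measure R) \x (@lebesgue_measure R)]_(p in
      setT `*` [set` `]0%R, tau[])
    (`|u p.1 p.2 - k| * derive1 (phi p.1) p.2
     + Num.sg (u p.1 p.2 - k) * (f (u p.1 p.2) - f k)
       * derive1 (fun y => phi y p.2) p.1)%R%:E)%E.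

(* Continuity in time with values in L^1_loc gives a meaning to u(., t) at a
   fixed time, and makes the initial datum be attained in L^1_loc. *)
Definition entropy_solution (R : realType) (f : R -> R) (tau : R)
    (u0 : R -> R) (u : R -> R -> R) : Prop :=
  [/\ measurable_fun (setT `*` [set` `[0, tau]]) (fun p : R * R => u p.1 p.2),
      exists B : R, forall x t : R, 0 <= t <= tau -> `|u x t| <= B,
      forall (k : R) (phi : R -> R -> R), test_function tau phi ->
        (0 <= kruzkov_integral f tau u k phi)%E,
      forall x, u x 0 = u0 x &
      forall a b t : R, 0 <= t <= tau ->
        (\int[@lebesgue_measure R]_(x in [set` `[a, b]]) (`|u x s - u x t|)%:E)%E
          @[s --> within [set` `[0, tau]] (nbhs t)] --> 0%E].

(* [entropy_evolution f t v w] is "w = S_t v". *)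
Definition entropy_evolution (R : realType) (f : R -> R) (t : R)
    (v w : R -> R) : Prop :=
  exists u, entropy_solution f t v u /\ (forall x, u x t = w x).

Definition wasserstein1 (R : realType) (u v : R -> R) : \bar R :=
  (\int[@lebesgue_measure R]_x
    `| \int[@lebesgue_measure R]_(y in [set` `]-oo, x]]) (u y - v y)%R%:E |)%E.

(* Pointwise variation.  Requiring W_1(P A v, v) <= K dx^2 TV(v) for every v with
   this TV is the same as requiring it with the essential variation, because the
   left-hand side only depends on v up to a null set. *)
Definition total_variationR (R : realType) (v : R -> R) : \bar R :=
  ereal_sup [set total_variation p.1 p.2 v | p in [set p : R * R | p.1 <= p.2]].

(** * Grid functions

    The grid is given by its mesh width dx and an origin o: the cell interfaces
    are x_{i-1/2} = o + i dx for i in Z. *)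

Definition cell (R : realType) (o dx : R) (i : int) : set R :=
  [set` `[o + i%:~R * dx, o + (i + 1)%:~R * dx[].

Definition cell_average (R : realType) (o dx : R) (v : R -> R) (i : int) : R :=
  dx^-1 * \int[@lebesgue_measure R]_(y in cell o dx i) v y.

(* The function equal to c i on the cell i; for 0 < dx, the point x lies in the
   cell of index floor ((x - o) / dx). *)
Definition piecewise_constant (R : realType) (o dx : R) (c : int -> R) : R -> R :=
  fun x => c (Num.floor ((x - o) / dx)).

Definition average (R : realType) (o dx : R) (v : R -> R) : R -> R :=
  piecewise_constant o dx (cell_average o dx v).

(** * Finite volume schemes with numerical flux F and ratio lam = dt / dx *)

Definition fv_update (R : realType) (F : R -> R -> R) (lam a b c : R) : R :=
  b - lam * (F b c - F a b).

Fixpoint fv_values (R : realType) (F : R -> R -> R) (lam o dx : R)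
    (u0 : R -> R) (n : nat) : int -> R :=
  match n with
  | 0%N => cell_average o dx u0
  | n'.+1 => fun i =>
      let u := fv_values F lam o dx u0 n' in
      fv_update F lam (u (i - 1)) (u i) (u (i + 1))
  end.

Definition fv_level (R : realType) (F : R -> R -> R) (lam o dx : R)
    (u0 : R -> R) (n : nat) : R -> R :=
  piecewise_constant o dx (fv_values F lam o dx u0 n).

(* For t >= 0, the time level in force is n = floor (t / dt), dt = lam dx. *)
Definition fv_approximation (R : realType) (F : R -> R -> R) (lam o dx : R)
    (u0 : R -> R) (x t : R) : R :=
  fv_level F lam o dx u0 (Num.truncn (t / (lam * dx))) x.

Definition lip_plus_bounded (R : realType) (u0 : R -> R) : Prop :=
  exists C : R, forall x z, z != 0 -> (u0 (x + z) - u0 x) / z <= C.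

Definition admissible_datum (R : realType) (u0 : R -> R) : Prop :=
  compact (closure [set x | u0 x != 0]) /\ lip_plus_bounded u0.

(* Monotonicity on the range [m, M] of the data: because of the CFL condition
   it cannot hold on the whole line for a fixed lam. *)
Definition monotone_scheme (R : realType) (F : R -> R -> R) (lam m M : R) : Prop :=
  forall a b c a' b' c' : R,
    a \in `[m, M] -> b \in `[m, M] -> c \in `[m, M] ->
    a' \in `[m, M] -> b' \in `[m, M] -> c' \in `[m, M] ->
  [/\ a <= a' -> fv_update F lam a b c <= fv_update F lam a' b c,
      b <= b' -> fv_update F lam a b c <= fv_update F lam a b' c &
      c <= c' -> fv_update F lam a b c <= fv_update F lam a b c'].

(* P o dx is a (possibly nonlinear) projection operator on the functions that
   are piecewise constant on the grid, with W_1(P A v, v) <= K dx^2 TV(v). *)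
Definition projection_operator (R : realType)
    (P : R -> R -> (R -> R) -> (R -> R)) : Prop :=
  (forall (o dx : R) (c : int -> R), 0 < dx ->
    (exists c' : int -> R,
      P o dx (piecewise_constant o dx c) = piecewise_constant o dx c') /\
    P o dx (P o dx (piecewise_constant o dx c)) =
      P o dx (piecewise_constant o dx c)) /\
  (exists K : R, 0 < K /\ forall (o dx : R) (v : R -> R), 0 < dx ->
    (@lebesgue_measure R).-integrable setT (EFin \o v) ->
    (wasserstein1 (P o dx (average o dx v)) v
      <= (K * dx ^+ 2)%:E * total_variationR v)%E).

(* The schemes under consideration, for data with values in [m, M]. *)
Definition fv_class (R : realType) (f : R -> R) (F : R -> R -> R)
    (lam m M : R) : Prop :=
  [/\ forall u, F u u = f u,
      monotone_scheme F lam m M &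
      exists2 P, projection_operator P &
        forall (u0 : R -> R) (o dx : R) (n : nat),
          admissible_datum u0 -> (forall x, m <= u0 x <= M) -> 0 < dx ->
          exists w, entropy_evolution f (lam * dx) (fv_level F lam o dx u0 n) w /\
            fv_level F lam o dx u0 n.+1 = P o dx (average o dx w)].

(* Main.v *)
(** Where the characteristic speeds have a constant sign, Godunov's flux is the
    upwind flux, and a time step is exact evolution followed by averaging
    ([P = id]).  Take a datum whose solution (a rarefaction and a compression wave)
    stays continuous up to time T.  The first moment of a solution changes at the
    rate [\int (f u - f 0)], which is conserved as long as the solution is
    continuous; the corresponding sum in the scheme decreases by at least a
    constant times dx per step.  After T / (lam dx) steps the first moments over a
    window therefore differ by at least c dx, and this difference bounds W_1 from
    below.  The exact solutions are uniform limits of superpositions of travelling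
    jumps, for which Kruzkov's inequality, mass and moments are finite sums. *)

Require Import Defs.
From mathcomp Require Import all_boot all_order all_algebra.
From mathcomp Require Import all_classical all_reals all_analysis.
From mathcomp Require Import measurable_realfun.
From mathcomp Require Import zify ring lra.
Import Order.TTheory GRing.Theory Num.Theory.
Import numFieldNormedType.Exports.
Local Open Scope classical_set_scope.
Local Open Scope ring_scope.

Set Implicit Arguments.
Unset Strict Implicit.
Unset Printing Implicit Defensive.

(** * Superpositions of travelling jumps *)

(** The size of the gain comes from three orders of magnitude. Over about 1/dx cells the sum of
    [f u - f 0] loses roughly the sum of squared jumps, of order dx, in each step. The moment adds
    these sums over the steps, so after n steps it lags by about n (n - 1) / 2 times dx; with n of
    order 1/dx and a factor dx^2 from the cell size, a multiple of dx remains. Averaging the datum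
    shifts moments by O(dx^2) only and cannot cancel this. The entropy whose loss is measured is f
    itself, because it drives the first moment; its entropy flux has derivative f'^2. The speed may
    vanish at the state 0, so the loss is degenerate there and carries a weight that vanishes with
    the states. Data take values in [0, 1] if f'(0) >= 0 and in [-1, 0] otherwise. Convexity then
    keeps the speeds of one sign, and a reflection of states and cells reduces the second case to
    the first. Exact solutions are needed both for membership in the class and for the final
    comparison; both kinds are built explicitly from the same fronts. *)

Lemma normr_le_endpoints (R : realType) (m M x : R) : m <= x <= M -> `|x| <= `|m| + `|M|.
Proof.
move=> /andP[mx xM]; rewrite ler_norml.
have := ler_norm M; have := ler_norm (- m); rewrite normrN.
have := normr_ge0 m; have := normr_ge0 M; lra.
Qed.

(* A travelling jump [(a, s, (l, r))]: at time t it sits at [a + s t], with the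
   state l on its left and r on its right. *)
Notation front R := (R * R * (R * R))%type.

Section fronts.
Variable R : realType.
Implicit Types (p : front R) (L : seq (front R)) (eta f : R -> R).

Definition front_pos p (t : R) : R := p.1.1 + p.1.2 * t.

Definition front_sum eta L (x t : R) : R :=
  \sum_(p <- L) (eta p.2.2 - eta p.2.1) * (front_pos p t <= x)%R%:R.

(* Speeds obey the Rankine-Hugoniot condition. *)
Definition front_valid f (m M tau lo hi : R) p : Prop :=
  [/\ p.1.2 * (p.2.2 - p.2.1) = f p.2.2 - f p.2.1,
      m <= p.2.1 <= M, m <= p.2.2 <= M &
      forall t : R, 0 <= t <= tau -> lo <= front_pos p t <= hi].

(* Bounds the entropy production of a jump; if [smooth] is false, the
   admissible (decreasing) jumps are free. *)
Definition front_cost f (smooth : bool) p : R :=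
  if smooth || (p.2.1 <= p.2.2)
  then (p.2.2 - p.2.1) * (derive1 f p.2.2 - derive1 f p.2.1) else 0.

(* u is a uniform limit of superpositions of fronts on [lo, hi[ x [0, tau]; the
   last two clauses say that the jumps are traversed in order, from l to r. *)
Definition front_approx f (smooth : bool) (m M tau lo hi l r : R)
    (u : R -> R -> R) : Prop :=
  forall eps : R, 0 < eps -> exists L : seq (front R),
  [/\ forall p, p \in L -> front_valid f m M tau lo hi p,
      \sum_(p <- L) front_cost f smooth p <= eps,
      forall x t : R, lo <= x < hi -> 0 <= t <= tau ->
        `|u x t - (l + front_sum id L x t)| <= eps,
      forall eta (x t : R), 0 <= t <= tau ->
        eta (l + front_sum id L x t) = eta l + front_sum eta L x t &
      forall eta, eta r = eta l + \sum_(p <- L) (eta p.2.2 - eta p.2.1)].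

Lemma front_sum_cat eta L1 L2 x t :
  front_sum eta (L1 ++ L2) x t = front_sum eta L1 x t + front_sum eta L2 x t.
Proof. by rewrite /front_sum big_cat. Qed.

Lemma front_sum_left eta L x t :
  (forall p, p \in L -> x < front_pos p t) -> front_sum eta L x t = 0.
Proof.
move=> xL; rewrite /front_sum big_seq big1 // => p /xL xp.
by rewrite leNgt xp mulr0.
Qed.

Lemma front_sum_right eta L x t :
  (forall p, p \in L -> front_pos p t <= x) ->
  front_sum eta L x t = \sum_(p <- L) (eta p.2.2 - eta p.2.1).
Proof.
move=> xL; rewrite /front_sum big_seq [RHS]big_seq; apply: eq_bigr => p /xL ->.
by rewrite mulr1.
Qed.

(* The entropy relation is applied to the indicator of the complement of [m, M]. *)
Lemma front_sum_range f m M tau lo hi L (l x t : R) :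
  (forall p, p \in L -> front_valid f m M tau lo hi p) -> m <= l <= M ->
  (forall eta : R -> R, eta (l + front_sum id L x t) = eta l + front_sum eta L x t) ->
  m <= l + front_sum id L x t <= M.
Proof.
move=> Lv lM etaL; pose chi (v : R) : R := if m <= v <= M then 0 else 1.
have := etaL chi; rewrite {2}/chi lM add0r /front_sum.
rewrite [RHS]big_seq [RHS]big1; last first.
  by move=> p /Lv[_ h1 h2 _]; rewrite /chi h1 h2 subrr mul0r.
by rewrite /chi; case: ifP => // _ /eqP; rewrite oner_eq0.
Qed.

Lemma front_approx_const f smooth m M tau lo hi l :
  front_approx f smooth m M tau lo hi l l (fun _ _ => l).
Proof.
move=> e e0; exists [::].
split => //; rewrite ?/front_sum ?big_nil //; [exact: ltW| | |].
- by move=> x t _ _; rewrite big_nil addr0 subrr normr0 ltW.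
- by move=> eta x t _; rewrite !big_nil !addr0.
- by move=> eta; rewrite big_nil addr0.
Qed.

Lemma front_approx_eq f smooth m M tau lo hi l r u v :
  (forall x t : R, lo <= x < hi -> 0 <= t <= tau -> u x t = v x t) ->
  front_approx f smooth m M tau lo hi l r u ->
  front_approx f smooth m M tau lo hi l r v.
Proof.
move=> uv uL e e0; have [L [L1 L2 L3 L4 L5]] := uL e e0; exists L; split => //.
by move=> x t xlh t0; rewrite -uv //; exact: L3.
Qed.

(** Fronts never leave their window: right of [b] those of the left piece have all passed and leave
    the state [q], and left of [b] none of the right piece has. Tolerance [e / 2] on each piece
    makes the costs add up to [e]. *)
Lemma front_approx_cat f smooth m M tau a b c l q r u : a <= b <= c ->
  front_approx f smooth m M tau a b l q u ->
  front_approx f smooth m M tau b c q r u ->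
  front_approx f smooth m M tau a c l r u.
Proof.
move=> /andP[ab bc] uL uK e e0.
have e20 : 0 < e / 2 by rewrite divr_gt0.
have [L [L1 L2 L3 L4 L5]] := uL _ e20.
have [K [K1 K2 K3 K4 K5]] := uK _ e20.
have Lb eta x t : b <= x -> 0 <= t <= tau ->
    eta l + front_sum eta L x t = eta q.
  move=> bx t0; rewrite (L5 eta) front_sum_right// => p /L1[_ _ _ /(_ _ t0)].
  by case/andP=> _ h; exact: le_trans bx.
have Kb eta x t : x < b -> 0 <= t <= tau -> front_sum eta K x t = 0.
  move=> xb t0; rewrite front_sum_left// => p /K1[_ _ _ /(_ _ t0)].
  by case/andP=> /(lt_le_trans xb).
exists (L ++ K); split.
- move=> p; rewrite mem_cat => /orP[/L1|/K1] [? ? ? H]; split => // t /H/andP[lt th].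
    by rewrite lt (le_trans th).
  by rewrite th (le_trans ab).
- by rewrite big_cat/= (splitr e) lerD.
- move=> x t /andP[ax xc] t0; rewrite front_sum_cat addrA.
  have [xb|bx] := ltP x b.
    rewrite Kb// addr0; apply: le_trans (L3 _ _ _ t0) _; first by rewrite ax.
    lra.
  have /= -> := Lb id x t bx t0.
  apply: le_trans (K3 _ _ _ t0) _; first by rewrite bx.
  lra.
- move=> eta x t t0; rewrite !front_sum_cat !addrA -(L4 eta)//.
  have [xb|bx] := ltP x b; first by rewrite !Kb// !addr0.
  have /= -> := Lb id x t bx t0; exact: K4.
- by move=> eta; rewrite big_cat/= addrA -L5 K5.
Qed.

(** One front is exact at every tolerance; it is free because it decreases and [smooth] is false. *)
Lemma front_approx_shock f m M tau lo hi l r x0 s :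
  r < l -> m <= l <= M -> m <= r <= M -> s * (r - l) = f r - f l ->
  (forall t : R, 0 <= t <= tau -> lo <= x0 + s * t <= hi) ->
  front_approx f false m M tau lo hi l r
    (fun x t => if x0 + s * t <= x then r else l).
Proof.
move=> rl lM rM sE sp e e0; exists [:: (x0, s, (l, r))].
split; rewrite ?/front_sum.
- by move=> p; rewrite inE => /eqP ->.
- by rewrite big_seq1 /front_cost/= (leNgt l) rl ltW.
- move=> x t _ _; rewrite big_seq1 /front_pos/=; case: ifP => _.
    by rewrite mulr1 subrKC subrr normr0 ltW.
  by rewrite mulr0 addr0 subrr normr0 ltW.
- move=> eta x t _; rewrite !big_seq1 /front_pos/=; case: (_ <= x) => /=.
    by rewrite !mulr1 !subrKC.
  by rewrite !mulr0 !addr0.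
- by move=> eta; rewrite big_seq1/= subrKC.
Qed.

End fronts.

(** Meant for the fronts of a fan at a given point: those already passed form an initial segment, so
    their number determines the superposition. *)
Lemma decreasing_bool_threshold (N : nat) (b : nat -> bool) :
  (forall i, (i.+1 < N)%N -> b i.+1 -> b i) ->
  exists2 k, (k <= N)%N & forall i, (i < N)%N -> b i = (i < k)%N.
Proof.
elim: N => [|N IH] bd; first by exists 0%N.
have [i iN|k kN bk] := IH; first by apply: bd; rewrite ltnW.
have [bN|bN] := boolP (b N); last first.
  exists k; first exact: leqW.
  move=> i; rewrite ltnS leq_eqVlt => /predU1P[->|/bk//].
  by rewrite (negbTE bN) ltnNge kN.
exists N.+1 => // i iN; rewrite iN.
have {}bN : forall j, (j <= N)%N -> b (N - j)%N.
  elim=> [|j jH] jN; first by rewrite subn0.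
  apply: bd; first by rewrite ltnS subnS prednK ?subn_gt0// leq_subr.
  by rewrite subnS prednK ?subn_gt0// jH// ltnW.
by have := bN (N - i)%N (leq_subr _ _); rewrite subKn.
Qed.

(** * Rarefaction and compression waves as limits of fronts *)

Section fan.
Variables (R : realType) (f : R -> R).
Hypothesis f_derivable : forall x : R, derivable f x 1.
Hypothesis f'_homo : {homo derive1 f : x y / x <= y}.

(** Mean value theorem for the Rankine-Hugoniot speed. The factor [c], of the sign of [b - a], will
    be [t - tc]: one ordering then serves both a rarefaction after its centre and a compression
    before its focus. *)
Lemma chord_slope (a b : R) : exists s : R, s * (b - a) = f b - f a /\
  forall c, 0 <= (b - a) * c -> c * derive1 f a <= c * s <= c * derive1 f b.
Proof.
have dF (x : R) : is_derive x 1 f (derive1 f x) by rewrite derive1E; exact: derivableP.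
have fc (x y : R) : {within `[x, y], continuous f}.
  apply: derivable_within_continuous => z _; exact: f_derivable.
wlog ab : a b / a <= b => [H|].
  have [ab|/ltW ba] := leP a b; first exact: H.
  have [s [sE sP]] := H _ _ ba; exists s; split.
    by rewrite -opprB mulrN sE opprB.
  move=> c; rewrite -opprB mulNr -mulrN => /sP; rewrite !mulNr !lerN2.
  by rewrite andbC.
have [x xab fE] := MVT_segment ab (fun x _ => dF x) (fc a b).
exists (derive1 f x); split=> // c c0.
move: xab; rewrite in_itv/= => /andP[ax xb].
have [abE|abN] := eqVneq a b.
  have -> : x = a by apply/le_anti; rewrite ax abE xb.
  by rewrite abE !lexx.
have {}ab : a < b by rewrite lt_neqAle abN.
move: c0; rewrite pmulr_rge0 ?subr_gt0// => c0.
by rewrite !ler_wpM2l// f'_homo.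
Qed.

(* The self-similar wave centred at [(xc, tc)] between the states p and q,
   written by inverting [f'] along the segment from p to q: a rarefaction wave
   for [t > tc] if [p <= q], a compression wave for [t < tc] if [q <= p]. *)
Definition fan (p q xc tc x t : R) : R :=
  p + (q - p) * sup [set w | 0 <= w <= 1 /\
    (w = 0 \/ xc + (t - tc) * derive1 f (p + (q - p) * w) <= x)].

Lemma fan_speed_homo p q c w w' : 0 <= (q - p) * c -> w <= w' ->
  c * derive1 f (p + (q - p) * w) <= c * derive1 f (p + (q - p) * w').
Proof.
move=> pqc ww'; have [c0|c0|->] := ltgtP c 0; last by rewrite !mul0r.
  rewrite ler_wnM2l ?(ltW c0)// f'_homo// lerD2l ler_wnM2l//.
  by move: pqc; rewrite nmulr_lge0.
rewrite ler_wpM2l ?(ltW c0)// f'_homo// lerD2l ler_wpM2l//.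
by move: pqc; rewrite pmulr_lge0.
Qed.

(** The segment from [p] to [q] is cut into [N] equal jumps, each moving at its chord slope through
    [(xc, tc)]; the sign condition keeps them in order. Each jump has height [(q - p) / N] and the
    increments of [f'] telescope, so the total cost is O(1/N) even if all jumps are charged. *)
Lemma fan_approx (smooth : bool) (m M tau lo hi p q xc tc : R) :
  m <= p <= M -> m <= q <= M ->
  (forall t : R, 0 <= t <= tau -> [/\ 0 <= (q - p) * (t - tc),
    lo <= xc + (t - tc) * derive1 f p & xc + (t - tc) * derive1 f q <= hi]) ->
  front_approx f smooth m M tau lo hi p q (fan p q xc tc).
Proof.
move=> pM qM Ht e e0.
(* [B / N] has to dominate both the total cost and the uniform error; the 1 keeps [B] positive. *)
pose B := 1 + `|q - p| + `|(q - p) * (derive1 f q - derive1 f p)|.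
have B0 : 0 < B by rewrite /B -addrA ltr_pwDl// addr_ge0.
pose N := (Num.truncn (B / e)).+1.
have BN : B / N%:R <= e.
  rewrite ler_pdivrMr ?ltr0n// mulrC -ler_pdivrMr// ltW//.
  by apply: truncnS_gt.
have NN : (N%:R : R) != 0 by rewrite pnatr_eq0.
pose v (i : nat) : R := p + (q - p) * (i%:R / N%:R).
have v0 : v 0%N = p by rewrite /v mul0r mulr0 addr0.
have vN : v N = q by rewrite /v divff// mulr1 subrKC.
have vD i : v i.+1 - v i = (q - p) / N%:R.
  by rewrite /v -(natr1 i); field.
have /choice[s sP] := fun i => chord_slope (v i) (v i.+1).
have sB i (t : R) : 0 <= t <= tau ->
    (t - tc) * derive1 f (v i) <= (t - tc) * s i <= (t - tc) * derive1 f (v i.+1).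
  move=> /Ht[c0 _ _]; apply: (sP i).2.
  by rewrite vD mulrAC mulr_ge0// invr_ge0.
have vMm i : (i <= N)%N -> m <= v i <= M.
  move=> iN; have : (0 <= i%:R / N%:R :> R) && (i%:R / N%:R <= 1 :> R).
    by rewrite divr_ge0//= ler_pdivrMr ?ltr0n// mul1r ler_nat.
  rewrite /v; move: (i%:R / N%:R) => w; move: pM qM; nra.
have vhomo i j (t : R) : (i <= j)%N -> 0 <= t <= tau ->
    (t - tc) * derive1 f (v i) <= (t - tc) * derive1 f (v j).
  move=> ij /Ht[c0 _ _]; apply: fan_speed_homo => //.
  by rewrite ler_pM2r ?invr_gt0 ?ltr0n// ler_nat.
(* The initial positions [xc - tc * s i] make all fronts meet at [(xc, tc)]. *)
pose L : seq (front R) :=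
  [seq (xc - tc * s i, s i, (v i, v i.+1)) | i <- iota 0 N].
have posE i t : front_pos (xc - tc * s i, s i, (v i, v i.+1)) t
    = xc + (t - tc) * s i by rewrite /front_pos/=; ring.
have sumE (eta : R -> R) k : (k <= N)%N ->
    \sum_(i <- iota 0 N) (eta (v i.+1) - eta (v i)) * (i < k)%N%:R
    = eta (v k) - eta p.
  move=> kN; have -> : iota 0 N = index_iota 0 N by rewrite /index_iota subn0.
  rewrite (@big_cat_nat _ _ _ k)//= [X in _ + X]big_nat [X in _ + X]big1 ?addr0.
    rewrite -[in RHS]v0 -(telescope_sumr (fun i => eta (v i)) (leq0n k)).
    by rewrite big_nat [RHS]big_nat; apply: eq_bigr => i /= ->; rewrite mulr1.
  by move=> i /andP[ki _]; rewrite ltnNge ki mulr0.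
have thr (x t : R) : 0 <= t <= tau -> exists2 k, (k <= N)%N &
    (forall i, (i < N)%N -> (xc + (t - tc) * s i <= x) = (i < k)%N) /\
    (forall eta, front_sum eta L x t = eta (v k) - eta p).
  move=> t0; have [i iN|k kN kP] :=
      @decreasing_bool_threshold N (fun i => xc + (t - tc) * s i <= x).
    apply: le_trans; rewrite lerD2l.
    have /andP[_ +] := sB i t t0; have /andP[+ _] := sB i.+1 t t0.
    by move=> /[swap]; exact: le_trans.
  exists k => //; split=> // eta; rewrite /front_sum /L big_map -(sumE eta)//.
  rewrite big_seq [RHS]big_seq; apply: eq_bigr => i.
  by rewrite mem_iota add0n => /andP[_ iN]; rewrite posE/= kP.
exists L; split.
- move=> g /mapP[i]; rewrite mem_iota add0n => /andP[_ iN] ->.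
  split=> /=; [exact: (sP i).1|by apply: vMm; rewrite ltnW|exact: vMm|].
  move=> t t0; rewrite posE; have [_ lo_le le_hi] := Ht t t0.
  have /andP[sl sr] := sB i t t0.
  have := vhomo 0%N i t (leq0n _) t0; have := vhomo i.+1 N t iN t0.
  rewrite v0 vN => H1 H2; apply/andP; split.
    by apply: le_trans lo_le _; rewrite lerD2l (le_trans H2).
  by apply: le_trans le_hi; rewrite lerD2l (le_trans sr).
- apply: (@le_trans _ _ (\sum_(i <- iota 0 N)
      (q - p) / N%:R * (derive1 f (v i.+1) - derive1 f (v i)))).
    rewrite /L big_map; apply: ler_sum => i _; rewrite /front_cost/= vD.
    case: ifP => // _; rewrite -(vD i).
    have [vv|/ltW vv] := leP (v i) (v i.+1).
      by rewrite mulr_ge0// subr_ge0// f'_homo.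
    by rewrite mulr_le0// subr_le0// f'_homo.
  rewrite -mulr_sumr; have := sumE (derive1 f) N (leqnn N).
  rewrite vN => H; have -> : \sum_(i <- iota 0 N) (derive1 f (v i.+1) - derive1 f (v i))
      = derive1 f q - derive1 f p.
    rewrite -H big_seq [RHS]big_seq; apply: eq_bigr => i.
    by rewrite mem_iota add0n => /andP[_ ->]; rewrite mulr1.
  apply: le_trans BN; rewrite mulrAC ler_wpM2r ?invr_ge0// /B.
  have := ler_norm ((q - p) * (derive1 f q - derive1 f p)).
  have := normr_ge0 (q - p); lra.
(* With [k] fronts passed the superposition has parameter [k / N]. The supremum in [fan] is within
   [1 / N] of it, since each chord slope lies between the characteristic speeds at the two ends of
   its jump. *)
- move=> x t _ t0; have [k kN [kP ->]] := thr x t t0.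
  rewrite /= subrKC /fan /v opprD addrACA subrr add0r -mulrBr.
  set S := [set w | _]; have [c0 _ _] := Ht t t0.
  have S0 : S 0 by rewrite /S/=; split; [rewrite lexx ler01|left].
  have S1 : ubound S 1 by move=> w [/andP[]].
  have Sge w : S w -> w <= sup S by apply: ub_le_sup; exists 1.
  have SL : k%:R / N%:R - N%:R^-1 <= sup S.
    have -> : k%:R / N%:R - N%:R^-1 = (k%:R - 1) / N%:R :> R by field.
    case: k kN kP => [|k] kN kP.
      apply: le_trans (Sge _ S0); rewrite sub0r mulNr oppr_le0.
      by rewrite divr_ge0.
    rewrite -natr1 addrK; apply: Sge; split.
      by rewrite divr_ge0//= ler_pdivrMr ?ltr0n// mul1r ler_nat ltnW.
    right; have := kP k kN; rewrite ltnSn; apply: le_trans.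
    by rewrite lerD2l; have /andP[] := sB k t t0.
  have SR : sup S <= k%:R / N%:R + N%:R^-1.
    have -> : k%:R / N%:R + N%:R^-1 = k.+1%:R / N%:R :> R.
      by rewrite -natr1; field.
    apply: ge_sup; first by exists 0.
    move=> w [/andP[w0 w1] [->|wx]]; first by rewrite divr_ge0.
    move: kN; rewrite leq_eqVlt => /predU1P[->|kN].
      by rewrite (le_trans w1)// ler_pdivlMr ?ltr0n// mul1r ler_nat.
    rewrite leNgt; apply/negP => kw.
    have := kP k kN; rewrite ltnn => /negP; apply; apply: le_trans wx.
    rewrite lerD2l; have /andP[_ /le_trans] := sB k t t0; apply.
    by apply: fan_speed_homo => //; exact: ltW.
  have Sd : `|sup S - k%:R / N%:R| <= N%:R^-1 by rewrite ler_norml; lra.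
  rewrite normrM; apply: le_trans BN; rewrite /B.
  apply: (@le_trans _ _ (`|q - p| / N%:R)); first by rewrite ler_wpM2l.
  rewrite ler_wpM2r ?invr_ge0//.
  have := normr_ge0 ((q - p) * (derive1 f q - derive1 f p)); lra.
- move=> eta x t t0; have [k kN [_ kE]] := thr x t t0.
  by rewrite !kE/= !subrKC.
- move=> eta; have := sumE eta N (leqnn N); rewrite vN => H.
  rewrite /L big_map; have -> : \sum_(i <- iota 0 N)
      (eta (v i.+1) - eta (v i)) = eta q - eta p; last by rewrite subrKC.
  rewrite -H big_seq [RHS]big_seq; apply: eq_bigr => i.
  by rewrite mem_iota add0n => /andP[_ ->]; rewrite mulr1.
Qed.

End fan.

(** * Kruzkov's inequality for superpositions *)

Section plane.
Variable R : realType.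
Implicit Types (phi : R -> R -> R) (tau : R).

(** Open sets are countable unions of rational boxes, which places them in the product
    sigma-algebra. *)
Lemma open_measurable_plane (U : set (R * R)) : open U -> measurable U.
Proof.
move=> oU.
pose box (i : (rat * rat) * (rat * rat)) : set (R * R) :=
  [set` `]ratr i.1.1, ratr i.1.2[] `*` [set` `]ratr i.2.1, ratr i.2.2[].
pose F i := if pselect (box i `<=` U) then box i else set0.
have -> : U = \bigcup_i F i.
  apply/seteqP; split=> [[x t] Uxt|p [i _]]; last first.
    by rewrite /F; case: pselect => // sub /sub.
  have [e/= e0 eU] := (nbhs_ballP _ _).1 (oU _ Uxt).
  have lt1 (z : R) : z - e < z by rewrite gtrBl.
  have lt2 (z : R) : z < z + e by rewrite ltrDl.
  have [q1] := rat_in_itvoo (lt1 x); have [q2] := rat_in_itvoo (lt2 x).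
  have [q3] := rat_in_itvoo (lt1 t); have [q4] := rat_in_itvoo (lt2 t).
  rewrite !in_itv/= => /andP[h1 h2] /andP[h3 h4] /andP[h5 h6] /andP[h7 h8].
  exists ((q1, q2), (q3, q4)) => //; rewrite /F; case: pselect => [?|[]].
    by rewrite /box/=; split; rewrite /= in_itv/= ?h8 ?h5 ?h4 ?h1.
  move=> [y s]; rewrite /box/= => -[]; rewrite /= !in_itv/= => Hy Hs.
  apply: eU; split; rewrite /ball/= ltr_norml; move: h1 h2 h3 h4 h5 h6 h7 h8 Hy Hs; lra.
apply: countable_bigcupT_measurable => // i.
rewrite /F; case: pselect => [?|?]; last exact: measurable0.
by apply: measurableX; exact: measurable_itv.
Qed.

Lemma continuous_measurable_plane (g : R * R -> R) :
  continuous g -> measurable_fun setT g.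
Proof.
move=> /continuousP cg; apply: (measurability _ (measurable_realfun.RGenOpens.measurableE R)).
move=> _ [_ [a [b ->] <-]]; rewrite setTI; apply: open_measurable_plane.
exact/cg/interval_open.
Qed.

Definition dphix phi (x t : R) : R := derive1 (fun y => phi y t) x.
Definition dphit phi (x t : R) : R := derive1 (phi x) t.

(** The derivatives vanish together with [phi] because the complement of the closed support is open,
    so [phi] is zero near each of its points. *)
Lemma test_function_support tau phi : test_function tau phi ->
  exists2 X : R, 0 < X & forall x t : R, ~ (- X < x < X /\ 0 < t < tau) ->
    [/\ phi x t = 0, dphix phi x t = 0 & dphit phi x t = 0].
Proof.
case=> _ _ _ _ /=; set K := closure _ => -[cK Ktau].
have [X X0 KX] : exists2 X : R, 0 < X & forall x t, K (x, t) -> - X < x < X.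
  have cK1 : compact (fst @` K).
    apply: continuous_compact => //; apply: continuous_subspaceT => p.
    exact: cvg_fst.
  have [B0 [_ HB0]] := compact_bounded cK1.
  have HB := HB0 (B0 + 1) (ltr_pwDr ltr01 (lexx B0)); set B := B0 + 1 in HB.
  have B1 : 0 < `|B| + 1 by rewrite ltr_wpDl.
  exists (`|B| + 1) => // x t Kxt; rewrite -ltr_norml.
  apply: (@le_lt_trans _ _ B); first by apply: (HB x); exists (x, t).
  by rewrite (le_lt_trans (ler_norm B))// ltrDl.
exists X => // x t nK.
have {}nK : (~` K) (x, t).
  by move=> Kxt; apply: nK; split; [exact: (KX x t)|exact: (Ktau _ Kxt)].
have oK : open (~` K) by rewrite openC; exact: closed_closure.
have [e/= e0 eK] := (nbhs_ballP _ _).1 (oK _ nK).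
have phi0 y s : `|x - y| < e -> `|t - s| < e -> phi y s = 0.
  move=> ye se; apply/eqP/negPn/negP => ph.
  have : (~` K) (y, s) by apply: eK; split.
  by apply; apply: subset_closure.
have n0 (z : R) : `|z - z| < e by rewrite subrr normr0.
split; first exact: phi0.
- rewrite /dphix derive1E (_ : 'D_1 _ x = 'D_1 (cst 0 : R -> R) x); first exact: derive_cst.
  apply: near_eq_derive; apply/nbhs_ballP; exists e => // y ye.
  exact: phi0.
- rewrite /dphit derive1E (_ : 'D_1 _ t = 'D_1 (cst 0 : R -> R) t); first exact: derive_cst.
  apply: near_eq_derive; apply/nbhs_ballP; exists e => // y ye.
  exact: phi0.
Qed.

Lemma test_function_bounded tau phi : test_function tau phi ->
  exists2 B : R, 0 < B &
    forall x t, `|dphix phi x t| <= B /\ `|dphit phi x t| <= B.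
Proof.
move=> tf; have [X X0 supp] := test_function_support tf.
case: tf => _ cx ct _ _.
have cbox : compact ([set` `[- X, X]] `*` [set` `[0, tau]]).
  by apply: compact_setX; exact: segment_compact.
have bnd (g : R * R -> R) : continuous g ->
    (forall x t, ~ (- X < x < X /\ 0 < t < tau) -> g (x, t) = 0) ->
    exists2 B : R, 0 < B & forall x t, `|g (x, t)| <= B.
  move=> cg g0; have cgb : compact (g @` ([set` `[- X, X]] `*` [set` `[0, tau]])).
    by apply: continuous_compact => //; exact: continuous_subspaceT.
  have [B0 [_ HB0]] := compact_bounded cgb.
  have HB := HB0 (B0 + 1) (ltr_pwDr ltr01 (lexx B0)); set B := B0 + 1 in HB.
  exists (`|B| + 1); first by rewrite ltr_wpDl.
  move=> x t; have [H|H] := pselect (- X < x < X /\ 0 < t < tau); last first.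
    by rewrite g0// normr0 addr_ge0.
  apply: (@le_trans _ _ B); last by rewrite (le_trans (ler_norm B))// lerDl.
  apply: (HB (g (x, t))); exists (x, t) => //; split; rewrite /= in_itv/=.
    by case: H => /andP[/ltW -> /ltW ->].
  by case: H => _ /andP[/ltW -> /ltW ->].
have [B1 B10 H1] := bnd _ cx (fun x t h => let: And3 _ a _ := supp x t h in a).
have [B2 B20 H2] := bnd _ ct (fun x t h => let: And3 _ _ a := supp x t h in a).
exists (B1 + B2); first exact: addr_gt0.
by move=> x t; split; [have := H1 x t|have := H2 x t] => /le_trans; apply;
  rewrite ?lerDl ?lerDr ltW.
Qed.

End plane.

(** * Integrals of derivatives on the line *)

Section line_integrals.
Variable R : realType.
Notation mu := (@lebesgue_measure R).

Lemma integral_segment_restrict (a b : R) (g h : R -> R) :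
  (forall x, g x = if a <= x <= b then h x else 0) ->
  (\int[mu]_x (g x)%:E = \int[mu]_(x in [set` `[a, b]]) (h x)%:E)%E.
Proof.
move=> gE; rewrite [RHS]integral_mkcond; apply: eq_integral => x _.
rewrite patchE gE; case: ifPn => H; case: ifPn => //.
  by rewrite notin_setE/= in_itv/= H.
by rewrite inE/= in_itv/= (negbTE H).
Qed.

Lemma integral_derive_segment (psi g : R -> R) (a b : R) : a <= b ->
  (forall x, derivable psi x 1) -> continuous (derive1 psi) ->
  (forall x, g x = if a <= x <= b then derive1 psi x else 0) ->
  (\int[mu]_x (g x)%:E = (psi b - psi a)%:E)%E.
Proof.
move=> ab dpsi cpsi /integral_segment_restrict ->.
move: ab; rewrite le_eqVlt => /predU1P[->|ab].
  by rewrite set_itv1 integral_set1 subrr.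
have cp : continuous psi.
  by move=> x; apply/differentiable_continuous/derivable1_diffP.
rewrite (@continuous_FTC2 _ _ psi)//; first exact: continuous_subspaceT.
split => //; first by apply: cvg_at_right_filter; exact: cp.
by apply: cvg_at_left_filter; exact: cp.
Qed.

Section compact_support.
Variables (psi : R -> R) (X : R).
Hypotheses (X0 : 0 < X) (dpsi : forall x, derivable psi x 1)
  (cpsi : continuous (derive1 psi))
  (spsi : forall x, ~ (- X < x < X) -> psi x = 0 /\ derive1 psi x = 0).

Let XX : - X <= X. Proof. by rewrite ge0_cp// ltW. Qed.
Let psi_ge x : X <= x -> psi x = 0 /\ derive1 psi x = 0.
Proof. by move=> Xx; apply: spsi => /andP[_]; rewrite ltNge Xx. Qed.
Let psi_le x : x <= - X -> psi x = 0 /\ derive1 psi x = 0.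
Proof. by move=> xX; apply: spsi => /andP[]; rewrite ltNge xX. Qed.

Lemma integral_derive_right (c : R) :
  (\int[mu]_x ((c <= x)%R%:R * derive1 psi x)%:E = (- psi c)%:E)%E.
Proof.
have [Xc|cX] := leP X c.
  rewrite (psi_ge Xc).1 oppr0 integral0_eq// => x _.
  case: (leP c x) => cx; rewrite ?mul0r// mul1r.
  by rewrite (psi_ge (le_trans Xc cx)).2.
rewrite (integral_derive_segment (ltW cX) dpsi cpsi); last first.
  move=> x; case: (leP c x) => cx/=; rewrite ?mul0r// mul1r.
  by case: (leP x X) => // /ltW /psi_ge[].
by rewrite (psi_ge (lexx X)).1 sub0r.
Qed.

Lemma integral_derive_left (c : R) :
  (\int[mu]_x ((x <= c)%R%:R * derive1 psi x)%:E = (psi c)%:E)%E.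
Proof.
have [cX|Xc] := leP c (- X).
  rewrite (psi_le cX).1 integral0_eq// => x _.
  case: (leP x c) => cx; rewrite ?mul0r// mul1r.
  by rewrite (psi_le (le_trans cx cX)).2.
rewrite (integral_derive_segment (ltW Xc) dpsi cpsi); last first.
  move=> x; case: (leP x c) => cx/=; rewrite ?andbF ?mul0r// andbT mul1r.
  by case: (leP (- X) x) => // /ltW /psi_le[].
by rewrite (psi_le (lexx (- X))).1 subr0.
Qed.

Lemma integral_derive_line : (\int[mu]_x (derive1 psi x)%:E = 0)%E.
Proof.
rewrite (integral_derive_segment XX dpsi cpsi).
  by rewrite (psi_le (lexx _)).1 (psi_ge (lexx _)).1 subrr.
move=> x; case: ifPn => // /negP H; apply: (spsi _).2 => /andP[/ltW h1 /ltW h2].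
by apply: H; rewrite h1.
Qed.

End compact_support.

(** Change of variables along the line of a front: it turns the x-integral left over from the
    t-derivative into the t-integral of [front_trace]. *)
Lemma integral_affine_substitution (G : R -> R) (a s Z : R) : 0 < Z -> s != 0 ->
  continuous G -> (forall x, ~ (- Z <= x <= Z) -> G x = 0) ->
  (\int[mu]_x (G x)%:E = \int[mu]_t (`|s| * G (a + s * t))%:E)%E.
Proof.
move=> Z0 s0 cG G0; pose F (t : R) := a + s * t.
have dF (t : R) : is_derive t 1 F s.
  by apply: is_derive_eq; rewrite ?scaler0 ?add0r mul1r; exact: mulr1.
have cF : continuous F.
  by move=> x; apply/differentiable_continuous/derivable1_diffP; have [] := dF x.
have F'E : derive1 F = cst s.
  by apply/funext => t; rewrite derive1E; have [] := dF t.
have F'c : continuous (derive1 F) by rewrite F'E; exact: cst_continuous.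
have cvF (H : set_system R) : Filter H -> cvg (derive1 F @ H).
  by move=> FH; rewrite F'E; exact: is_cvg_cst.
have dFoo u v : derivable_oo_LRcontinuous F u v.
  split; first by move=> x _; have [] := dF x.
    by apply: cvg_at_right_filter; exact: cF.
  by apply: cvg_at_left_filter; exact: cF.
have GE x : G x = if - Z <= x <= Z then G x else 0.
  by case: ifPn => // /negP /G0.
rewrite (integral_segment_restrict GE).
have FK x : F ((x - a) / s) = x by rewrite /F; field.
have cG' : {within [set` `[- Z, Z]], continuous G} by exact: continuous_subspaceT.
have ZZ : - Z <= Z by rewrite ge0_cp// ltW.
have [sp|sn] : 0 < s \/ s < 0 by move: s0; rewrite neq_lt => /orP[]; [right|left].
- have lt_F : {homo F : x y / x < y} by move=> x y xy; rewrite /F ltrD2l ltr_pM2l.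
  have uv : (- Z - a) / s <= (Z - a) / s by rewrite ler_pM2r ?invr_gt0// lerD2r.
  have := @integration_by_substitution_increasing _ F G _ _ uv
    (fun x y _ _ => @lt_F x y) (fun x _ => F'c x) (cvF _ _) (cvF _ _) (dFoo _ _).
  rewrite !FK => ->; last exact: cG'.
  rewrite -(@integral_segment_restrict _ _
    (fun t => `|s| * G (a + s * t)))// => t.
  rewrite F'E gtr0_norm//= mulrC; case: ifPn => // /negP H.
  rewrite G0 ?mul0r// => // Hx; apply: H; move: Hx.
  by rewrite ler_pdivrMr// ler_pdivlMr// lerBlDl lerBrDl mulrC.
- have lt_F : {homo F : x y /~ x < y}.
    by move=> x y xy; rewrite /F ltrD2l ltr_nM2l.
  have uv : (Z - a) / s <= (- Z - a) / s by rewrite ler_nM2r ?invr_lt0// lerD2r.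
  have := @integration_by_substitution_decreasing _ F G _ _ uv
    (fun x y _ _ => @lt_F x y) (fun x _ => F'c x) (cvF _ _) (cvF _ _) (dFoo _ _).
  rewrite !FK => ->; last exact: cG'.
  rewrite -(@integral_segment_restrict _ _
    (fun t => `|s| * G (a + s * t)))// => t.
  rewrite F'E ltr0_norm//= mulrC; case: ifPn => // /negP H.
  rewrite G0 ?mul0r// => // Hx; apply: H; move: Hx.
  by rewrite ler_ndivrMr// ler_ndivlMr// lerBlDl lerBrDl mulrC andbC.
Qed.

Lemma derive1_bounded_lipschitz (psi : R -> R) (B : R) :
  (forall x, derivable psi x 1) -> (forall x, `|derive1 psi x| <= B) ->
  forall x y, `|psi x - psi y| <= B * `|x - y|.
Proof.
move=> dpsi bpsi x y; wlog yx : x y / y <= x => [H|].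
  by have [/H//|/ltW /H] := leP y x; rewrite distrC (distrC x).
have [||c _ ->] := @MVT_segment _ psi (derive1 psi) _ _ yx.
- by move=> z _; rewrite derive1E; exact: derivableP.
- by apply: derivable_within_continuous => z _; exact: dpsi.
by rewrite normrM ler_wpM2r.
Qed.

End line_integrals.

(** * Green's identities for the half-plane to the right of a front *)

Section plane_integrals.
Variable R : realType.
Notation mu := (@lebesgue_measure R).
Notation mu2 := (mu \x mu)%E.

Lemma integrable_compact_support (g : R * R -> R) (Y B : R) :
  measurable_fun setT g ->
  (forall x t, ~ (- Y < x < Y /\ - Y < t < Y) -> g (x, t) = 0) ->
  (forall p, `|g p| <= B) -> mu2.-integrable setT (EFin \o g).
Proof.
move=> mg g0 gB.
pose D : set (R * R) := [set` `[- Y, Y]] `*` [set` `[- Y, Y]].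
have mD : measurable D by apply: measurableX; exact: measurable_itv.
have -> : EFin \o g = (EFin \o g) \_ D.
  apply/funext => -[x t]; rewrite patchE; case: ifPn => //=.
  rewrite notin_setE => nD; rewrite g0// => -[/andP[x1 x2] /andP[t1 t2]].
  by apply: nD; split; rewrite /= in_itv/= ?(ltW x1) ?(ltW x2) ?(ltW t1) ?(ltW t2).
have [+ _] := integrable_mkcond (mu := mu2) (EFin \o g) mD; apply; apply: measurable_bounded_integrable => //.
- rewrite [ltLHS](_ : _ = (mu [set` `[(- Y)%R, Y]] * mu [set` `[(- Y)%R, Y]])%E).
    2: by apply: product_measure1E; exact: measurable_itv.
  rewrite /= lebesgue_measure_itv/=; case: ifP => _; last by rewrite mule0.
  by rewrite -EFinB -EFinM ltry.
- exact: measurable_funTS.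
- exists B; split; first exact: num_real.
  by move=> x Bx p _; apply: le_trans (gB p) _; exact: ltW.
Qed.

Lemma measurable_halfplane (a s : R) :
  measurable_fun setT (fun p : R * R => (a + s * p.2 <= p.1)%R%:R : R).
Proof.
pose h (p : R * R) : R := p.1 - (a + s * p.2).
have mh : measurable_fun setT h.
  apply: continuous_measurable_plane => p.
  apply: cvgB; first exact: cvg_fst.
  apply: cvgD; first exact: cvg_cst.
  by apply: cvgM; [exact: cvg_cst|exact: cvg_snd].
rewrite (_ : (fun _ => _) = (\1_[set` `[0, +oo[] : R -> R) \o h); last first.
  apply/funext => p /=; rewrite indicE /h; congr ((nat_of_bool _)%:R).
  apply/idP/idP => H; rewrite ?inE /= ?in_itv/= ?subr_ge0 ?andbT//.
  by move: H; rewrite inE /= in_itv/= subr_ge0 andbT.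
by apply: measurableT_comp => //; apply: measurable_indic; exact: measurable_itv.
Qed.

Section front_identities.
Variables (tau : R) (phi : R -> R -> R).
Hypothesis tf : test_function tau phi.

Lemma test_function_box : exists Y B : R, [/\ 0 < Y, 0 < B,
  forall x t : R, ~ (- Y < x < Y /\ - Y < t < Y) ->
    [/\ phi x t = 0, dphix phi x t = 0 & dphit phi x t = 0],
  forall x t, `|dphix phi x t| <= B & forall x t, `|dphit phi x t| <= B].
Proof.
have [X X0 HX] := test_function_support tf.
have [B B0 HB] := test_function_bounded tf.
exists (X + `|tau|), B; split => //.
- by rewrite ltr_wpDr.
- move=> x t H; apply: HX => -[/andP[x1 x2] /andP[t1 t2]]; apply: H.
  have := ler_norm tau; have := normr_ge0 tau => h1 h2.
  by split; apply/andP; split; move: X0 x1 x2 t1 t2 h1 h2; lra.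
- by move=> x t; have [] := HB x t.
- by move=> x t; have [] := HB x t.
Qed.

Let derx (t x : R) : derivable (fun y => phi y t) x 1.
Proof. by case: tf => /(_ x t)[]. Qed.
Let dert (x t : R) : derivable (phi x) t 1.
Proof. by case: tf => /(_ x t)[]. Qed.

Lemma test_function_dphix_continuous : continuous (fun p : R * R => dphix phi p.1 p.2).
Proof. by case: tf. Qed.
Lemma test_function_dphit_continuous : continuous (fun p : R * R => dphit phi p.1 p.2).
Proof. by case: tf. Qed.
Let phi_ge0 x t : 0 <= phi x t. Proof. by case: tf. Qed.

Let pairx (t : R) : continuous (fun x : R => (x, t)).
Proof.
by move=> x; apply: (@cvg_pair _ _ _ _ (nbhs x) (nbhs t)); [exact: cvg_id|exact: cvg_cst].
Qed.
Let pairt (x : R) : continuous (fun t : R => (x, t)).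
Proof.
by move=> t; apply: (@cvg_pair _ _ _ _ (nbhs x) (nbhs t)); [exact: cvg_cst|exact: cvg_id].
Qed.

Let cderx (t : R) : continuous (derive1 (fun y => phi y t)).
Proof.
move=> x; apply: (@continuous_comp _ _ _ (fun x : R => (x, t))
  (fun p : R * R => dphix phi p.1 p.2)); first exact: pairx.
exact: test_function_dphix_continuous.
Qed.
Let cdert (x : R) : continuous (derive1 (phi x)).
Proof.
move=> t; apply: (@continuous_comp _ _ _ (fun t : R => (x, t))
  (fun p : R * R => dphit phi p.1 p.2)); first exact: pairt.
exact: test_function_dphit_continuous.
Qed.

(** Joint continuity of a test function follows from bounds on its partial derivatives. Both
    arguments are affine so that lines parametrised by x are covered too. *)
Lemma continuous_test_function_line (a s b r : R) :
  continuous (fun t => phi (a + s * t) (b + r * t)).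
Proof.
have [Y [B [Y0 B0 _ Bx Bt]]] := test_function_box.
move=> t0; apply/(@cvgrPdist_le _ R^o) => e e0.
have K0 : 0 < B * (`|s| + `|r|) + 1.
  by rewrite ltr_wpDl// mulr_ge0// ?addr_ge0// ltW.
near=> t.
have -> : phi (a + s * t0) (b + r * t0) - phi (a + s * t) (b + r * t) =
  (phi (a + s * t0) (b + r * t0) - phi (a + s * t) (b + r * t0)) +
  (phi (a + s * t) (b + r * t0) - phi (a + s * t) (b + r * t)) by ring.
have H1 := derive1_bounded_lipschitz (@derx (b + r * t0)) (Bx^~ _)
   (a + s * t0) (a + s * t).
have H2 := derive1_bounded_lipschitz (@dert (a + s * t)) (Bt _)
   (b + r * t0) (b + r * t).
apply: (le_trans (ler_normD _ _)); apply: (le_trans (lerD H1 H2)).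
have E1 : a + s * t0 - (a + s * t) = s * (t0 - t) by ring.
have E2 : b + r * t0 - (b + r * t) = r * (t0 - t) by ring.
rewrite E1 E2 !normrM -mulrDr -mulrDl mulrA.
have tt : `|t0 - t| <= e / (B * (`|s| + `|r|) + 1).
  by near: t; apply: (@cvgr_dist_le _ R^o _ _ _ id) => //; rewrite divr_gt0.
move: tt; rewrite ler_pdivlMr// => tt; apply: le_trans tt.
rewrite mulrC ler_wpM2l// lerDl//.
Unshelve. all: by end_near. Qed.

Definition front_trace (a s : R) : \bar R := (\int[mu]_t (phi (a + s * t)%R t)%:E)%E.

Let front_line_continuous (a s : R) : continuous (fun t => phi (a + s * t) t).
Proof.
have -> : (fun t => phi (a + s * t) t) = fun t => phi (a + s * t) (0 + 1 * t).
  by apply/funext => t; rewrite add0r mul1r.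
exact: continuous_test_function_line.
Qed.

Let front_line_measurable (a s : R) :
  measurable_fun (setT : set R) (fun t => (phi (a + s * t) t)%:E).
Proof. by apply/measurable_EFinP; apply: continuous_measurable_fun. Qed.

(** Uniformity in the front is the point: the entropy defect of a superposition is estimated by its
    total cost times this constant, whatever the number of fronts. *)
Lemma front_trace_bounded :
  exists2 C : R, 0 < C & forall a s, (0 <= front_trace a s <= C%:E)%E.
Proof.
have [Y [B [Y0 B0 box Bx Bt]]] := test_function_box.
exists ((B * (Y + Y)) * (Y + Y)); first by rewrite !mulr_gt0 ?addr_gt0.
move=> a s; apply/andP; split; first by apply: integral_ge0 => t _; rewrite lee_fin.
rewrite /front_trace (@integral_segment_restrict _ (- Y) Y _ (fun t => phi (a + s * t) t)).
  apply: (@le_trans _ _ (\int[mu]_(t in [set` `[(- Y)%R, Y]]) (cst (B * (Y + Y))%:E) t)%E).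
    apply: ge0_le_integral => //; rewrite ?/cst//=.
    - by move=> t _; rewrite lee_fin.
    - by apply: measurable_funTS; exact: front_line_measurable.
    - move=> t; rewrite /= in_itv/= => /andP[t1 t2]; rewrite lee_fin.
      have := derive1_bounded_lipschitz (@dert (a + s * t)) (Bt _) t (- Y).
      have [|-> _ _] := box (a + s * t) (- Y); first by case; rewrite ltxx.
      rewrite subr0 ger0_norm// opprK => /le_trans; apply.
      rewrite ler_wpM2l ?(ltW B0)// ler_norml; move: t1 t2; lra.
  rewrite integral_cst//= lebesgue_measure_itv/= lte_fin.
  by rewrite ifT ?gtrN// opprK -EFinM.
move=> t; case: ifPn => // /negP H; have [|//] := box (a + s * t) t.
by move=> -[_ /andP[/ltW h1 /ltW h2]]; apply: H; rewrite h1.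
Qed.

Lemma integrable_front_dphix (a s : R) : mu2.-integrable setT
  (EFin \o (fun p : R * R => (a + s * p.2 <= p.1)%R%:R * dphix phi p.1 p.2)).
Proof.
have [Y [B [Y0 B0 box Bx Bt]]] := test_function_box.
apply: (@integrable_compact_support _ Y B).
- apply: measurable_funM; first exact: measurable_halfplane.
  by apply: continuous_measurable_plane; exact: test_function_dphix_continuous.
- by move=> x t /box[_ h _]; rewrite h mulr0.
- by move=> p; case: (_ + _ <= _) => /=; rewrite ?mul1r ?mul0r ?normr0 ?(ltW B0).
Qed.

Lemma integrable_front_dphit (a s : R) : mu2.-integrable setT
  (EFin \o (fun p : R * R => (a + s * p.2 <= p.1)%R%:R * dphit phi p.1 p.2)).
Proof.
have [Y [B [Y0 B0 box Bx Bt]]] := test_function_box.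
apply: (@integrable_compact_support _ Y B).
- apply: measurable_funM; first exact: measurable_halfplane.
  by apply: continuous_measurable_plane; exact: test_function_dphit_continuous.
- by move=> x t /box[_ _ h]; rewrite h mulr0.
- by move=> p; case: (_ + _ <= _) => /=; rewrite ?mul1r ?mul0r ?normr0 ?(ltW B0).
Qed.

Lemma integral_front_dphix (a s : R) :
  (\int[mu2]_p ((a + s * p.2 <= p.1)%R%:R * dphix phi p.1 p.2)%:E
   = - front_trace a s)%E.
Proof.
have [Y [B [Y0 B0 box Bx Bt]]] := test_function_box.
rewrite -[LHS](integral21_prod_meas1 (integrable_front_dphix a s)).
transitivity (\int[mu]_t (- (phi (a + s * t)%R t)%:E))%E; last first.
  by rewrite integral_ge0N// => t _; rewrite lee_fin.
apply: eq_integral => t _; rewrite /fubini_G /=.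
have spsi x : ~ (- Y < x < Y) -> phi x t = 0 /\ derive1 (fun y => phi y t) x = 0.
  by move=> nx; have [|-> h _] := box x t; first by case.
exact: (integral_derive_right (@derx t) (@cderx t) spsi (a + s * t)).
Qed.

(** At fixed [x] the slice of the half-plane is [t <= (x - a) / s] if [s > 0] and [t >= (x - a) / s]
    if [s < 0]; both leave [phi] on the front line, with the sign of [s]. For [s = 0] the slices are
    empty or whole lines and contribute nothing. *)
Lemma integral_front_dphit (a s : R) :
  (\int[mu2]_p ((a + s * p.2 <= p.1)%R%:R * dphit phi p.1 p.2)%:E
   = s%:E * front_trace a s)%E.
Proof.
have [Y [B [Y0 B0 box Bx Bt]]] := test_function_box.
have boxt x t : ~ (- Y < t < Y) -> phi x t = 0 /\ derive1 (phi x) t = 0.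
  by move=> nt; have [|-> _ h] := box x t; first by case.
rewrite -[LHS](integral12_prod_meas1 (integrable_front_dphit a s)).
have [s0|s0] := eqVneq s 0.
  rewrite s0 mul0e integral0_eq// => x _; rewrite /fubini_F /=.
  have lineE := integral_derive_line Y0 (@dert x) (@cdert x) (boxt x).
  have [ax|ax] := leP a x; last first.
    by apply: integral0_eq => t _; rewrite mul0r addr0 leNgt ax mul0r.
  rewrite -[RHS]lineE; apply: eq_integral => t _.
  by rewrite mul0r addr0 ax mul1r.
pose G x := phi x ((x - a) / s).
have GE t : G (a + s * t) = phi (a + s * t) t by rewrite /G; congr phi; field.
have cG : continuous G.
  have -> : G = fun x => phi (0 + 1 * x) (- a / s + s^-1 * x).
    by apply/funext => x; rewrite /G; congr phi; field.
  exact: continuous_test_function_line.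
have G0 x : ~ (- Y <= x <= Y) -> G x = 0.
  move=> nx; have [|//] := box x ((x - a) / s).
  by move=> -[/andP[/ltW h1 /ltW h2]]; case: nx; rewrite h1.
have sub := integral_affine_substitution a Y0 s0 cG G0.
have -> : front_trace a s = (\int[mu]_t (G (a + s * t))%:E)%E.
  by apply: eq_integral => t _; rewrite GE.
have mG : measurable_fun setT (fun t => (G (a + s * t))%:E).
  by apply/measurable_EFinP; under eq_fun do rewrite GE;
    apply: continuous_measurable_fun; exact: front_line_continuous.
have absE : (\int[mu]_x (G x)%:E = `|s|%:E * \int[mu]_t (G (a + s * t))%:E)%E.
  rewrite sub -ge0_integralZl_EFin//.
  by move=> t _; rewrite lee_fin GE.
have [sp|sn] : 0 < s \/ s < 0 by move: s0; rewrite neq_lt => /orP[]; [right|left].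
- rewrite gtr0_norm// in absE; rewrite -absE; apply: eq_integral => x _.
  rewrite /fubini_F /=.
  rewrite -[RHS](integral_derive_left (@dert x) (@cdert x) (boxt x)).
  apply: eq_integral => t _; congr ((nat_of_bool _)%:R * _)%:E.
  by rewrite ler_pdivlMr// lerBrDl mulrC.
- have sE : s = - `|s| by rewrite ltr0_norm// opprK.
  rewrite [X in (X%:E * _)%E]sE.
  rewrite EFinN mulNe -absE -integral_ge0N; last by move=> x _; rewrite lee_fin /G.
  apply: eq_integral => x _; rewrite /fubini_F /=.
  rewrite -[RHS](integral_derive_right (@dert x) (@cdert x) (boxt x)).
  apply: eq_integral => t _; congr ((nat_of_bool _)%:R * _)%:E.
  by rewrite ler_ndivrMr// lerBrDl mulrC.
Qed.

End front_identities.
End plane_integrals.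

(** * Entropy production of a single jump *)

Section kruzkov_entropies.
Variables (R : realType) (f : R -> R).
Hypothesis f_derivable : forall x : R, derivable f x 1.
Hypothesis f'_homo : {homo derive1 f : x y / x <= y}.

Definition kruzkov_entropy (k v : R) : R := `|v - k|.
Definition kruzkov_flux (k v : R) : R := Num.sg (v - k) * (f v - f k).

Lemma chord_slope_le (a b : R) : a <= b -> exists s : R,
  s * (b - a) = f b - f a /\ derive1 f a <= s <= derive1 f b.
Proof.
move=> ab; have [s [sE sP]] := chord_slope f_derivable f'_homo a b.
exists s; split => //; have := sP 1; rewrite !mul1r; apply.
by rewrite mulr1 subr_ge0.
Qed.

Lemma kruzkov_entropy_le k v : k <= v -> kruzkov_entropy k v = v - k.
Proof. by move=> kv; rewrite /kruzkov_entropy ger0_norm// subr_ge0. Qed.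
Lemma kruzkov_entropy_ge k v : v <= k -> kruzkov_entropy k v = k - v.
Proof. by move=> kv; rewrite /kruzkov_entropy ler0_norm ?subr_le0// opprB. Qed.
Lemma kruzkov_flux_le k v : k <= v -> kruzkov_flux k v = f v - f k.
Proof.
rewrite /kruzkov_flux le_eqVlt => /predU1P[->|kv]; first by rewrite !subrr mulr0.
by rewrite gtr0_sg ?subr_gt0// mul1r.
Qed.
Lemma kruzkov_flux_ge k v : v <= k -> kruzkov_flux k v = f k - f v.
Proof.
rewrite /kruzkov_flux le_eqVlt => /predU1P[->|kv]; first by rewrite !subrr mulr0.
by rewrite ltr0_sg ?subr_lt0// mulN1r opprB.
Qed.

Lemma kruzkov_entropy_lipschitz k v w :
  `|kruzkov_entropy k v - kruzkov_entropy k w| <= `|v - w|.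
Proof.
rewrite /kruzkov_entropy; apply: (le_trans (ler_dist_dist _ _)).
by rewrite opprB addrA subrK.
Qed.

(** Slopes of a convex function are controlled by those at the ends of an interval; the interval is
    enlarged to contain [k], where the flux changes branch. *)
Lemma kruzkov_flux_lipschitz m M k : exists2 C : R, 0 <= C &
  forall v w, m <= v <= M -> m <= w <= M ->
  `|kruzkov_flux k v - kruzkov_flux k w| <= C * `|v - w|.
Proof.
pose a := Num.min m k; pose b := Num.max M k.
exists (`|derive1 f a| + `|derive1 f b|); first by rewrite addr_ge0.
set C := _ + _.
have lip v w : a <= v -> v <= w -> w <= b -> `|f w - f v| <= C * (w - v).
  move=> av vw wb; have [s [<- /andP[s1 s2]]] := chord_slope_le vw.
  rewrite normrM (ger0_norm (x := w - v)) ?subr_ge0//.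
  rewrite ler_wpM2r ?subr_ge0// normr_le_endpoints//.
  by rewrite (le_trans (f'_homo av) s1) (le_trans s2 (f'_homo wb)).
have aP v : m <= v -> a <= v by move=> mv; rewrite /a ge_min mv.
have bP v : v <= M -> v <= b by move=> mv; rewrite /b le_max mv.
have ak : a <= k by rewrite /a ge_min lexx orbT.
have kb : k <= b by rewrite /b le_max lexx orbT.
move=> v w; wlog vw : v w / v <= w => [H vM wM|/andP[mv vM] /andP[mw wM]].
  by have [vw|/ltW wv] := leP v w; [exact: H|rewrite distrC (distrC v); exact: H].
rewrite (distrC v) (ger0_norm (x := w - v)) ?subr_ge0// distrC.
have [kv|/ltW vk] := leP k v.
  rewrite !kruzkov_flux_le ?(le_trans kv)// opprB addrA subrK.
  by apply: lip => //; [exact: aP|exact: bP].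
have [kw|/ltW wk] := leP k w.
  rewrite kruzkov_flux_le// kruzkov_flux_ge//.
  apply: (le_trans (ler_normB _ _)).
  have H1 := lip _ _ ak kw (bP _ wM); have H2 := lip _ _ (aP _ mv) vk kb.
  apply: (le_trans (lerD H1 H2)); rewrite -mulrDr.
  by rewrite addrA subrK.
rewrite !kruzkov_flux_ge//.
have -> : f k - f w - (f k - f v) = - (f w - f v) by ring.
by rewrite normrN; apply: lip => //; [exact: aP|exact: bP].
Qed.

(** If [k] is not strictly between the states, the production vanishes by Rankine-Hugoniot.
    Otherwise it is, up to sign, [2 (d2 - d1)] times the product of the distances to [k], over the
    height of the jump, where [d1 <= d2] are the chord slopes from [k] to the lower and the upper
    state. The sign is favourable for decreasing jumps; for increasing ones the loss is at most the
    cost. *)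
Lemma kruzkov_front_production m M tau lo hi (p : front R) k :
  front_valid f m M tau lo hi p ->
  - front_cost f false p <=
    p.1.2 * (kruzkov_entropy k p.2.2 - kruzkov_entropy k p.2.1)
    - (kruzkov_flux k p.2.2 - kruzkov_flux k p.2.1).
Proof.
case: p => -[a s] [l r] [/= sE _ _ _]; rewrite /front_cost/=.
have cost0 : 0 <= if l <= r then (r - l) * (derive1 f r - derive1 f l) else 0.
  by case: ifP => // lr; rewrite mulr_ge0// subr_ge0// f'_homo.
have [kl|lk] := leP k l; have [kr|rk] := leP k r.
- rewrite !kruzkov_entropy_le// !kruzkov_flux_le//.
  suff -> : s * (r - k - (l - k)) - (f r - f k - (f l - f k)) = 0 by rewrite oppr_le0.
  by have -> : r - k - (l - k) = r - l; [ring|rewrite sE; ring].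
- have rl : r < l by exact: lt_le_trans kl.
  rewrite (leNgt l) rl/= oppr0 kruzkov_entropy_ge ?(ltW rk)//.
  rewrite kruzkov_entropy_le// kruzkov_flux_ge ?(ltW rk)// kruzkov_flux_le//.
  have [d1 [d1E /andP[_ d1k]]] := chord_slope_le (ltW rk).
  have [d2 [d2E /andP[d2k _]]] := chord_slope_le kl.
  have d12 : d1 <= d2 by exact: le_trans d2k.
  have E : (l - r) * (s * (k - r - (l - k)) - (f k - f r - (f l - f k))) =
     2 * ((d2 - d1) * ((k - r) * (l - k))).
    have -> : f k - f r = d1 * (k - r) by [].
    have -> : f l - f k = d2 * (l - k) by [].
    have sE' : s * (r - l) = - (d1 * (k - r) + d2 * (l - k)).
      by rewrite sE d1E d2E; ring.
    transitivity (- (s * (r - l)) * (k - r - (l - k))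
      - (l - r) * (d1 * (k - r) - d2 * (l - k))); first ring.
    by rewrite sE'; ring.
  rewrite -(pmulr_rge0 _ (_ : 0 < l - r)) ?subr_gt0// E.
  by rewrite !mulr_ge0// subr_ge0// ltW.
- have lr : l <= r by rewrite (le_trans (ltW lk)).
  rewrite lr kruzkov_entropy_le// kruzkov_entropy_ge ?(ltW lk)//.
  rewrite kruzkov_flux_le// kruzkov_flux_ge ?(ltW lk)//.
  have [d1 [d1E /andP[d1l d1k]]] := chord_slope_le (ltW lk).
  have [d2 [d2E /andP[d2k d2r]]] := chord_slope_le kr.
  have ltlr : l < r by exact: lt_le_trans kr.
  have E : (r - l) * (s * (r - k - (k - l)) - (f r - f k - (f k - f l))) =
     - (2 * ((d2 - d1) * ((k - l) * (r - k)))).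
    have -> : f k - f l = d1 * (k - l) by [].
    have -> : f r - f k = d2 * (r - k) by [].
    have sE' : s * (r - l) = d1 * (k - l) + d2 * (r - k).
      by rewrite sE d1E d2E; ring.
    transitivity ((s * (r - l)) * (r - k - (k - l))
      - (r - l) * (d2 * (r - k) - d1 * (k - l))); first ring.
    by rewrite sE'; ring.
  rewrite -(ler_pM2l (_ : 0 < r - l)) ?subr_gt0// E mulrN lerN2.
  have d21 : d2 - d1 <= derive1 f r - derive1 f l by rewrite lerB.
  have kk : 2 * ((k - l) * (r - k)) <= (r - l) * (r - l).
    have -> : r - l = (k - l) + (r - k) by ring.
    have : 0 <= k - l by rewrite subr_ge0 ltW.
    have : 0 <= r - k by rewrite subr_ge0.
    move: (k - l) (r - k) => x y; nra.
  have P0 : 0 <= (k - l) * (r - k) by rewrite mulr_ge0// subr_ge0// ltW.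
  have D0 : 0 <= derive1 f r - derive1 f l by rewrite subr_ge0 f'_homo.
  move: kk d21 P0 D0; move: ((k - l) * (r - k)) (d2 - d1) (derive1 f r - derive1 f l).
  move=> P d D kk dD P0 D0.
  have h1 : d * P <= D * P by rewrite ler_wpM2r.
  have h2 : D * (2 * P) <= D * ((r - l) * (r - l)) by rewrite ler_wpM2l.
  move: h1 h2; lra.
- rewrite (kruzkov_entropy_ge (ltW lk)) (kruzkov_entropy_ge (ltW rk)).
  rewrite (kruzkov_flux_ge (ltW lk)) (kruzkov_flux_ge (ltW rk)).
  suff -> : s * (k - r - (k - l)) - (f k - f r - (f k - f l)) = 0 by rewrite oppr_le0.
  have -> : k - r - (k - l) = - (r - l) by ring.
  by rewrite mulrN sE; ring.
Qed.

End kruzkov_entropies.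

(** * Superpositions on the whole line *)

Section front_approx_line.
Variables (R : realType) (f : R -> R) (smooth : bool).
Variables (m M tau lo hi l r : R) (u : R -> R -> R).
Hypothesis lM : m <= l <= M.
Hypothesis uP : front_approx f smooth m M tau lo hi l r u.
Hypothesis ul : forall x t, x < lo -> 0 <= t <= tau -> u x t = l.
Hypothesis ur : forall x t, hi <= x -> 0 <= t <= tau -> u x t = r.

(** Outside the window all fronts lie on the same side of the point, so the superposition equals [l]
    or [r] there, as [u] does. *)
Lemma front_approx_line (eps : R) : 0 < eps -> exists L : seq (front R),
  [/\ forall p, p \in L -> front_valid f m M tau lo hi p,
      \sum_(p <- L) front_cost f smooth p <= eps,
      forall x t, 0 <= t <= tau -> `|u x t - (l + front_sum id L x t)| <= eps,
      forall x t, 0 <= t <= tau -> m <= l + front_sum id L x t <= M &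
      forall eta (x t : R), 0 <= t <= tau ->
        eta (l + front_sum id L x t) = eta l + front_sum eta L x t].
Proof.
move=> e0; have [L [L1 L2 L3 L4 L5]] := uP e0.
exists L; split => //.
- move=> x t t0.
  have [xlo|lox] := ltP x lo.
    rewrite front_sum_left ?addr0 ?ul ?subrr ?normr0 ?(ltW e0)// => p /L1[_ _ _].
    by move=> /(_ _ t0) /andP[h _]; exact: lt_le_trans h.
  have [xhi|hix] := ltP x hi; first by apply: L3; rewrite ?lox.
  rewrite front_sum_right.
    by have := L5 id => /= <-; rewrite ur// subrr normr0 ltW.
  by move=> p /L1[_ _ _] /(_ _ t0) /andP[_ h]; exact: le_trans h _.
- by move=> x t t0; apply: (front_sum_range L1 lM) => eta; exact: L4.
Qed.

Lemma front_approx_range x t : 0 <= t <= tau -> m <= u x t <= M.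
Proof.
move=> t0; apply/andP; split; apply/ler_addgt0Pr => e e0;
  have [L [_ _ /(_ x t t0) + /(_ x t t0) /andP[h1 h2] _]] := front_approx_line e0;
  rewrite ler_norml => /andP[]; move: h1 h2; lra.
Qed.

End front_approx_line.

(** * Superpositions paired with a test function *)

Section front_sums_measurable.
Variable R : realType.
Notation mu := (@lebesgue_measure R).
Notation mu2 := (mu \x mu)%E.

Lemma measurable_front_sum eta (L : seq (front R)) :
  measurable_fun setT (fun p : R * R => front_sum eta L p.1 p.2).
Proof.
apply: measurable_sum => p.
by apply: measurable_funM; [exact: measurable_cst|exact: measurable_halfplane].
Qed.

Section test.
Variables (tau : R) (phi : R -> R -> R).
Hypothesis tf : test_function tau phi.

Let J (p : front R) : R := fine (front_trace phi p.1.1 p.1.2).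

Let JE p : front_trace phi p.1.1 p.1.2 = (J p)%:E.
Proof.
have [C _ /(_ p.1.1 p.1.2)/andP[J0 JC]] := front_trace_bounded tf.
by rewrite fineK// ge0_fin_numE// (le_lt_trans JC)// ltry.
Qed.

(** By linearity one front suffices, and there Green's identities apply. Integrability is carried
    through the induction to justify additivity. *)
Lemma integral_front_sum_test eta q (L : seq (front R)) :
  let H (p : R * R) := front_sum eta L p.1 p.2 * dphit phi p.1 p.2
    + front_sum q L p.1 p.2 * dphix phi p.1 p.2 in
  mu2.-integrable setT (EFin \o H) /\
  (\int[mu2]_p (H p)%:E = (\sum_(p <- L) (p.1.2 * (eta p.2.2 - eta p.2.1)
     - (q p.2.2 - q p.2.1)) * J p)%:E)%E.
Proof.
elim: L => [|g L [IH1 IH2]] /=.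
  rewrite big_nil; have -> : EFin \o (fun p : R * R =>
    front_sum eta [::] p.1 p.2 * dphit phi p.1 p.2 +
    front_sum q [::] p.1 p.2 * dphix phi p.1 p.2) = cst 0%E.
    by apply/funext => p /=; rewrite /front_sum !big_nil !mul0r addr0.
  split; first exact: integrable0.
  by rewrite integral0_eq// => p _; rewrite /front_sum !big_nil !mul0r addr0.
set H := fun p : R * R => front_sum eta L p.1 p.2 * _ + _ in IH1 IH2.
pose ht (p : R * R) := (front_pos g p.2 <= p.1)%R%:R * dphit phi p.1 p.2.
pose hx (p : R * R) := (front_pos g p.2 <= p.1)%R%:R * dphix phi p.1 p.2.
have it : mu2.-integrable setT (EFin \o ht) := integrable_front_dphit tf g.1.1 g.1.2.
have ix : mu2.-integrable setT (EFin \o hx) := integrable_front_dphix tf g.1.1 g.1.2.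
set e := eta g.2.2 - eta g.2.1; set d := q g.2.2 - q g.2.1.
have HE (p : R * R) : (front_sum eta (g :: L) p.1 p.2 * dphit phi p.1 p.2 +
    front_sum q (g :: L) p.1 p.2 * dphix phi p.1 p.2)%:E
    = (e%:E * (ht p)%:E + d%:E * (hx p)%:E + (H p)%:E)%E.
  rewrite -!EFinM -!EFinD /H /ht /hx /front_sum !big_cons /e /d; congr EFin.
  by rewrite !mulrDl; ring.
have i1 : mu2.-integrable setT (fun p => (e%:E * (ht p)%:E)%E).
  exact: integrableZl it.
have i2 : mu2.-integrable setT (fun p => (d%:E * (hx p)%:E)%E).
  exact: integrableZl ix.
have i12 : mu2.-integrable setT (fun p => (e%:E * (ht p)%:E + d%:E * (hx p)%:E)%E).
  exact: integrableD i1 i2.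
split.
  rewrite (_ : _ \o _ = (fun p => (e%:E * (ht p)%:E + d%:E * (hx p)%:E + (H p)%:E)%E)).
    exact: integrableD i12 IH1.
  by apply/funext => p; rewrite /= -HE.
under eq_integral do rewrite HE.
rewrite integralD// integralD// (integralZl _ it)// (integralZl _ ix)// IH2.
rewrite /ht /hx [X in (_ * X + _ + _)%E](integral_front_dphit tf).
rewrite [X in (_ + _ * X + _)%E](integral_front_dphix tf) !JE.
rewrite big_cons -!EFinN -!EFinM -!EFinD; congr EFin; rewrite /e /d; ring.
Qed.

(** A constant is treated as a standing front at the edge [- Y] of the support, whose trace is zero;
    [eta] and [q] are chosen so that its jump from 0 to 1 has heights [a] and [b]. *)
Lemma integral_test_constant (a b : R) :
  let H (p : R * R) := a * dphit phi p.1 p.2 + b * dphix phi p.1 p.2 in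
  mu2.-integrable setT (EFin \o H) /\ (\int[mu2]_p (H p)%:E = 0)%E.
Proof.
have [Y [B [Y0 B0 box _ _]]] := test_function_box tf.
pose eta (v : R) : R := if v == 0 then 0 else a.
pose q (v : R) : R := if v == 0 then 0 else b.
have HE (p : R * R) : front_sum eta [:: (- Y, 0, (0, 1))] p.1 p.2 * dphit phi p.1 p.2
    + front_sum q [:: (- Y, 0, (0, 1))] p.1 p.2 * dphix phi p.1 p.2 =
    a * dphit phi p.1 p.2 + b * dphix phi p.1 p.2.
  rewrite /front_sum !big_seq1 /front_pos/= mul0r addr0.
  rewrite /eta /q oner_eq0 eqxx !subr0.
  case: (leP (- Y) p.1) => Yp; first by rewrite !mulr1.
  have [|_ -> ->] := box p.1 p.2; last by rewrite !mulr0.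
  by case=> /andP[]; rewrite ltNge (ltW Yp).
have [i1 i2] := integral_front_sum_test eta q [:: (- Y, 0, (0, 1))].
split.
  rewrite (_ : _ \o _ = EFin \o (fun p : R * R =>
    front_sum eta [:: (- Y, 0, (0, 1))] p.1 p.2 * dphit phi p.1 p.2
    + front_sum q [:: (- Y, 0, (0, 1))] p.1 p.2 * dphix phi p.1 p.2)) //.
  by apply/funext => p /=; rewrite HE.
have {i2} := i2; under eq_integral do rewrite HE.
rewrite big_seq1/= mul0r => ->.
rewrite /J/= /front_trace integral0_eq ?mulr0// => t _.
have [|-> //] := box (- Y + 0 * t) t.
by case=> /andP[]; rewrite mul0r addr0 ltxx.
Qed.

End test.
End front_sums_measurable.

(** * Continuity in time *)

Section front_time_shift.
Variable R : realType.
Notation mu := (@lebesgue_measure R).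
Notation mu2 := (mu \x mu)%E.

Lemma measurable_step (c : R) :
  measurable_fun setT (fun x : R => (c <= x)%R%:R : R).
Proof.
rewrite (_ : (fun _ => _) = (\1_[set` `[c, +oo[] : R -> R)).
  by apply: measurable_indic; exact: measurable_itv.
apply/funext => x /=; rewrite indicE; congr ((nat_of_bool _)%:R).
apply/idP/idP => H; first by rewrite inE /= in_itv/= H.
by move: H; rewrite inE /= in_itv/= andbT.
Qed.

Lemma integral_step_shift (a b c d : R) :
  (\int[mu]_(x in [set` `[a, b]]) `|(c <= x)%R%:R - (d <= x)%R%:R|%:E
   <= `|c - d|%:E)%E.
Proof.
pose E : set R := [set` `[Num.min c d, Num.max c d]].
have mE : measurable E by exact: measurable_itv.
apply: (@le_trans _ _ (\int[mu]_(x in [set` `[a, b]]) (\1_E x)%:E)%E).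
  apply: ge0_le_integral => //.
  - apply/measurable_EFinP; apply: measurable_funTS; apply: measurableT_comp => //.
    by apply: measurable_funB; exact: measurable_step.
  - apply/measurable_EFinP; apply: measurable_funTS; exact: measurable_indic.
  - move=> x _; rewrite lee_fin indicE.
    case: (leP c x) => cx; case: (leP d x) => dx /=;
      rewrite ?subrr ?normr0// ?subr0 ?sub0r ?normrN normr1 ?mem_set//.
    + by rewrite /E/= in_itv/= ge_min le_max cx (ltW dx) orbT.
    + by rewrite /E/= in_itv/= ge_min le_max dx (ltW cx) orbT.
rewrite integral_indic//.
apply: (@le_trans _ _ (mu E)).
  by apply: le_measure; rewrite ?inE//; exact: measurableI.
rewrite /E lebesgue_measure_itv/= lte_fin; case: ifP => _; last by rewrite lee_fin.
rewrite -EFinB lee_fin; have [cd|dc] := leP c d.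
  by rewrite distrC ler_norm.
by rewrite ler_norm.
Qed.

Lemma integral_front_shift (a b s t : R) (L : seq (front R)) :
  (\int[mu]_(x in [set` `[a, b]]) (\sum_(p <- L) `|p.2.2 - p.2.1| *
     `|(front_pos p s <= x)%R%:R - (front_pos p t <= x)%R%:R|)%:E
  <= ((\sum_(p <- L) `|p.2.2 - p.2.1| * `|p.1.2|) * `|s - t|)%:E)%E.
Proof.
have mstep (p : front R) : measurable_fun [set` `[a, b]]
    (fun x => `|(front_pos p s <= x)%R%:R - (front_pos p t <= x)%R%:R : R|%:E).
  apply/measurable_EFinP; apply: measurable_funTS; apply: measurableT_comp => //.
  by apply: measurable_funB; exact: measurable_step.
under eq_integral do rewrite -sumEFin; rewrite ge0_integral_sum//; last first.
  move=> p; apply/measurable_EFinP; apply: measurable_funM; first exact: measurable_cst.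
  by have /measurable_EFinP := mstep p.
rewrite mulr_suml -sumEFin; apply: lee_sum => p _.
under eq_integral do rewrite EFinM.
rewrite ge0_integralZl_EFin//; last exact: mstep.
rewrite -mulrA EFinM lee_wpmul2l// ?lee_fin//.
apply: (le_trans (integral_step_shift _ _ _ _)).
by rewrite lee_fin /front_pos opprD addrACA subrr add0r -mulrBr normrM.
Qed.

End front_time_shift.

Section front_approx_regularity.
Variables (R : realType) (f : R -> R) (smooth : bool).
Variables (m M tau lo hi l r : R) (u : R -> R -> R).
Hypothesis lM : m <= l <= M.
Hypothesis uP : front_approx f smooth m M tau lo hi l r u.
Hypothesis ul : forall x t, x < lo -> 0 <= t <= tau -> u x t = l.
Hypothesis ur : forall x t, hi <= x -> 0 <= t <= tau -> u x t = r.
Notation mu := (@lebesgue_measure R).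
Notation mu2 := (mu \x mu)%E.

Let uL := front_approx_line lM uP ul ur.

Let measurable_strip : measurable ([set: R] `*` [set` `[0, tau]]).
Proof. by apply: measurableX => //; exact: measurable_itv. Qed.

Lemma front_approx_measurable_strip :
  measurable_fun (setT `*` [set` `[0, tau]]) (fun p : R * R => u p.1 p.2).
Proof.
have /choice[L LP] : forall n : nat, exists L : seq (front R), forall x t,
    0 <= t <= tau -> `|u x t - (l + front_sum id L x t)| <= n.+1%:R^-1.
  by move=> n; have [|L [_ _ H _ _]] := uL (eps := n.+1%:R^-1); [|exists L].
apply: (@measurable_fun_cvg _ _ _ _
  (fun n (p : R * R) => l + front_sum id (L n) p.1 p.2)).
  move=> n; apply: measurable_funTS; apply: measurable_funD => //.
  exact: measurable_front_sum.
move=> [x t] [_ /=]; rewrite in_itv/= => t0.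
apply/(@cvgrPdist_le _ R^o) => e e0; near=> n.
apply: le_trans (LP n x t t0) _; apply/ltW.
near: n; exact: (near_infty_natSinv_lt (PosNum e0)).
Unshelve. all: by end_near. Qed.

Lemma front_approx_measurable (t : R) : 0 <= t <= tau ->
  measurable_fun setT (fun x => u x t).
Proof.
move=> t0; pose v := (fun p : R * R => u p.1 p.2) \_ (setT `*` [set` `[0, tau]]).
have mv : measurable_fun setT v.
  apply/(measurable_restrict _ measurable_strip) => //.
  by rewrite setTI; exact: front_approx_measurable_strip.
rewrite (_ : (fun x => u x t) = v \o (pair^~ t)).
  by apply: measurableT_comp => //; exact: pair2_measurable.
apply/funext => x; rewrite /v /= patchE mem_set//; split => //=.
Qed.

(** A superposition is Lipschitz in time with values in L1, but its constant [V] depends on the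
    superposition. So one superposition of the required accuracy is fixed first, and the distance of
    the times is chosen after it. *)
Lemma front_approx_continuous_L1 (a b t : R) : 0 <= t <= tau ->
  (\int[mu]_(x in [set` `[a, b]]) (`|u x s - u x t|)%:E)%E
     @[s --> within [set` `[0, tau]] (nbhs t)] --> 0%E.
Proof.
move=> t0; pose I s := (\int[mu]_(x in [set` `[a, b]]) (`|u x s - u x t|)%:E)%E.
have I0 s : (0 <= I s)%E by apply: integral_ge0 => x _; rewrite lee_fin.
have If s (e : R) : (I s <= e%:E)%E -> I s \is a fin_num.
  by move=> Is; rewrite (ge0_fin_numE (I0 s)) (le_lt_trans Is)// ltry.
suff Ie (e : R) : 0 < e ->
    \forall s \near within [set` `[0, tau]] (nbhs t), (I s <= e%:E)%E.
  apply/fine_cvgP; split.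
    by have := Ie 1 ltr01; apply: filterS => s; exact: If.
  apply/(@cvgrPdist_le _ R^o) => e e0; have := Ie e e0; apply: filterS => s Is.
  rewrite sub0r normrN [(_ \o _) s]/= ger0_norm; last exact: fine_ge0 (I0 s).
  by rewrite -lee_fin (fineK (If _ _ Is)).
(* With this [K], replacing [u] by the superposition at both times costs at most [e / 2] on
   [[a, b]]. *)
move=> e0; pose K := 4 * (`|b - a| + 1).
have K0 : 0 < K by rewrite mulr_gt0// ltr_wpDl.
have [|L [_ _ LP _ _]] := uL (eps := e / K); first by rewrite divr_gt0.
pose V := \sum_(p <- L) `|p.2.2 - p.2.1| * `|p.1.2|.
have V0 : 0 <= V by apply: sumr_ge0 => p _; rewrite mulr_ge0.
have mab : measurable ([set` `[a, b]] : set R) by exact: measurable_itv.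
have bound s : 0 <= s <= tau -> (I s <= (e / 2 + V * `|s - t|)%:E)%E.
  move=> s0.
  pose g x := \sum_(p <- L) `|p.2.2 - p.2.1| *
     `|(front_pos p s <= x)%R%:R - (front_pos p t <= x)%R%:R : R|.
  have g0 x : 0 <= g x by apply: sumr_ge0 => p _; rewrite mulr_ge0.
  have mg : measurable_fun setT g.
    apply: measurable_sum => p; apply: measurable_funM; first exact: measurable_cst.
    apply: measurableT_comp => //.
    by apply: measurable_funB; exact: measurable_step.
  apply: (@le_trans _ _
    (\int[mu]_(x in [set` `[a, b]]) ((2 * (e / K))%:E + (g x)%:E))%E).
    apply: ge0_le_integral => //.
    - apply/measurable_EFinP; apply: measurable_funTS; apply: measurableT_comp => //.
      by apply: measurable_funB; exact: front_approx_measurable.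
    - apply: emeasurable_funD => //.
      by apply/measurable_EFinP; exact: measurable_funTS.
    - move=> x _; rewrite -EFinD lee_fin.
      have h1 := LP x s s0; have h2 := LP x t t0.
      have h3 : `|front_sum id L x s - front_sum id L x t| <= g x.
        rewrite /front_sum -sumrB; apply: (le_trans (ler_norm_sum _ _ _)).
        by apply: ler_sum => p _; rewrite -mulrBr normrM.
      have -> : u x s - u x t = (u x s - (l + front_sum id L x s))
        - (u x t - (l + front_sum id L x t))
        + (front_sum id L x s - front_sum id L x t) by ring.
      apply: (le_trans (ler_normD _ _)); apply: lerD => //.
      by apply: (le_trans (ler_normB _ _)); rewrite mulr2n mulrDl mul1r lerD.
  rewrite ge0_integralD//; last 3 first.
  - by move=> x _; rewrite lee_fin mulr_ge0// divr_ge0// ltW.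
  - by move=> x _; rewrite lee_fin.
  - by apply/measurable_EFinP; exact: measurable_funTS.
  rewrite EFinD; apply: leeD; last exact: integral_front_shift.
  rewrite integral_cst//= lebesgue_measure_itv/= lte_fin.
  have eK0 : 0 <= 2 * (e / K) by rewrite mulr_ge0// divr_ge0// ltW.
  case: ifP => [ab|_]; last by rewrite mule0 lee_fin divr_ge0// ltW.
  rewrite -EFinB -EFinM lee_fin.
  apply: (@le_trans _ _ (2 * (e / K) * (`|b - a| + 1))).
    by rewrite ler_wpM2l// (le_trans (ler_norm _))// lerDl.
  by rewrite /K le_eqVlt; apply/orP; left; apply/eqP; field; rewrite gt_eqF// ltr_wpDl.
have dV : 0 < e / 2 / (V + 1) by rewrite !divr_gt0// ltr_wpDl.
near=> s.
have s0 : 0 <= s <= tau.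
  have : [set` `[0, tau]] s by near: s; exact: withinT.
  by rewrite /= in_itv.
apply: (le_trans (bound s s0)); rewrite lee_fin.
have st : `|s - t| <= e / 2 / (V + 1).
  near: s; apply: cvg_within; apply/nbhs_ballP; exists (e / 2 / (V + 1)) => // s ts.
  by rewrite distrC ltW.
move: st; rewrite ler_pdivlMr ?ltr_wpDl// => st.
have := normr_ge0 (s - t); move: st V0; nra.
Unshelve. all: by end_near. Qed.

End front_approx_regularity.

(** * Limits of superpositions are entropy solutions *)

Section front_approx_entropy.
Variables (R : realType) (f : R -> R).
Hypothesis f_derivable : forall x : R, derivable f x 1.
Hypothesis f'_homo : {homo derive1 f : x y / x <= y}.
Notation mu := (@lebesgue_measure R).
Notation mu2 := (mu \x mu)%E.

Lemma continuous_kruzkov_entropy k : continuous (kruzkov_entropy k : R -> R).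
Proof.
move=> /= v; apply/(@cvgrPdist_le _ R^o) => e e0; near=> w.
apply: (le_trans (kruzkov_entropy_lipschitz _ _ _)).
by near: w; apply: (@cvgr_dist_le _ R^o _ _ _ id).
Unshelve. all: by end_near. Qed.

Lemma continuous_kruzkov_flux k : continuous (kruzkov_flux f k : R -> R).
Proof.
move=> /= v; have [C C0 HC] := kruzkov_flux_lipschitz f_derivable f'_homo ((v : R) - 1) (v + 1) k.
apply/(@cvgrPdist_le _ R^o) => e e0.
have C10 : 0 < C + 1 by rewrite ltr_wpDl.
near=> w.
have vw1 : `|v - w| <= 1 by near: w; apply: (@cvgr_dist_le _ R^o _ _ _ id).
have vwe : `|v - w| <= e / (C + 1).
  by near: w; apply: (@cvgr_dist_le _ R^o _ _ _ id) => //; rewrite divr_gt0.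
apply: (le_trans (HC v w _ _)).
- by rewrite lerBlDr lerDl ler01.
- by move: vw1; rewrite ler_norml; lra.
- rewrite ler_pdivlMr// in vwe; apply: le_trans vwe.
  by rewrite mulrC ler_wpM2l// lerDl.
Unshelve. all: by end_near. Qed.

Variables (m M tau lo hi l r : R) (u : R -> R -> R).
Hypothesis lM : m <= l <= M.
Hypothesis uP : front_approx f false m M tau lo hi l r u.
Hypothesis ul : forall x t, x < lo -> 0 <= t <= tau -> u x t = l.
Hypothesis ur : forall x t, hi <= x -> 0 <= t <= tau -> u x t = r.

(** The entropy relation in [front_approx] turns a nonlinear entropy of the superposition into a sum
    over fronts, whose integral is at least minus cost times trace. Replacing [u] by the
    superposition costs a multiple of [eps] times the L1 norm of the derivatives of [phi]. *)
Lemma front_approx_kruzkov k phi : test_function tau phi ->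
  (0 <= kruzkov_integral f tau u k phi)%E.
Proof.
move=> tf.
pose D0 : set (R * R) := setT `*` [set` `]0, tau[].
have mD0 : measurable D0 by apply: measurableX => //; exact: measurable_itv.
pose eta := kruzkov_entropy k; pose q := kruzkov_flux f k.
pose g (p : R * R) := eta (u p.1 p.2) * dphit phi p.1 p.2
  + q (u p.1 p.2) * dphix phi p.1 p.2.
pose G := g \_ D0.
have -> : kruzkov_integral f tau u k phi = (\int[mu2]_p (G p)%:E)%E.
  rewrite /kruzkov_integral integral_mkcond; apply: eq_integral => p _.
  by rewrite /G !patchE; case: ifP.
have [X X0 supp] := test_function_support tf.
have mt : measurable_fun setT (fun p : R * R => dphit phi p.1 p.2).
  apply: continuous_measurable_plane; exact: test_function_dphit_continuous tf.
have mx : measurable_fun setT (fun p : R * R => dphix phi p.1 p.2).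
  apply: continuous_measurable_plane; exact: test_function_dphix_continuous tf.
have mG : measurable_fun setT G.
  apply/(measurable_restrict _ mD0) => //; rewrite setTI.
  have mu_ : measurable_fun D0 (fun p : R * R => u p.1 p.2).
    apply: measurable_funS (front_approx_measurable_strip lM uP ul ur).
      by apply: measurableX => //; exact: measurable_itv.
    move=> [x t] [_ /=]; rewrite in_itv/= => /andP[t1 t2]; split => //=.
    by rewrite in_itv/= !ltW.
  apply: measurable_funD; apply: measurable_funM.
  - apply: (measurableT_comp (f := eta)) => //.
    by apply: continuous_measurable_fun; exact: continuous_kruzkov_entropy.
  - exact: measurable_funTS.
  - apply: (measurableT_comp (f := q)) => //.
    by apply: continuous_measurable_fun; exact: continuous_kruzkov_flux.
  - exact: measurable_funTS.
pose E (p : R * R) := `|dphit phi p.1 p.2| + `|dphix phi p.1 p.2|.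
have iE : mu2.-integrable setT (EFin \o E).
  have [i1 _] := integral_test_constant tf 1 0.
  have [i2 _] := integral_test_constant tf 0 1.
  have := integrableD measurableT (integrable_norm i1) (integrable_norm i2).
  rewrite (_ : (_ \+ _)%E = EFin \o E)//; apply/funext => p /=.
  by rewrite -EFinD !mul0r !mul1r addr0 add0r.
have [Cq Cq0 qlip] := kruzkov_flux_lipschitz f_derivable f'_homo m M k.
have [C C0 HC] := front_trace_bounded tf.
pose A := fine (\int[mu2]_p (E p)%:E)%E.
have Afin : (\int[mu2]_p (E p)%:E)%E \is a fin_num by exact: integrable_fin_num iE.
have A0 : 0 <= A by apply: fine_ge0; apply: integral_ge0 => p _; rewrite lee_fin addr_ge0.
apply/lee_addgt0Pr => e e0.
(* With tolerance [e / B], the defect [eps * C] of the superposition and the error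
   [eps * (1 + Cq) * A] of the replacement together stay below [e]. *)
pose B := C + (1 + Cq) * A + 1.
have CA0 : 0 <= (1 + Cq) * A by rewrite mulr_ge0// addr_ge0.
have B0 : 0 < B by rewrite ltr_wpDl// addr_ge0// ltW.
have eB0 : 0 < e / B by rewrite divr_gt0.
have [L [L1 L2 L3 L4 L5]] := front_approx_line lM uP ul ur eB0.
set eps := e / B in eB0 L2 L3 *.
pose H1 (p : R * R) := eta l * dphit phi p.1 p.2 + q l * dphix phi p.1 p.2.
pose H2 (p : R * R) := front_sum eta L p.1 p.2 * dphit phi p.1 p.2
    + front_sum q L p.1 p.2 * dphix phi p.1 p.2.
have [iH1 IH1] := integral_test_constant tf (eta l) (q l).
have [iH2 IH2] := integral_front_sum_test tf eta q L.
pose c := eps * (1 + Cq).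
have c0 : 0 <= c by rewrite mulr_ge0 ?addr_ge0// ltW.
have GH p : `|G p - (H1 p + H2 p)| <= c * E p.
  rewrite /G patchE; case: ifPn => [|nD]; last first.
    have [|_ px pt] := supp p.1 p.2.
      move=> [_ t0]; move: nD; rewrite notin_setE; apply.
      by split; rewrite //= in_itv.
    by rewrite /H1 /H2 /E px pt !mulr0 !addr0 subrr normr0 addr0 mulr0.
  rewrite inE => -[_ /=]; rewrite in_itv/= => /andP[t1 t2].
  have t0 : 0 <= p.2 <= tau by rewrite !ltW.
  have rg := front_approx_range lM uP ul ur p.1 t0.
  have -> : g p - (H1 p + H2 p) =
     (eta (u p.1 p.2) - eta (l + front_sum id L p.1 p.2)) * dphit phi p.1 p.2 +
     (q (u p.1 p.2) - q (l + front_sum id L p.1 p.2)) * dphix phi p.1 p.2.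
    by rewrite !L5// /g /H1 /H2; ring.
  apply: (le_trans (ler_normD _ _)); rewrite !normrM /E mulrDr.
  have he := kruzkov_entropy_lipschitz k (u p.1 p.2) (l + front_sum id L p.1 p.2).
  have hq := qlip _ _ rg (L4 p.1 p.2 t0).
  have hu := L3 p.1 p.2 t0.
  apply: lerD; apply: ler_wpM2r => //.
    apply: (le_trans he); apply: (le_trans hu).
    by rewrite /c ler_peMr ?(ltW eB0)// lerDl.
  apply: (le_trans hq).
  apply: (@le_trans _ _ (Cq * eps)); first by rewrite ler_wpM2l.
  by rewrite /c mulrC ler_wpM2l ?(ltW eB0)// lerDr.
have iH : mu2.-integrable setT (fun p => ((H1 p)%:E + (H2 p)%:E)%E).
  exact: integrableD iH1 iH2.
have icE : mu2.-integrable setT (fun p => (c%:E * (E p)%:E)%E).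
  exact: integrableZl iE.
have iG : mu2.-integrable setT (EFin \o G).
  have iF := integrableD measurableT (integrable_abse iH) icE.
  apply: le_integrable iF => //; first exact/measurable_EFinP.
  move=> p _; rewrite /= lee_fin.
  apply: le_trans (ler_norm _).
  have -> : G p = (H1 p + H2 p) + (G p - (H1 p + H2 p)) by ring.
  by apply: (le_trans (ler_normD _ _)); apply: lerD.
have low : ((\int[mu2]_p ((H1 p)%:E + (H2 p)%:E)) - (c * A)%:E <= \int[mu2]_p (G p)%:E)%E.
  have -> : (c * A)%:E = (\int[mu2]_p (c%:E * (E p)%:E))%E.
    by rewrite (integralZl _ iE)// EFinM /A fineK.
  rewrite -integralB//; apply: le_integral => //; first exact: integrableB.
  move=> p _; rewrite /= lee_fin.
  by have := GH p; rewrite ler_norml => /andP[+ _]; lra.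
have IH : (\int[mu2]_p ((H1 p)%:E + (H2 p)%:E) >= (- (eps * C))%:E)%E.
  rewrite integralD// [X in (X + _)%E]IH1 [X in (_ + X)%E]IH2 add0e lee_fin.
  apply: (@le_trans _ _ (- (\sum_(p <- L) front_cost f false p) * C)).
    by rewrite mulNr lerN2 ler_wpM2r// ltW.
  rewrite -sumrN mulr_suml big_seq [leRHS]big_seq; apply: ler_sum => p pL.
  have prod := kruzkov_front_production f_derivable f'_homo k (L1 p pL).
  have [J0 JC] : 0 <= fine (front_trace phi p.1.1 p.1.2) /\
      fine (front_trace phi p.1.1 p.1.2) <= C.
    have /andP[J0 JC] := HC p.1.1 p.1.2; rewrite fine_ge0//; split => //.
    by rewrite -lee_fin fineK// ge0_fin_numE// (le_lt_trans JC)// ltry.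
  have cost0 : 0 <= front_cost f false p.
    rewrite /front_cost/=; case: ifP => // lr.
    by rewrite mulr_ge0// subr_ge0// f'_homo.
  apply: (@le_trans _ _ (- front_cost f false p * fine (front_trace phi p.1.1 p.1.2))).
    by rewrite !mulNr lerN2 ler_wpM2l.
  by rewrite ler_wpM2r.
apply: (@le_trans _ _ (((- (eps * C))%:E - (c * A)%:E) + e%:E)%E).
  rewrite -EFinB -EFinD lee_fin.
  have -> : e = eps * B by rewrite /eps divfK// gt_eqF.
  have -> : - (eps * C) - c * A + eps * B = eps by rewrite /B /c; ring.
  exact: ltW.
by apply: leeD => //; apply: le_trans low; apply: leeB.
Qed.

Theorem front_approx_entropy_solution : entropy_solution f tau (u^~ 0) u.
Proof.
split => //.
- exact: front_approx_measurable_strip lM uP ul ur.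
- exists (`|m| + `|M|) => x t t0; apply: normr_le_endpoints.
  exact: (front_approx_range lM uP ul ur x t0).
- by move=> k phi; exact: front_approx_kruzkov.
- by move=> a b t t0; exact: (front_approx_continuous_L1 lM uP ul ur a b t0).
Qed.

End front_approx_entropy.

(** * Grids, averages and W_1 *)

Section primitive.
Variable R : realType.
Notation mu := (@lebesgue_measure R).

(** The primitive is a section integral over the half-plane [y <= x], so Tonelli's theorem applies
    to the positive and the negative part. *)
Lemma measurable_primitive (h : R -> R) : measurable_fun setT h ->
  measurable_fun setT (fun x : R => \int[mu]_(y in [set` `]-oo, x]]) (h y)%:E)%E.
Proof.
move=> mh.
have pos (g : R -> \bar R) : measurable_fun setT g -> (forall y, 0 <= g y)%E ->
    measurable_fun setT (fun x : R => \int[mu]_(y in [set` `]-oo, x]]) g y)%E.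
  move=> mg g0.
  pose F (p : R * R) := (g p.2 * ((0 + 1 * p.2 <= p.1)%R%:R)%:E)%E.
  have mF : measurable_fun setT F.
    apply: emeasurable_funM; first by apply: measurableT_comp.
    by apply/measurable_EFinP; exact: measurable_halfplane.
  have F0 p : (0 <= F p)%E by rewrite mule_ge0// lee_fin.
  have := measurable_fun_fubini_tonelli_F (m2 := mu) F mF F0.
  rewrite (_ : fubini_F _ _ = fun x : R => \int[mu]_(y in [set` `]-oo, x]]) g y)%E//.
  apply/funext => x; rewrite [RHS]integral_mkcond; apply: eq_integral => y _.
  rewrite /F /= add0r mul1r patchE; case: ifPn => H.
    by move: H; rewrite inE/= in_itv/= => ->; rewrite mule1.
  by move: H; rewrite notin_setE/= in_itv/= => /negP/negPf->; rewrite mule0.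
rewrite (_ : (fun _ => _) = (fun x =>
    (\int[mu]_(y in [set` `]-oo, x]]) (EFin \o h)^\+ y) -
    (\int[mu]_(y in [set` `]-oo, x]]) (EFin \o h)^\- y))%E); last first.
  by apply/funext => x; rewrite integralE.
have mEh : measurable_fun setT (EFin \o h : R -> \bar R) by exact/measurable_EFinP.
apply: emeasurable_funB; apply: pos => //.
- exact: measurable_funepos.
- exact: measurable_funeneg.
Qed.

End primitive.

Lemma int_absS_bounds (j : int) : - (`|j|.+1)%:Z <= j /\ j + 1 <= (`|j|.+1)%:Z.
Proof. by split; lia. Qed.

(** * Grids and cellwise estimates *)

Section grid.
Variables (R : realType) (o dx : R).
Hypothesis dx0 : 0 < dx.
Notation mu := (@lebesgue_measure R).

Definition grid_point (i : int) : R := o + i%:~R * dx.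

Lemma grid_pointD i (n : nat) : grid_point (i + n%:Z) = grid_point i + n%:R * dx.
Proof. by rewrite /grid_point intrD mulrDl addrA. Qed.

Lemma grid_point_le i (n : nat) : grid_point i <= grid_point (i + n%:Z).
Proof. by rewrite grid_pointD lerDl mulr_ge0// ltW. Qed.

Lemma grid_point_lt i : grid_point i < grid_point (i + 1).
Proof. by rewrite (grid_pointD i 1) mul1r ltrDl. Qed.

Lemma cellE i x : cell o dx i x <-> grid_point i <= x < grid_point (i + 1).
Proof. by rewrite /cell /= in_itv. Qed.

Lemma cell_floor i x : cell o dx i x <-> Num.floor ((x - o) / dx) = i.
Proof.
rewrite cellE /grid_point -lerBrDl -ltrBlDl -ler_pdivlMr// -ltr_pdivrMr//.
by rewrite -floor_eq; split=> /eqP.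
Qed.

Lemma piecewise_constant_cell (c : int -> R) i x :
  cell o dx i x -> piecewise_constant o dx c x = c i.
Proof. by move=> /cell_floor xi; rewrite /piecewise_constant xi. Qed.

Lemma mem_cell_floor x : cell o dx (Num.floor ((x - o) / dx)) x.
Proof. exact/cell_floor. Qed.

Lemma measurable_cell i : measurable (cell o dx i).
Proof. exact: measurable_itv. Qed.

Lemma lebesgue_measure_cell i : mu (cell o dx i) = dx%:E.
Proof.
rewrite /cell lebesgue_measure_itv/= lte_fin ifT; last exact: grid_point_lt.
by rewrite -EFinB intrD mulrDl mul1r; congr EFin; ring.
Qed.

Lemma measurable_piecewise_constant (c : int -> R) :
  measurable_fun setT (piecewise_constant o dx c).
Proof.
pose h (n : nat) (x : R) : R := \sum_(i < n) (c i%:Z * \1_(cell o dx i%:Z) x +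
  c (- (i.+1%:Z)) * \1_(cell o dx (- (i.+1%:Z))) x).
have mh n : measurable_fun setT (h n).
  apply: measurable_sum => i; apply: measurable_funD; apply: measurable_funM => //;
    by apply: measurable_indic; exact: measurable_cell.
apply: (measurable_fun_cvg mh) => x _.
apply: cvg_near_cst.
pose j := Num.floor ((x - o) / dx).
have jP i : \1_(cell o dx i) x = (i == j)%:R :> R.
  rewrite indicE; congr ((nat_of_bool _)%:R); apply/idP/eqP.
    by rewrite inE => /cell_floor.
  by move=> ->; rewrite inE; exact: mem_cell_floor.
exists `|j|.+1 => // n /= jn; rewrite /h /piecewise_constant -/j.
under eq_bigr do rewrite !jP.
case: j jn {jP} => [j|j] /= jn.
  rewrite (bigD1 (Ordinal jn))//= eqxx mulr1 big1 ?addr0; first by rewrite mulr0 addr0.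
  move=> i ij; rewrite (_ : (_ == _) = false) ?mulr0 ?add0r.
    by rewrite ?mulr0.
  by apply/negbTE/eqP => -[] ij'; move/eqP: ij; apply; apply/val_inj.
have jn' : (j < n)%N by exact: leq_trans jn.
rewrite (bigD1 (Ordinal jn'))//= NegzE eqxx mulr1 big1 ?addr0; first by rewrite mulr0 add0r.
move=> i ij; rewrite mulr0 add0r.
rewrite (_ : (_ == _) = false) ?mulr0//.
by apply/negbTE/eqP => /oppr_inj [] ij'; move/eqP: ij; apply; apply/val_inj.
Qed.

Lemma windowS a (n : nat) : [set` `[grid_point a, grid_point (a + n.+1%:Z)[] =
  [set` `[grid_point a, grid_point (a + n%:Z)[] `|` cell o dx (a + n%:Z).
Proof.
have an : a + n.+1%:Z = a + n%:Z + 1 by rewrite -addrA -natz -natz -(natrD _ n 1) addn1.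
rewrite an /cell -!/(grid_point _).
apply: itv_bndbnd_setU; rewrite bnd_simp; first exact: grid_point_le.
exact/ltW/grid_point_lt.
Qed.

Lemma window_cell_disjoint a (n : nat) :
  [disjoint [set` `[grid_point a, grid_point (a + n%:Z)[] & cell o dx (a + n%:Z)].
Proof.
apply/disj_setPS => x []; rewrite /= in_itv/= => /andP[_ h] /cellE/andP[h' _].
by move: h; rewrite ltNge h'.
Qed.

Lemma integral_window_le (f : R -> \bar R) (v : R -> R) (K : R) : 0 <= K ->
  measurable_fun setT f -> (forall x, 0 <= f x)%E ->
  (forall i x, cell o dx i x ->
    (f x <= K%:E * total_variation (grid_point i) (grid_point (i + 1)) v)%E) ->
  forall a (n : nat),
  (\int[mu]_(x in [set` `[grid_point a, grid_point (a + n%:Z)[]) f x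
    <= (K * dx)%:E * total_variation (grid_point a) (grid_point (a + n%:Z)) v)%E.
Proof.
move=> K0 mf f0 fle a; elim=> [|n IH].
  by rewrite addr0 set_itvco0 integral_set0 total_variationxx mule0.
rewrite windowS ge0_integral_setU//; last 3 first.
- exact: measurable_cell.
- exact: measurable_funTS.
- exact: window_cell_disjoint.
have an : a + n.+1%:Z = a + n%:Z + 1 by rewrite -addrA -natz -natz -(natrD _ n 1) addn1.
have le1 := grid_point_le a n; have le2 := ltW (grid_point_lt (a + n%:Z)).
rewrite an (total_variationD _ le1 le2) ge0_muleDr; last 2 first.
- exact: total_variation_ge0.
- exact: total_variation_ge0.
apply: leeD => //.
apply: (@le_trans _ _ (\int[mu]_(x in cell o dx (a + n%:Z))
  cst (K%:E * total_variation (grid_point (a + n%:Z)) (grid_point (a + n%:Z + 1)) v) x)%E).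
  apply: ge0_le_integral => //; first exact: measurable_cell.
    exact: measurable_funTS.
  by move=> x xi; exact: fle.
rewrite integral_cst; last exact: measurable_cell.
by rewrite [X in (_ * X <= _)%E]lebesgue_measure_cell EFinM muleAC.
Qed.

(** Variation is additive over adjacent cells, and symmetric windows exhaust the line by monotone
    convergence. For averaging this is used twice: for the error and for its primitive. *)
Lemma integral_le_variation (f : R -> \bar R) (v : R -> R) (K : R) : 0 <= K ->
  measurable_fun setT f -> (forall x, 0 <= f x)%E ->
  (forall i x, cell o dx i x ->
    (f x <= K%:E * total_variation (grid_point i) (grid_point (i + 1)) v)%E) ->
  (\int[mu]_x f x <= (K * dx)%:E * total_variationR v)%E.
Proof.
move=> K0 mf f0 fle.
pose W (n : nat) : set R := [set` `[grid_point (- n%:Z), grid_point (- n%:Z + (n + n)%:Z)[].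
have WE n : - n%:Z + (n + n)%:Z = n%:Z by rewrite PoszD addKr.
have Wcov : \bigcup_n W n = setT.
  apply/seteqP; split => // x _; pose j := Num.floor ((x - o) / dx).
  exists `|j|.+1 => //; rewrite /W /= in_itv/= WE.
  have /cellE/andP[h1 h2] := mem_cell_floor x; rewrite -/j in h1 h2.
  have mono i k : (i <= k)%R -> grid_point i <= grid_point k.
    by move=> ik; rewrite lerD2l ler_pM2r// ler_int.
  have jB := int_absS_bounds j.
  by rewrite (le_trans (mono _ _ jB.1))// (lt_le_trans h2 (mono _ _ jB.2)).
have Wmono : {homo W : n m / (n <= m)%N >-> (n <= m)%O}.
  move=> n m nm; apply/subsetPset => x; rewrite /W /= !in_itv/= !WE.
  have mono i k : (i <= k)%R -> grid_point i <= grid_point k.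
    by move=> ik; rewrite lerD2l ler_pM2r// ler_int.
  move=> /andP[h1 h2]; rewrite (le_trans (mono _ _ _) h1)/= ?lerN2 ?lez_nat//.
  by rewrite (lt_le_trans h2)// mono// lez_nat.
have cv : (\int[mu]_(x in W n) f x)%E @[n --> \oo]
    --> (\int[mu]_(x in \bigcup_n W n) f x)%E.
  apply: ge0_nondecreasing_set_cvg_integral => //.
  - by move=> n; exact: measurable_itv.
  - by move=> n; exact: measurable_funTS.
rewrite Wcov in cv; rewrite -(cvg_lim _ cv)//; apply: lime_le; first by apply/cvg_ex; eexists; exact: cv.
near=> n; apply: (le_trans (integral_window_le K0 mf f0 fle _ _)).
apply: lee_wpmul2l; first by rewrite lee_fin mulr_ge0// ltW.
apply: ereal_sup_ubound; exists (grid_point (- n%:Z), grid_point (- n%:Z + (n + n)%:Z)) => //=.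
exact: grid_point_le.
Unshelve. all: by end_near. Qed.

End grid.

(** * The W_1 error of cell averaging *)

Section wasserstein_average.
Variables (R : realType) (o dx : R).
Hypothesis dx0 : 0 < dx.
Notation mu := (@lebesgue_measure R).
Notation gp := (grid_point o dx).

Lemma distance_le_total_variation (v : R -> R) (a b x y : R) :
  a <= x <= b -> a <= y <= b -> (`|v y - v x|%:E <= total_variation a b v)%E.
Proof.
wlog xy : x y / x <= y => [H xab yab|/andP[ax xb] /andP[ay yb]].
  by have [xy|/ltW yx] := leP x y; [exact: H|rewrite distrC; exact: H].
rewrite (total_variationD v ax xb) (total_variationD v xy yb).
apply: (@le_trans _ _ (total_variation x y v)); first exact: total_variation_ge.
apply: (@le_trans _ _ (total_variation x y v + total_variation y b v)%E).
  by rewrite leeDl// total_variation_ge0.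
by rewrite leeDr// total_variation_ge0.
Qed.

Lemma total_variationR_ge (v : R -> R) (a b : R) : a <= b ->
  (total_variation a b v <= total_variationR v)%E.
Proof. by move=> ab; apply: ereal_sup_ubound; exists (a, b). Qed.

Section integrable_bounded_variation.
Variable v : R -> R.
Hypothesis iv : mu.-integrable setT (EFin \o v).
Hypothesis tv : (total_variationR v < +oo)%E.

Let h (x : R) : R := average o dx v x - v x.
Let t (i : int) : R := fine (total_variation (gp i) (gp (i + 1)) v).

Let mv : measurable_fun setT v.
Proof. by apply/measurable_EFinP; exact: measurable_int iv. Qed.

Let icell i : mu.-integrable (cell o dx i) (EFin \o v).
Proof. by apply: integrableS iv => //; exact: measurable_cell. Qed.

Let tE i : total_variation (gp i) (gp (i + 1)) v = (t i)%:E.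
Proof.
have le := ltW (grid_point_lt o dx0 i).
rewrite fineK// ge0_fin_numE ?total_variation_ge0//.
by apply: le_lt_trans tv; exact: total_variationR_ge.
Qed.

Let icst i (c : R) : mu.-integrable (cell o dx i) (EFin \o cst c).
Proof.
apply: measurable_bounded_integrable => //; first exact: measurable_cell.
  by have /= -> := lebesgue_measure_cell o dx0 i; rewrite ltry.
exists `|c|; split; first exact: num_real.
by move=> x cx y _; exact: ltW.
Qed.

Let Rint_cst i (c : R) : \int[mu]_(x in cell o dx i) c = c * dx.
Proof.
rewrite Rintegral_cst; last exact: measurable_cell.
by have /= -> := lebesgue_measure_cell o dx0 i.
Qed.

Let hcell i x : cell o dx i x -> h x = dx^-1 * \int[mu]_(y in cell o dx i) (v y - v x).
Proof.
move=> xi; rewrite /h /average (piecewise_constant_cell dx0 _ xi) /cell_average.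
rewrite RintegralB; [|exact: measurable_cell|exact: icell|exact: icst].
by rewrite Rint_cst; field; rewrite gt_eqF.
Qed.

Let h_le i x : cell o dx i x -> `|h x| <= t i.
Proof.
move=> xi; rewrite (hcell xi) normrM gtr0_norm ?invr_gt0// mulrC ler_pdivrMr//.
have iB : mu.-integrable (cell o dx i) (EFin \o (fun y => v y - v x)).
  rewrite (_ : _ \o _ = ((EFin \o v) \- (EFin \o cst (v x)))%E)//.
  by apply: integrableB; [exact: measurable_cell|exact: icell|exact: icst].
have le := le_normr_Rintegral _ iB; apply: (le_trans (le _)); first exact: measurable_cell.
rewrite -(Rint_cst i); apply: le_Rintegral; [exact: measurable_cell| |exact: icst|].
  exact: integrable_norm iB.
move=> y yi; rewrite -lee_fin -tE.
move: xi yi => /cellE/andP[x1 /ltW x2] /cellE/andP[y1 /ltW y2].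
by apply: distance_le_total_variation; rewrite ?x1 ?y1.
Qed.

Let mh : measurable_fun setT h.
Proof. by apply: measurable_funB => //; exact: measurable_piecewise_constant. Qed.

Let ih : mu.-integrable setT (EFin \o h).
Proof.
apply/integrableP; split; first exact/measurable_EFinP.
apply: (@le_lt_trans _ _ ((1 * dx)%:E * total_variationR v)%E).
  apply: (@integral_le_variation _ o dx dx0 _ v 1) => //.
    by apply: measurableT_comp => //; exact/measurable_EFinP.
  by move=> i x xi; rewrite mul1e tE lee_fin h_le.
rewrite mul1r; apply: lte_mul_pinfty => //; first by rewrite lee_fin ltW.
Qed.

Let h_cell0 i : (\int[mu]_(x in cell o dx i) (h x)%:E = 0)%E.
Proof.
have -> : (\int[mu]_(x in cell o dx i) (h x)%:E =
    \int[mu]_(x in cell o dx i) ((cst (cell_average o dx v i)%:E x) - (v x)%:E))%E.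
  apply: eq_integral => x; rewrite inE => xi.
  by rewrite /h /average (piecewise_constant_cell dx0 _ xi).
rewrite integralB; [|exact: measurable_cell|exact: icst|exact: icell].
rewrite integral_cst; last exact: measurable_cell.
rewrite [X in (_ * X - _)%E](lebesgue_measure_cell o dx0 i).
have -> : (\int[mu]_(x in cell o dx i) (v x)%:E =
    (\int[mu]_(x in cell o dx i) v x)%:E)%E.
  by rewrite /Rintegral fineK//; apply: integrable_fin_num (icell i); exact: measurable_cell.
by rewrite -EFinM -EFinB /cell_average mulrAC mulVf ?gt_eqF// mul1r subrr.
Qed.

(** The error has mean zero on each cell, hence its primitive vanishes at every grid point;
    integrability on the line justifies the sum over infinitely many cells. *)
Let h_left0 i : (\int[mu]_(x in [set` `]-oo, (gp i)[]) (h x)%:E = 0)%E.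
Proof.
pose F (k : nat) := cell o dx (i - k.+1%:Z).
have FE : [set` `]-oo, (gp i)[] = \bigcup_k F k.
  apply/seteqP; split => x.
    rewrite /= in_itv/= => xi; pose j := Num.floor ((x - o) / dx).
    have xj := mem_cell_floor o dx0 x; rewrite -/j in xj.
    have ji : (j < i)%R.
      move: xj => /cellE/andP[jx _]; have := le_lt_trans jx xi.
      by rewrite /grid_point ltrD2l ltr_pM2r// ltr_int.
    exists (absz (i - j - 1)%R) => //.
    suff e : i - (absz (i - j - 1)%R).+1%:Z = j by rewrite -e in xj.
    by move: ji; clear; lia.
  move=> [k _ /cellE/andP[_ xk]]; rewrite /= in_itv/=; apply: lt_le_trans xk _.
  rewrite /grid_point lerD2l ler_pM2r// ler_int; clear; lia.
have mF k : measurable (F k) by exact: measurable_cell.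
rewrite FE integral_bigcup//.
- by rewrite eseries0// => k _ _; exact: h_cell0.
- apply/trivIsetP => k l _ _ kl; apply/seteqP; split => // x [].
  move=> /(cell_floor _ dx0) e1 /(cell_floor _ dx0) e2.
  by move: (etrans (esym e1) e2) => /addrI/oppr_inj[] kl'; rewrite kl' eqxx in kl.
- by apply: integrableS ih => //; apply: bigcup_measurable => k _; exact: mF.
Qed.

Let primitive_le i x : cell o dx i x ->
  (`|\int[mu]_(y in [set` `]-oo, x]]) (h y)%:E| <= dx%:E * (t i)%:E)%E.
Proof.
move=> xi; have /cellE/andP[x1 x2] := xi.
have -> : [set` `]-oo, x]] = [set` `]-oo, (gp i)[] `|` [set` `[(gp i), x]].
  by apply: itv_bndbnd_setU; rewrite bnd_simp.
rewrite integral_setU; last 4 first.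
- exact: measurable_itv.
- exact: measurable_itv.
- by apply: measurable_funTS; exact/measurable_EFinP.
- apply/disj_setPS => y []; rewrite /= !in_itv/= => yi /andP[iy _].
  by move: yi; rewrite ltNge iy.
rewrite h_left0 add0e.
have mI : measurable ([set` `[(gp i), x]] : set R) by exact: measurable_itv.
have iI : mu.-integrable [set` `[(gp i), x]] (EFin \o h) by apply: integrableS ih.
apply: (le_trans (le_abse_integral _ _ _)) => //; first exact: measurable_int iI.
have sub : [set` `[(gp i), x]] `<=` cell o dx i.
  move=> y; rewrite /= in_itv/= => /andP[y1 y2]; apply/cellE.
  by rewrite y1 (le_lt_trans y2).
apply: (@le_trans _ _ (\int[mu]_(y in [set` `[(gp i), x]]) cst (t i)%:E y)%E).
  apply: ge0_le_integral => //.
  - by apply: measurableT_comp => //; exact: measurable_int iI.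
  - by move=> y /sub yi; rewrite lee_fin h_le.
rewrite integral_cst// muleC; apply: lee_wpmul2r.
  by rewrite -tE total_variation_ge0// ltW// grid_point_lt.
have /= <- := lebesgue_measure_cell o dx0 i.
by apply: le_measure; rewrite ?inE//; exact: measurable_cell.
Qed.

(** Inside a cell the error is at most the local variation and its primitive starts from zero: one
    factor [dx]. Integrating the primitive over the cell gives the second. *)
Lemma wasserstein1_average_fin :
  (wasserstein1 (average o dx v) v <= (dx ^+ 2)%:E * total_variationR v)%E.
Proof.
rewrite expr2; apply: (@integral_le_variation _ o dx dx0 _ v dx) => //.
- exact: ltW.
- by apply: measurableT_comp => //; exact: measurable_primitive.
- by move=> i x xi; rewrite tE; exact: primitive_le.
Qed.

End integrable_bounded_variation.

Lemma wasserstein1_average (v : R -> R) :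
  mu.-integrable setT (EFin \o v) ->
  (wasserstein1 (average o dx v) v <= (dx ^+ 2)%:E * total_variationR v)%E.
Proof.
move=> iv; have [tv|] := ltP (total_variationR v) +oo%E.
  exact: wasserstein1_average_fin.
rewrite leye_eq => /eqP ->; rewrite gt0_muley ?leey// lte_fin.
by rewrite exprn_gt0.
Qed.

End wasserstein_average.

Lemma projection_operator_id (R : realType) :
  projection_operator (fun (_ _ : R) (w : R -> R) => w).
Proof.
split; first by move=> o dx c _; split => //; exists c.
exists 1; split => // o dx v dx0 iv; rewrite mul1r.
exact: wasserstein1_average.
Qed.

(** * The upwind scheme *)

Section weighted_integrals.
Variable R : realType.
Notation mu := (@lebesgue_measure R).

Section weight.
Variables (psi : R -> R) (lo hi K : R).
Hypotheses (lohi : lo <= hi) (dpsi : forall x, derivable psi x 1)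
  (cpsi : continuous (derive1 psi))
  (psiK : forall x, lo <= x <= hi -> `|derive1 psi x| <= K).
Let D : set R := [set` `[lo, hi[].
Let mD : measurable D. Proof. exact: measurable_itv. Qed.

Let muD : mu D = (hi - lo)%:E.
Proof.
rewrite /D lebesgue_measure_itv/= lte_fin; case: ltP => [_|hilo].
  by rewrite -EFinB.
by have -> : hi = lo; [apply/le_anti; rewrite hilo lohi|rewrite subrr].
Qed.

Let K0 : 0 <= K.
Proof. by apply: le_trans (psiK (x := lo) _) => //; rewrite lexx. Qed.

Lemma bounded_integrable_window (g : R -> R) (B : R) : measurable_fun D g ->
  (forall x, D x -> `|g x| <= B) -> mu.-integrable D (EFin \o g).
Proof.
move=> mg gB; apply: measurable_bounded_integrable => //.
  by have /= -> := muD; rewrite ltry.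
exists B; split; first exact: num_real.
by move=> x Bx y Dy; apply: (le_trans (gB y Dy)); exact: ltW.
Qed.

Let weight_le x : D x -> `|derive1 psi x| <= K.
Proof. by rewrite /D/= in_itv/= => /andP[x1 /ltW x2]; apply: psiK; rewrite x1. Qed.

Let mpsi : measurable_fun D (derive1 psi).
Proof. by apply: measurable_funTS; exact: continuous_measurable_fun. Qed.

Lemma weighted_integrable (g : R -> R) (B : R) : measurable_fun D g ->
  (forall x, D x -> `|g x| <= B) ->
  mu.-integrable D (EFin \o (fun x => derive1 psi x * g x)).
Proof.
move=> mg gB; apply: (@bounded_integrable_window _ (K * B)).
  exact: measurable_funM.
by move=> x Dx; rewrite normrM ler_pM// ?weight_le// gB.
Qed.

Lemma weighted_distance (g k : R -> R) (B e : R) :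
  measurable_fun D g -> measurable_fun D k ->
  (forall x, D x -> `|g x| <= B) -> (forall x, D x -> `|k x| <= B) ->
  (forall x, D x -> `|g x - k x| <= e) ->
  `|\int[mu]_(x in D) (derive1 psi x * g x) - \int[mu]_(x in D) (derive1 psi x * k x)|
    <= K * e * (hi - lo).
Proof.
move=> mg mk gB kB gk.
have ig := weighted_integrable mg gB; have ik := weighted_integrable mk kB.
rewrite -RintegralB//.
have iB : mu.-integrable D (EFin \o (fun x => derive1 psi x * g x - derive1 psi x * k x)).
  rewrite (_ : _ \o _ = ((EFin \o (fun x => derive1 psi x * g x)%R) \-
    (EFin \o (fun x => derive1 psi x * k x)%R))%E)//.
  exact: integrableB.
apply: (le_trans (le_normr_Rintegral _ iB)) => //.
have <- : \int[mu]_(x in D) (K * e) = K * e * (hi - lo).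
  by rewrite Rintegral_cst//; have /= -> := muD.
apply: le_Rintegral => //.
- exact: integrable_norm iB.
- apply: (@bounded_integrable_window _ `|K * e|) => //.
- by move=> x Dx; rewrite -mulrBr normrM ler_pM// ?weight_le// gk.
Qed.

(** The reason to give weights as derivatives: against a jump only the value of [psi] at its
    position survives. [psi = id] yields the mass and [psi = moment_weight hi] the first moment. *)
Lemma integral_weight_step (c : R) : lo <= c <= hi ->
  \int[mu]_(x in D) (derive1 psi x * (c <= x)%R%:R) = psi hi - psi c.
Proof.
move=> /andP[loc chi].
have ms : measurable_fun D (fun x : R => (c <= x)%R%:R : R).
  by apply: measurable_funTS; exact: measurable_step.
have is_ : mu.-integrable D (EFin \o (fun x => derive1 psi x * (c <= x)%R%:R)).
  apply: (@weighted_integrable _ 1) => // x _.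
  by case: (c <= x); rewrite ?normr0 ?normr1.
rewrite /D Rintegral_itv_bndo_bndc//.
rewrite /Rintegral.
have gE (x : R) : (if lo <= x <= hi then derive1 psi x * (c <= x)%R%:R else 0) =
    if c <= x <= hi then derive1 psi x else 0.
  have [cx|xc] := leP c x; first by rewrite (le_trans loc cx) mulr1.
  by rewrite mulr0; case: ifP.
have := @integral_derive_segment _ psi _ _ _ chi dpsi cpsi gE.
by rewrite (integral_segment_restrict (fun x => erefl)) => ->.
Qed.

Lemma integral_weight : \int[mu]_(x in D) derive1 psi x = psi hi - psi lo.
Proof.
have loP : lo <= lo <= hi by rewrite lexx.
rewrite -(integral_weight_step loP); apply: eq_Rintegral => x.
by rewrite inE /D/= in_itv/= => /andP[-> _]; rewrite mulr1.
Qed.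

Lemma integral_weight_front_sum (eta : R -> R) (L : seq (front R)) (t : R) :
  (forall p, p \in L -> lo <= front_pos p t <= hi) ->
  \int[mu]_(x in D) (derive1 psi x * front_sum eta L x t) =
  \sum_(p <- L) (eta p.2.2 - eta p.2.1) * (psi hi - psi (front_pos p t)).
Proof.
move=> LD.
have is_ (c : R) : mu.-integrable D (EFin \o (fun x => derive1 psi x * (c <= x)%R%:R)).
  apply: (@weighted_integrable _ 1).
    by apply: measurable_funTS; exact: measurable_step.
  by move=> x _; case: (c <= x); rewrite ?normr0 ?normr1.
transitivity (\sum_(p <- L) (eta p.2.2 - eta p.2.1) *
    \int[mu]_(x in D) (derive1 psi x * (front_pos p t <= x)%R%:R)).
  elim: L {LD} => [|p L IH].
    rewrite big_nil; under eq_Rintegral do rewrite /front_sum big_nil mulr0.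
    by rewrite Rintegral_cst// mul0r.
  rewrite big_cons -IH -RintegralZl// -RintegralD//.
  - by apply: eq_Rintegral => x _; rewrite /front_sum big_cons; ring.
  - rewrite (_ : _ \o _ = fun x => ((eta p.2.2 - eta p.2.1)%:E *
      (EFin \o (fun x => derive1 psi x * (front_pos p t <= x)%R%:R)%R) x)%E)//.
    exact: integrableZl.
  - apply: (@weighted_integrable _ (\sum_(p <- L) `|eta p.2.2 - eta p.2.1|)).
      apply: measurable_funTS; apply: measurable_sum => q.
      by apply: measurable_funM; [exact: measurable_cst|exact: measurable_step].
    move=> x _; apply: (le_trans (ler_norm_sum _ _ _)); apply: ler_sum => q _.
    by rewrite normrM; case: (_ <= x); rewrite ?normr0 ?normr1 ?mulr1 ?mulr0.
rewrite big_seq [RHS]big_seq; apply: eq_bigr => p pL.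
by rewrite integral_weight_step// LD.
Qed.

Variables (f : R -> R) (smooth : bool) (m M tau l r : R) (u : R -> R -> R).
Hypothesis lM : m <= l <= M.
Hypothesis uP : front_approx f smooth m M tau lo hi l r u.

Lemma front_approx_measurable_window (t : R) : 0 <= t <= tau ->
  measurable_fun D (fun x => u x t).
Proof.
move=> t0.
have /choice[L LP] : forall n : nat, exists L : seq (front R), forall x,
    lo <= x < hi -> `|u x t - (l + front_sum id L x t)| <= n.+1%:R^-1.
  move=> n; have [|L [_ _ H _ _]] := uP (eps := n.+1%:R^-1) => //.
  by exists L => x xD; exact: H.
apply: (@measurable_fun_cvg _ _ _ _ (fun n x => l + front_sum id (L n) x t)).
  move=> n; apply: measurable_funTS; apply: measurable_funD => //.
  apply: measurable_sum => q.
  by apply: measurable_funM; [exact: measurable_cst|exact: measurable_step].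
move=> x; rewrite /D/= in_itv/= => xD.
apply/(@cvgrPdist_le _ R^o) => e e0; near=> n.
apply: le_trans (LP n x xD) _; apply/ltW.
near: n; exact: (near_infty_natSinv_lt (PosNum e0)).
Unshelve. all: by end_near. Qed.

Lemma front_approx_range_window x t : lo <= x < hi -> 0 <= t <= tau ->
  m <= u x t <= M.
Proof.
move=> xD t0.
apply/andP; split; apply/ler_addgt0Pr => e e0;
  have [L [L1 _ /(_ x t xD t0) + L4 _]] := uP e0;
  have /andP[] := front_sum_range L1 lM (fun eta => L4 eta x t t0);
  rewrite ler_norml => h1 h2 /andP[]; move: h1 h2; lra.
Qed.

(** By the entropy relation [eta] of a superposition is again a superposition, so its weighted
    integral is a sum over fronts; the Lipschitz bound on [eta] controls the error. *)
Lemma front_weighted_distance (L : seq (front R)) (eps : R) (eta : R -> R) (C t : R) :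
  (forall p, p \in L -> front_valid f m M tau lo hi p) ->
  (forall x, lo <= x < hi -> `|u x t - (l + front_sum id L x t)| <= eps) ->
  (forall (eta : R -> R) x, eta (l + front_sum id L x t) = eta l + front_sum eta L x t) ->
  continuous eta ->
  (forall v w : R, m <= v <= M -> m <= w <= M -> `|eta v - eta w| <= C * `|v - w|) ->
  0 <= C -> 0 <= t <= tau ->
  `|\int[mu]_(x in D) (derive1 psi x * eta (u x t)) -
     (eta l * (psi hi - psi lo) + \sum_(p <- L) (eta p.2.2 - eta p.2.1) *
         (psi hi - psi (front_pos p t)))| <= K * (C * eps) * (hi - lo).
Proof.
move=> L1 L3 L4 ceta etaC C0 t0.
have LD p : p \in L -> lo <= front_pos p t <= hi by move=> /L1[_ _ _]; exact.
have mS : measurable_fun D (fun x => eta l + front_sum eta L x t).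
  apply: measurable_funD; first exact: measurable_cst.
  apply: measurable_funTS; apply: measurable_sum => q.
  by apply: measurable_funM; [exact: measurable_cst|exact: measurable_step].
have mcst : measurable_fun D (cst (eta l) : R -> R) by exact: measurable_cst.
have mF : measurable_fun D (fun x => front_sum eta L x t).
  apply: measurable_funTS; apply: measurable_sum => q.
  by apply: measurable_funM; [exact: measurable_cst|exact: measurable_step].
have FB x : D x -> `|front_sum eta L x t| <= \sum_(p <- L) `|eta p.2.2 - eta p.2.1|.
  move=> _; apply: (le_trans (ler_norm_sum _ _ _)); apply: ler_sum => q _.
  by rewrite normrM; case: (_ <= x); rewrite ?normr0 ?normr1 ?mulr1 ?mulr0.
have SE : \int[mu]_(x in D) (derive1 psi x * (eta l + front_sum eta L x t)) =
    eta l * (psi hi - psi lo) + \sum_(p <- L) (eta p.2.2 - eta p.2.1) *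
             (psi hi - psi (front_pos p t)).
  rewrite -(integral_weight_front_sum eta LD) -integral_weight -RintegralZl//; last first.
    by apply: (@bounded_integrable_window _ K) => // x; exact: weight_le.
  rewrite -RintegralD//.
  - by apply: eq_Rintegral => x _; ring.
  - apply: (@bounded_integrable_window _ (`|eta l| * K)).
      by apply: measurable_funM.
    by move=> x Dx; rewrite normrM ler_wpM2l// weight_le.
  - exact: weighted_integrable mF FB.
rewrite -SE.
have Srange x : m <= l + front_sum id L x t <= M.
  by apply: (front_sum_range L1 lM) => chi; exact: L4.
have etaB v : m <= v <= M -> `|eta v| <= `|eta l| + C * (M - m).
  move=> vM; have -> : eta v = eta l + (eta v - eta l) by ring.
  apply: (le_trans (ler_normD _ _)); rewrite lerD2l; apply: (le_trans (etaC _ _ vM lM)).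
  rewrite ler_wpM2l// ler_norml; move: vM lM => /andP[? ?] /andP[? ?]; lra.
apply: (@weighted_distance _ _ (`|eta l| + C * (M - m))) => //.
- apply: (measurableT_comp (f := eta)); first exact: continuous_measurable_fun.
  exact: front_approx_measurable_window.
- move=> x; rewrite /D/= in_itv/= => xD.
  by apply: etaB; exact: front_approx_range_window.
- by move=> x _; rewrite -(L4 eta)//; apply: etaB.
- move=> x; rewrite /D/= in_itv/= => xD; rewrite -(L4 eta)//.
  apply: (le_trans (etaC _ _ (front_approx_range_window xD t0) (Srange x))).
  by rewrite ler_wpM2l// L3.
Qed.

End weight.
End weighted_integrals.

Section weights.
Variable R : realType.

Lemma derive1_idE (x : R) : derive1 (id : R -> R) x = 1.
Proof. by rewrite derive1E derive_id. Qed.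

Lemma derivable_id_line (x : R) : derivable (id : R -> R) x 1.
Proof. exact: derivable_id. Qed.

Lemma continuous_id_line : continuous (id : R -> R).
Proof. by move=> x; exact: cvg_id. Qed.

Lemma continuous_derive1_id : continuous (derive1 (id : R -> R)).
Proof.
have -> : derive1 (id : R -> R) = cst 1 by apply/funext => x; exact: derive1_idE.
exact: cst_continuous.
Qed.

Lemma derive1_id_le1 (lo hi x : R) : lo <= x <= hi -> `|derive1 (id : R -> R) x| <= 1.
Proof. by rewrite derive1_idE normr1. Qed.

(** Antiderivative of [hi - x]. Measured from the right end of the window, the first moment is what
    the double primitive in W_1 produces. *)
Definition moment_weight (hi x : R) : R := - ((hi - x) ^+ 2 / 2).

Lemma is_derive_moment_weight (hi x : R) : is_derive x 1 (moment_weight hi) (hi - x).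
Proof. by rewrite /moment_weight; apply: is_derive_eq; rewrite /GRing.scale/=; field. Qed.

Lemma derive1_moment_weight (hi x : R) : derive1 (moment_weight hi) x = hi - x.
Proof. by rewrite derive1E; have [_] := is_derive_moment_weight hi x. Qed.

Lemma derivable_moment_weight (hi x : R) : derivable (moment_weight hi) x 1.
Proof. by have [] := is_derive_moment_weight hi x. Qed.

Lemma continuous_derive1_moment_weight (hi : R) : continuous (derive1 (moment_weight hi)).
Proof.
have -> : derive1 (moment_weight hi) = fun x => hi - x.
  by apply/funext => x; exact: derive1_moment_weight.
by move=> x; apply: cvgB; [exact: cvg_cst|exact: cvg_id].
Qed.

End weights.

(** * Conservation of mass and Riemann problems *)

Section riemann_problem.
Variables (R : realType) (f : R -> R).
Hypothesis f_derivable : forall x : R, derivable f x 1.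
Hypothesis f'_homo : {homo derive1 f : x y / x <= y}.
Notation mu := (@lebesgue_measure R).

Lemma norm_le_eps_eq0 (x c : R) : (forall e, 0 < e -> `|x| <= e * c) -> x = 0.
Proof.
move=> H; apply/eqP; rewrite -normr_le0; apply/ler_addgt0Pr => e e0; rewrite add0r.
have c1 : 0 < `|c| + 1 by rewrite ltr_wpDl.
apply: (le_trans (H _ (divr_gt0 e0 c1))).
rewrite mulrAC ler_pdivrMr// ler_wpM2l ?(ltW e0)//.
by rewrite (le_trans (ler_norm c))// lerDl.
Qed.

(** A front that moves for time [tau] lowers the mass by [tau] times its jump of [f], by
    Rankine-Hugoniot; the jumps telescope to [f r - f l], and the tolerance is sent to zero. *)
Lemma front_approx_mass smooth m M tau lo hi l r u : lo <= hi -> 0 <= tau ->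
  m <= l <= M -> front_approx f smooth m M tau lo hi l r u ->
  \int[mu]_(x in [set` `[lo, hi[]) u x tau =
  \int[mu]_(x in [set` `[lo, hi[]) u x 0 - tau * (f r - f l).
Proof.
move=> lohi tau0 lM uP.
have lid (v w : R) : m <= v <= M -> m <= w <= M -> `|v - w| <= 1 * `|v - w|.
  by rewrite mul1r.
have tt : 0 <= tau <= tau by rewrite tau0 lexx.
have t0 : ((0 : R) <= 0) && (0 <= tau) by rewrite lexx.
apply/eqP; rewrite -subr_eq0; apply/eqP.
apply: (@norm_le_eps_eq0 _ (2 * (hi - lo))) => e e0.
have [L [L1 _ L2 L4 L3]] := uP _ e0.
have dist (t : R) (ht : 0 <= t <= tau) := front_weighted_distance lohi
  (@derivable_id_line _) (@continuous_derive1_id _) (@derive1_id_le1 _ lo hi) lM uP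
  L1 (fun x xD => L2 x t xD ht) (fun eta x => L4 eta x t ht) (@continuous_id_line _) lid ler01 ht.
have := dist tau tt; have := dist 0 t0.
under eq_Rintegral do rewrite derive1_idE mul1r.
under [in X in _ -> X -> _]eq_Rintegral do rewrite derive1_idE mul1r.
set I0 := \int[mu]_(x in _) u x 0; set I1 := \int[mu]_(x in _) u x tau.
have SE : \sum_(p <- L) (id p.2.2 - id p.2.1) * (id hi - id (front_pos p tau)) =
    \sum_(p <- L) (id p.2.2 - id p.2.1) * (id hi - id (front_pos p 0)) - tau * (f r - f l).
  have -> : f r - f l = \sum_(p <- L) (f p.2.2 - f p.2.1) by rewrite (L3 f); ring.
  rewrite mulr_sumr -sumrB big_seq [RHS]big_seq; apply: eq_bigr => p /L1[h _ _ _].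
  by rewrite -h /front_pos/=; ring.
rewrite SE /= !mul1r; set S := \sum_(p <- L) _.
rewrite !ler_norml => /andP[h1 h2] /andP[h3 h4]; move: h1 h2 h3 h4; lra.
Qed.

Definition riemann (l r x0 x t : R) : R :=
  if l <= r then fan f l r x0 0 x t
  else if x0 + (f r - f l) / (r - l) * t <= x then r else l.

Lemma riemann_approx m M tau lo hi l r x0 : m <= l <= M -> m <= r <= M ->
  (forall v t : R, m <= v <= M -> 0 <= t <= tau -> lo <= x0 + t * derive1 f v <= hi) ->
  front_approx f false m M tau lo hi l r (riemann l r x0).
Proof.
move=> lM rM H; rewrite /riemann; have [lr|rl] := leP l r.
  apply: fan_approx => // t t0; rewrite subr0; split.
  - by rewrite mulr_ge0 ?subr_ge0//; case/andP: t0.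
  - by case/andP: (H l t lM t0).
  - by case/andP: (H r t rM t0).
apply: front_approx_shock => //.
  by rewrite divfK// subr_eq0 lt_eqF.
move=> t t0.
have [s [sE /andP[s1 s2]]] := chord_slope_le f_derivable f'_homo (ltW rl).
have -> : (f r - f l) / (r - l) = s.
  rewrite -(opprB l r) -(opprB (f l) (f r)) invrN mulrNN -sE mulfK//.
  by rewrite subr_eq0 gt_eqF.
have /andP[h1 _] := H r t rM t0; have /andP[_ h2] := H l t lM t0.
have tge : 0 <= t by case/andP: t0.
apply/andP; split.
  by apply: (le_trans h1); rewrite lerD2l mulrC ler_wpM2r.
by apply: le_trans h2; rewrite lerD2l mulrC ler_wpM2l.
Qed.

Lemma riemann_initial l r x0 x : riemann l r x0 x 0 = if x0 <= x then r else l.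
Proof.
rewrite /riemann mulr0 addr0; case: ifP => // lr.
rewrite /fan.
set S := [set w | _]; have [x0x|xx0] := leP x0 x.
  have -> : S = [set` `[0, 1]].
    apply/seteqP; split => w; rewrite /S /= in_itv/=; first by case.
    by move=> w01; split => //; right; rewrite subrr mul0r addr0.
  by rewrite sup_itv ?bnd_simp// mulr1 subrKC.
have -> : S = [set 0].
  apply/seteqP; split => w; rewrite /S /=.
    by move=> [_ [//|]]; rewrite subrr mul0r addr0 leNgt xx0.
  by move=> ->; rewrite lexx ler01; split => //; left.
by rewrite sup1 mulr0 addr0.
Qed.

Lemma riemann_const l x0 x t : riemann l l x0 x t = l.
Proof. by rewrite /riemann lexx /fan subrr mul0r addr0. Qed.

End riemann_problem.

(** * One time step: exact evolution followed by averaging *)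

Section upwind_scheme.
Variables (R : realType) (f : R -> R).
Hypothesis f_derivable : forall x : R, derivable f x 1.
Hypothesis f'_homo : {homo derive1 f : x y / x <= y}.
Notation mu := (@lebesgue_measure R).
Variables (right : bool) (lam m M : R).
Hypotheses (lam0 : 0 < lam) (m0 : m <= 0) (M0 : 0 <= M).

(* Godunov's flux when the characteristic speeds have a constant sign. *)
Definition upwind_flux (a b : R) : R := if right then f a else f b.

Hypothesis speed : forall v : R, m <= v <= M ->
  if right then 0 <= lam * derive1 f v <= 1 else -1 <= lam * derive1 f v <= 0.

Let zM : m <= 0 <= M. Proof. by rewrite m0 M0. Qed.

Lemma flux_increment (a b : R) : m <= a <= M -> m <= b <= M -> a <= b ->
  if right then 0 <= lam * (f b - f a) <= b - a
  else - (b - a) <= lam * (f b - f a) <= 0.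
Proof.
move=> aM bM ab; have [s [<- /andP[s1 s2]]] := chord_slope_le f_derivable f'_homo ab.
have := speed aM; have := speed bM.
have ls1 : lam * derive1 f a <= lam * s by rewrite ler_pM2l.
have ls2 : lam * s <= lam * derive1 f b by rewrite ler_pM2l.
have ba : 0 <= b - a by rewrite subr_ge0.
rewrite mulrA; move: (lam * s) (b - a) ls1 ls2 ba => S d.
case: right => ls1 ls2 d0 /andP[h1 h2] /andP[h3 h4].
  by rewrite mulr_ge0 ?ler_piMl//; [exact: le_trans ls2 h2|exact: le_trans ls1].
rewrite mulr_le0_ge0 ?(le_trans ls2)// andbT -mulN1r ler_wpM2r//.
exact: le_trans ls1.
Qed.

Lemma upwind_consistent u : upwind_flux u u = f u.
Proof. by rewrite /upwind_flux; case: right. Qed.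

Lemma upwind_updateE a b c : fv_update upwind_flux lam a b c =
  if right then b - lam * (f b - f a) else b - lam * (f c - f b).
Proof. by rewrite /fv_update /upwind_flux; case: right. Qed.

Lemma upwind_monotone : monotone_scheme upwind_flux lam m M.
Proof.
move=> a b c a' b' c'; rewrite !in_itv/= => aM bM cM a'M b'M c'M.
have flux := flux_increment.
rewrite !upwind_updateE; split => le.
- move: (flux _ _ aM a'M le); case: right => // /andP[h1 h2].
  by move: h1; lra.
- move: (flux _ _ bM b'M le); case: right => // /andP[h1 h2]; move: h1 h2; lra.
- move: (flux _ _ cM c'M le); case: right => // /andP[h1 h2]; move: h1 h2; lra.
Qed.

(** Monotonicity allows comparison with the constant states [m] and [M], which the update leaves
    fixed. *)
Lemma upwind_update_range a b c : m <= a <= M -> m <= b <= M -> m <= c <= M ->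
  m <= fv_update upwind_flux lam a b c <= M.
Proof.
move=> aM bM cM; have mM : m <= M by exact: le_trans M0.
have upE v : fv_update upwind_flux lam v v v = v.
  by rewrite /fv_update subrr mulr0 subr0.
have mm : m <= m <= M by rewrite lexx. have MM : m <= M <= M by rewrite lexx mM.
have mon (x y : R) (x' y' z z' : R) : m <= x <= M -> m <= y <= M -> m <= z <= M ->
    m <= x' <= M -> m <= y' <= M -> m <= z' <= M -> x <= x' -> y <= y' -> z <= z' ->
    fv_update upwind_flux lam x y z <= fv_update upwind_flux lam x' y' z'.
  move=> xM yM zM' x'M y'M z'M xx yy zz.
  have := @upwind_monotone x y z x' y' z'; rewrite !in_itv/=.
  move=> /(_ xM yM zM' x'M y'M z'M)[/(_ xx) h1 _ _].
  have := @upwind_monotone x' y z x' y' z'; rewrite !in_itv/=.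
  move=> /(_ x'M yM zM' x'M y'M z'M)[_ /(_ yy) h2 _].
  have := @upwind_monotone x' y' z x' y' z'; rewrite !in_itv/=.
  move=> /(_ x'M y'M zM' x'M y'M z'M)[_ _ /(_ zz) h3].
  exact: le_trans h1 (le_trans h2 h3).
apply/andP; split.
  by rewrite -[leLHS](upE m); apply: mon => //; [case/andP: aM|case/andP: bM|case/andP: cM].
by rewrite -[leRHS](upE M); apply: mon => //; [case/andP: aM|case/andP: bM|case/andP: cM].
Qed.

Section grid_evolution.
Variables (o dx : R).
Hypothesis dx0 : 0 < dx.
Notation gp := (grid_point o dx).
Let tau := lam * dx.

Let tau0 : 0 <= tau. Proof. by rewrite mulr_ge0// ltW. Qed.

(* The interface whose Riemann fan enters the cell i is i if the speeds are
   nonnegative and i + 1 otherwise. *)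
Let d : int := if right then 0 else 1.

Definition upwind_evolution (c : int -> R) (x t : R) : R :=
  let i := Num.floor ((x - o) / dx) in
  riemann f (c (i - 1 + d)) (c (i + d)) (gp (i + d)) x t.

Lemma upwind_evolution_cell c i x t : cell o dx i x ->
  upwind_evolution c x t = riemann f (c (i - 1 + d)) (c (i + d)) (gp (i + d)) x t.
Proof. by move=> /(cell_floor _ dx0) xi; rewrite /upwind_evolution xi. Qed.

Lemma upwind_evolution_initial c x :
  upwind_evolution c x 0 = piecewise_constant o dx c x.
Proof.
have xi := mem_cell_floor o dx0 x.
rewrite (piecewise_constant_cell dx0 _ xi) (upwind_evolution_cell _ _ xi).
rewrite riemann_initial; move: xi => /cellE/andP[h1 h2]; rewrite /d.
case: right; first by rewrite !addr0 h1.
by rewrite leNgt h2/= subrK.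
Qed.

Section bounded_data.
Variable c : int -> R.
Hypothesis cM : forall i, m <= c i <= M.

(** The CFL condition keeps the waves of each Riemann problem inside the cell on its downwind side
    during the step, so neighbouring problems do not interact. *)
Lemma upwind_evolution_approx_cell i :
  front_approx f false m M tau (gp i) (gp (i + 1)) (c (i - 1 + d)) (c (i + d))
    (upwind_evolution c).
Proof.
apply: (@front_approx_eq _ _ _ _ _ _ _ _ _ _
  (riemann f (c (i - 1 + d)) (c (i + d)) (gp (i + d)))).
  by move=> x t xi _; rewrite (@upwind_evolution_cell _ i)//; exact/cellE.
apply: riemann_approx => // v t vM /andP[t0 tt].
have gE : gp (i + 1) = gp i + dx by rewrite (grid_pointD o dx i 1) mul1r.
have := speed vM; rewrite gE /d.
have tdx : t / lam <= dx by rewrite ler_pdivrMr// mulrC.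
have -> : t * derive1 f v = t / lam * (lam * derive1 f v) by field; rewrite gt_eqF.
have tl0 : 0 <= t / lam by rewrite divr_ge0// ltW.
move: (t / lam) (lam * derive1 f v) tdx tl0 => T V Tdx T0.
case: right => /andP[h1 h2].
  rewrite addr0 lerDl mulr_ge0//= lerD2l (le_trans _ Tdx)// ler_piMr//.
rewrite gE -addrA lerDl lerD2l gerDl mulr_ge0_le0// andbT.
have : T * - V <= T by rewrite ler_piMr// lerNl.
rewrite mulrN; move: Tdx; lra.
Qed.

Lemma upwind_evolution_approx_window a (n : nat) :
  front_approx f false m M tau (gp a) (gp (a + n%:Z)) (c (a - 1 + d)) (c (a + n%:Z - 1 + d))
    (upwind_evolution c).
Proof.
elim: n => [|n IH].
  rewrite addr0; apply: (@front_approx_eq _ _ _ _ _ _ _ _ _ _ (fun _ _ => c (a - 1 + d))).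
    by move=> x t /andP[h1 h2]; have := le_lt_trans h1 h2; rewrite ltxx.
  exact: front_approx_const.
have an : a + n.+1%:Z = a + n%:Z + 1 by rewrite -addrA -natz -natz -(natrD _ n 1) addn1.
rewrite an; apply: (front_approx_cat _ IH).
  by rewrite grid_point_le//= ltW// grid_point_lt.
have := upwind_evolution_approx_cell (a + n%:Z).
by rewrite addrK.
Qed.

(** Mass balance on one cell: during the whole step the states at its two ends are the upwind ones,
    so the exact fluxes are the numerical ones. *)
Lemma upwind_evolution_average i :
  cell_average o dx (fun x => upwind_evolution c x tau) i =
  fv_update upwind_flux lam (c (i - 1)) (c i) (c (i + 1)).
Proof.
have le1 := ltW (grid_point_lt o dx0 i).
have mass := front_approx_mass le1 tau0 (cM _) (upwind_evolution_approx_cell i).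
rewrite /cell_average [X in _ * X]mass.
have -> : \int[mu]_(x in [set` `[(gp i), (gp (i + 1))[]) upwind_evolution c x 0 =
    c i * dx.
  transitivity (\int[mu]_(x in cell o dx i) (cst (c i) x)).
    apply: eq_Rintegral => x; rewrite inE => xi.
    by rewrite upwind_evolution_initial (piecewise_constant_cell dx0 _ xi).
  rewrite Rintegral_cst; last exact: measurable_cell.
  by have /= -> := lebesgue_measure_cell o dx0 i.
rewrite upwind_updateE /tau /d; case: right; rewrite ?addr0 ?subrK;
  field; rewrite gt_eqF//.
Qed.

Hypothesis c_support : exists (a : int) (n : nat), forall i,
  (i < a) || (a + n%:Z <= i) -> c i = 0.

Lemma upwind_evolution_entropy :
  entropy_evolution f tau (piecewise_constant o dx c)
    (fun x => upwind_evolution c x tau).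
Proof.
have [a [n c0]] := c_support.
exists (upwind_evolution c); split => //.
have -> : piecewise_constant o dx c = upwind_evolution c ^~ 0.
  by apply/funext => x; rewrite upwind_evolution_initial.
(* One extra cell on each side makes the end states zero for both values of [d]. *)
have ua := upwind_evolution_approx_window (a - 1) n.+2.
have [d0 d1] : 0 <= d /\ d <= 1 by rewrite /d; case: right.
have cl : c (a - 1 - 1 + d) = 0.
  by apply: c0; move: (d) d1; clear; lia.
have cr : c (a - 1 + n.+2%:Z - 1 + d) = 0.
  by apply: c0; move: (d) d0; clear; lia.
rewrite cl cr in ua.
apply: (front_approx_entropy_solution f_derivable f'_homo zM ua) => x t xa _.
  have xi := mem_cell_floor o dx0 x; set i := Num.floor _ in xi.
  have ia : (i < a - 1)%R.
    move: xi => /cellE/andP[ix _]; have := le_lt_trans ix xa.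
    by rewrite /grid_point ltrD2l ltr_pM2r// ltr_int.
  rewrite (upwind_evolution_cell _ _ xi) !c0 ?riemann_const//;
    by move: (d) (i) d1 ia; clear; lia.
have xi := mem_cell_floor o dx0 x; set i := Num.floor _ in xi.
have ia : (a - 1 + n.+2%:Z < i + 1)%R.
  move: xi => /cellE/andP[_ ix]; have := le_lt_trans xa ix.
  by rewrite /grid_point ltrD2l ltr_pM2r// ltr_int.
rewrite (upwind_evolution_cell _ _ xi) !c0 ?riemann_const//;
  by move: (d) (i) d0 ia; clear; lia.
Qed.

End bounded_data.
End grid_evolution.
End upwind_scheme.

(** * Admissible data and their cell averages *)

Section admissible_data.
Variable R : realType.
Notation mu := (@lebesgue_measure R).

(** The one-sided bound makes [C x - v x] nondecreasing, hence measurable. *)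
Lemma lip_plus_measurable (v : R -> R) : lip_plus_bounded v -> measurable_fun setT v.
Proof.
move=> [C HC].
have -> : v = (fun x => C * x) \- (fun x => C * x - v x).
  by apply/funext => x /=; ring.
apply: measurable_funB; first by apply: measurable_funM.
apply: nondecreasing_measurable => // x y xy.
have [->//|nxy] := eqVneq x y.
have {nxy}xy : 0 < y - x by rewrite subr_gt0 lt_neqAle nxy.
have := HC x (y - x); rewrite gt_eqF// subrKC => /(_ isT).
by rewrite ler_pdivrMr//; lra.
Qed.

Lemma admissible_support (v : R -> R) : admissible_datum v ->
  exists X : R, forall x, ~ (- X <= x <= X) -> v x = 0.
Proof.
move=> [cv _]; have [B0 [_ HB0]] := compact_bounded cv.
have HB := HB0 (B0 + 1) (ltr_pwDr ltr01 (lexx B0)).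
exists (B0 + 1) => x nx; apply/eqP/negPn/negP => vx; apply: nx.
by rewrite -ler_norml; apply: (HB x); exact: subset_closure.
Qed.

Variables (o dx : R).
Hypothesis dx0 : 0 < dx.

Lemma cell_average_range (v : R -> R) (m M : R) i : measurable_fun setT v ->
  (forall x, m <= v x <= M) -> m <= cell_average o dx v i <= M.
Proof.
move=> mv vM; have le1 := ltW (grid_point_lt o dx0 i).
have cstE (k : R) : \int[mu]_(x in cell o dx i) k = k * dx.
  rewrite Rintegral_cst; last exact: measurable_cell.
  by have /= -> := lebesgue_measure_cell o dx0 i.
have iv : mu.-integrable (cell o dx i) (EFin \o v).
  apply: (@bounded_integrable_window _ _ _ le1 _ (`|m| + `|M|)).
    exact: measurable_funTS.
  by move=> x _; exact: normr_le_endpoints.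
have ic (k : R) : mu.-integrable (cell o dx i) (EFin \o cst k).
  by apply: (@bounded_integrable_window _ _ _ le1 _ `|k|).
have mc := measurable_cell o dx i.
rewrite /cell_average mulrC; apply/andP; split.
  rewrite ler_pdivlMr// -cstE; apply: le_Rintegral => // [|x _]; first exact: ic.
  by case/andP: (vM x).
rewrite ler_pdivrMr// -cstE; apply: le_Rintegral => // [|x _]; first exact: ic.
by case/andP: (vM x).
Qed.

Lemma cell_average_eq0 (v : R -> R) i :
  (forall x, cell o dx i x -> v x = 0) -> cell_average o dx v i = 0.
Proof.
move=> v0; rewrite /cell_average (_ : \int[mu]_(y in _) v y = 0) ?mulr0//.
transitivity (\int[mu]_(x in cell o dx i) (0 : R)).
  by apply: eq_Rintegral => x; rewrite inE => /v0.
by rewrite Rintegral_cst ?mul0r//; exact: measurable_cell.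
Qed.

Lemma cell_average_support (v : R -> R) (lo hi : R) :
  (forall x, ~ (lo <= x <= hi) -> v x = 0) ->
  forall i, (i < Num.floor ((lo - o) / dx))%R || (Num.floor ((hi - o) / dx) < i)%R ->
  cell_average o dx v i = 0.
Proof.
move=> v0 i ii; apply: cell_average_eq0 => x /(cell_floor _ dx0) xi; apply: v0.
move=> /andP[x1 x2]; move: ii; rewrite -xi !ltNge -negb_and => /negP; apply.
by rewrite !le_floor// ler_pM2r ?invr_gt0// lerD2r.
Qed.

End admissible_data.

(** * Membership in the class of schemes *)

Section upwind_class.
Variables (R : realType) (f : R -> R).
Hypothesis f_derivable : forall x : R, derivable f x 1.
Hypothesis f'_homo : {homo derive1 f : x y / x <= y}.
Variables (right : bool) (lam m M : R).
Hypotheses (lam0 : 0 < lam) (m0 : m <= 0) (M0 : 0 <= M).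
Hypothesis speed : forall v : R, m <= v <= M ->
  if right then 0 <= lam * derive1 f v <= 1 else -1 <= lam * derive1 f v <= 0.

Lemma fv_values_range o dx u0 n i : 0 < dx -> measurable_fun setT u0 ->
  (forall x, m <= u0 x <= M) -> m <= fv_values (upwind_flux f right) lam o dx u0 n i <= M.
Proof.
move=> dx0 mu0 u0M; elim: n i => [|n IH] i /=; first exact: cell_average_range.
exact: upwind_update_range.
Qed.

Lemma fv_values_support o dx u0 n (a b : int) :
  (forall i, (i < a)%R || (b < i)%R -> cell_average o dx u0 i = 0) ->
  forall i, (i < a - n%:Z)%R || (b + n%:Z < i)%R ->
  fv_values (upwind_flux f right) lam o dx u0 n i = 0.
Proof.
move=> u00; elim: n => [|n IH] i.
  by rewrite subr0 addr0; exact: u00.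
move=> ii /=; rewrite !IH; first by rewrite /fv_update subrr mulr0 subr0.
all: by move: ii; clear; lia.
Qed.

Lemma upwind_class : fv_class f (upwind_flux f right) lam m M.
Proof.
split; [exact: upwind_consistent|exact: upwind_monotone|].
exists (fun _ _ w => w); first exact: projection_operator_id.
move=> u0 o dx n u0adm u0M dx0.
have mu0 : measurable_fun setT u0 by case: u0adm => _ /lip_plus_measurable.
have [X HX] := admissible_support u0adm.
pose c := fv_values (upwind_flux f right) lam o dx u0 n.
have cM i : m <= c i <= M by exact: fv_values_range.
have [a [b HS]] : exists a b : int, forall i, (i < a)%R || (b < i)%R -> c i = 0.
  by eexists; eexists; apply: fv_values_support; exact: cell_average_support HX.
have cS : exists (a : int) (k : nat), forall i, (i < a) || (a + k%:Z <= i) -> c i = 0.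
  exists a, (absz (b - a)%R).+1 => i ii; apply: HS; move: ii; clear; lia.
have ev := upwind_evolution_entropy f_derivable f'_homo lam0 m0 M0 speed o dx0 cM cS.
eexists; split; first exact: ev.
rewrite /fv_level /average; congr piecewise_constant; apply/funext => i.
by rewrite (upwind_evolution_average f_derivable f'_homo lam0 speed o dx0 cM).
Qed.

End upwind_class.

(** * Dissipation in the upwind scheme *)

Section upwind_dissipation.
Variables (R : realType) (g dg Q : R -> R) (lam alpha M : R).
Hypotheses (lam0 : 0 < lam) (alpha0 : 0 < alpha).
Hypothesis g_derive : forall x : R, is_derive x 1 g (dg x).
Hypothesis Q_derive : forall x : R, 0 <= x <= M -> is_derive x 1 Q (dg x ^+ 2).
Hypothesis dg_convex : forall a b : R, 0 <= a -> a <= b -> b <= M ->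
  alpha * (b - a) <= dg b - dg a.
Hypothesis dg0 : 0 <= dg 0.
Hypothesis cfl : forall x : R, 0 <= x <= M -> lam * dg x <= 2^-1.

(** The 12 matches the term [6 kappa p (r - p)], from differentiating the cubic correction in [Phi],
    with the lower bound [lam alpha^2 p (r - p) / 2] for the entropy loss. *)
Definition dissipation_rate : R := lam * alpha ^+ 2 / 12.
Local Notation kappa := dissipation_rate.

Lemma dg_ge x : 0 <= x <= M -> alpha * x <= dg x.
Proof.
move=> /andP[x0 xM]; have := dg_convex (lexx 0) x0 xM; rewrite subr0.
move: dg0; lra.
Qed.

Lemma g_slope a b : 0 <= a -> a <= b -> b <= M ->
  exists2 s, 0 <= lam * s <= 2^-1 & g b - g a = s * (b - a).
Proof.
move=> a0 ab bM.
have [|c cab ->] := @MVT_segment _ g dg a b ab.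
  by apply: derivable_within_continuous => x _; exact: ex_derive.
move: cab; rewrite in_itv/= => /andP[ac cb].
have cM : 0 <= c <= M by rewrite (le_trans a0 ac) (le_trans cb bM).
exists (dg c) => //; rewrite cfl// andbT mulr_ge0 ?(ltW lam0)//.
by apply: le_trans (dg_ge cM); rewrite mulr_ge0 ?(ltW alpha0)//; case/andP: cM.
Qed.

Let Phi (r p : R) : R := g (r - lam * (g r - g p)) + lam * (Q r - Q p)
  + kappa * ((r - p) ^+ 2 * (r + 2 * p)).

Let dPhi (r p : R) : R := lam * dg p * (dg (r - lam * (g r - g p)) - dg p)
  - 6 * kappa * (p * (r - p)).

Let Phi_derive r p : 0 <= p <= M -> is_derive p 1 (Phi r) (dPhi r p).
Proof.
move=> pM; have Qd := Q_derive pM; have gd := g_derive p.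
have gd' := g_derive (r - lam * (g r - g p)).
have inner : is_derive p 1 (fun x => r - lam * (g r - g x)) (lam * dg p).
  by apply: is_derive_eq; rewrite add0r !mul1r scalerN opprK.
have comp := @is_derive1_comp _ g (fun x => r - lam * (g r - g x)) p _ _ gd' inner.
have quad : is_derive p 1 (fun x : R => lam * (Q r - Q x)
    + kappa * ((r - x) ^+ 2 * (r + 2 * x)))
    (- (lam * dg p ^+ 2) - 6 * kappa * (p * (r - p))).
  by apply: is_derive_eq; rewrite /GRing.scale/=; ring.
rewrite (_ : Phi r = (g \o (fun x => r - lam * (g r - g x))) \+
   (fun x : R => lam * (Q r - Q x) + kappa * ((r - x) ^+ 2 * (r + 2 * x)))); last first.
  by apply/funext => x; rewrite /Phi /= addrA.
apply: is_derive_eq; rewrite /dPhi; ring.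
Qed.

(** Cell entropy inequality for the entropy [g] with flux [Q], with a quantitative loss. For fixed
    [r] the function [Phi r] increases up to [p = r] and decreases after it. Indeed, as
    [lam g' <= 1/2], the updated state lies at least halfway from [c] to [r], so convexity separates
    the values of [g'] by at least [alpha |r - c| / 2], while [g' c >= alpha c]. The last bound is
    all that is known near the state 0, whence the weight [r + 2 p]. *)
Lemma upwind_dissipation p r : 0 <= p <= M -> 0 <= r <= M ->
  g (r - lam * (g r - g p)) <=
  g r - lam * (Q r - Q p) - kappa * ((r - p) ^+ 2 * (r + 2 * p)).
Proof.
move=> /andP[p0 pM] /andP[r0 rM].
suff : Phi r p <= Phi r r.
  rewrite /Phi !subrr !mulr0 subr0 expr0n mul0r mulr0 !addr0; lra.
have k6 : 6 * kappa = lam * alpha * alpha / 2 by rewrite /kappa; field.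
have cont a b : 0 <= a -> b <= M -> {within [set` `[a, b]], continuous (Phi r)}.
  move=> a0 bM; apply: derivable_within_continuous => x.
  rewrite in_itv/= => /andP[ax xb].
  have xM : 0 <= x <= M by rewrite (le_trans a0) ?(le_trans xb).
  by have := Phi_derive r xM; move=> H; exact: ex_derive.
have der a b x : 0 <= a -> b <= M -> x \in `]a, b[ -> is_derive x 1 (Phi r) (dPhi r x).
  move=> a0 bM; rewrite in_itv/= => /andP[/ltW ax /ltW xb]; apply: Phi_derive.
  by rewrite (le_trans a0) ?(le_trans xb).
have [pr|/ltW rp] := leP p r.
  have [c cab E] := MVT_segment pr (fun x xab => der p r x p0 rM xab) (cont p r p0 rM).
  rewrite -subr_ge0 E mulr_ge0 ?subr_ge0//.
  move: cab; rewrite in_itv/= => /andP[pc cr].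
  have c0 : 0 <= c by exact: le_trans pc.
  have [s /andP[s0 s1] gE] := g_slope c0 cr rM.
  have dc : alpha * c <= dg c by apply: dg_ge; rewrite c0 (le_trans cr).
  rewrite /dPhi k6 gE.
  have rE : r - lam * (s * (r - c)) = c + (1 - lam * s) * (r - c) by ring.
  have rc0 : 0 <= r - c by rewrite subr_ge0.
  have ls : 2^-1 * (r - c) <= (1 - lam * s) * (r - c) by rewrite ler_wpM2r//; lra.
  have ls' : (1 - lam * s) * (r - c) <= r - c by rewrite ler_piMl//; lra.
  have := @dg_convex c (r - lam * (s * (r - c))) c0.
  rewrite rE lerDl => /(_ _ _)/wrap[].
    by rewrite (le_trans _ ls)// mulr_ge0.
    by apply: le_trans rM; rewrite -lerBrDl.
  move=> cv; have dd : alpha * (2^-1 * (r - c)) <= dg (c + (1 - lam * s) * (r - c)) - dg c.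
    apply: le_trans cv; rewrite ler_pM2l//; move: ls; lra.
  have : alpha * c * (alpha * (2^-1 * (r - c))) <=
      dg c * (dg (c + (1 - lam * s) * (r - c)) - dg c).
    by apply: ler_pM => //; rewrite mulr_ge0 ?(ltW alpha0)// mulr_ge0.
  move=> H; rewrite -subr_ge0 in H; have {}H := mulr_ge0 (ltW lam0) H; rewrite -subr_ge0; apply: (le_trans H).
  by rewrite le_eqVlt; apply/orP; left; apply/eqP; field.
have [c cab E] := MVT_segment rp (fun x xab => der r p x r0 pM xab) (cont r p r0 pM).
rewrite -subr_le0 E mulr_le0_ge0 ?subr_ge0//.
move: cab; rewrite in_itv/= => /andP[rc cp].
have c0 : 0 <= c by exact: le_trans rc.
have cM : c <= M by exact: le_trans cp pM.
have [s /andP[s0 s1] gE] := g_slope r0 rc cM.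
have dc : alpha * c <= dg c by apply: dg_ge; rewrite c0.
rewrite /dPhi k6 -(opprB (g c) (g r)) gE.
have rE : r - lam * - (s * (c - r)) = c - (1 - lam * s) * (c - r) by ring.
have rc0 : 0 <= c - r by rewrite subr_ge0.
have ls : 2^-1 * (c - r) <= (1 - lam * s) * (c - r) by rewrite ler_wpM2r//; lra.
have ls' : (1 - lam * s) * (c - r) <= c - r by rewrite ler_piMl//; lra.
have x0 : 0 <= c - (1 - lam * s) * (c - r) by move: ls' r0; lra.
have xc : c - (1 - lam * s) * (c - r) <= c.
  by rewrite gerBl (le_trans _ ls)// mulr_ge0.
have cv := dg_convex x0 xc cM; rewrite rE.
have dd : alpha * (2^-1 * (c - r)) <= dg c - dg (c - (1 - lam * s) * (c - r)).
  apply: le_trans cv; rewrite ler_pM2l//; move: ls; lra.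
have : alpha * c * (alpha * (2^-1 * (c - r))) <=
    dg c * (dg c - dg (c - (1 - lam * s) * (c - r))).
  by apply: ler_pM => //; rewrite mulr_ge0 ?(ltW alpha0)// mulr_ge0.
move=> H; rewrite -subr_ge0 in H; have {}H := mulr_ge0 (ltW lam0) H.
rewrite -oppr_ge0; apply: le_trans H _.
by rewrite le_eqVlt; apply/orP; left; apply/eqP; field.
Qed.

End upwind_dissipation.

(** * Mass, moment and energy of the upwind recursion *)

Section upwind_sequence.
Variables (R : realType) (g dg Q : R -> R) (lam alpha M : R).
Hypotheses (lam0 : 0 < lam) (alpha0 : 0 < alpha).
Hypothesis g_derive : forall x : R, is_derive x 1 g (dg x).
Hypothesis Q_derive : forall x : R, 0 <= x <= M -> is_derive x 1 Q (dg x ^+ 2).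
Hypothesis dg_convex : forall a b : R, 0 <= a -> a <= b -> b <= M ->
  alpha * (b - a) <= dg b - dg a.
Hypothesis dg0 : 0 <= dg 0.
Hypothesis cfl : forall x : R, 0 <= x <= M -> lam * dg x <= 2^-1.
Hypothesis g0 : g 0 = 0.

Local Notation kappa := (dissipation_rate lam alpha).

Variables (z : nat -> nat -> R) (W N : nat).
Hypothesis z_step : forall k j, z k.+1 j.+1 = z k j.+1 - lam * (g (z k j.+1) - g (z k j)).
Hypothesis z_left : forall k, z k 0%N = 0.
Hypothesis z_right : forall k j, (k <= N)%N -> (W <= j)%N -> z k j = 0.
Hypothesis z_range : forall k j, 0 <= z k j <= M.

Lemma sum_shift (F : nat -> R) : F 0%N = 0 -> F W = 0 ->
  \sum_(0 <= j < W) F j.+1 = \sum_(0 <= j < W) F j.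
Proof.
move=> F0 FW; apply/eqP; rewrite -subr_eq0 -sumrB (telescope_sumr F (leq0n W)).
by rewrite F0 FW subrr.
Qed.

Let zW k : (k <= N)%N -> z k W = 0. Proof. by move=> kN; rewrite z_right. Qed.

Lemma upwind_mass k : (k < N)%N ->
  \sum_(0 <= j < W) z k.+1 j = \sum_(0 <= j < W) z k j.
Proof.
move=> kN; rewrite -sum_shift ?z_left ?zW//.
under eq_bigr do rewrite z_step.
rewrite sumrB -mulr_sumr (telescope_sumr (fun j => g (z k j)) (leq0n W)).
rewrite (zW (ltnW kN)) z_left subrr mulr0 subr0 sum_shift//.
by rewrite zW// ltnW.
Qed.

(** Summation by parts. The sum of [g] plays for the scheme the part of the integral of [f u - f 0]
    for the exact solution. *)
Lemma upwind_moment k : (k < N)%N ->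
  \sum_(0 <= j < W) j%:R * z k.+1 j =
  \sum_(0 <= j < W) j%:R * z k j + lam * \sum_(0 <= j < W) g (z k j).
Proof.
move=> kN; have kN' := ltnW kN.
rewrite -(sum_shift (F := fun j => j%:R * z k.+1 j)) ?mul0r ?zW ?mulr0//.
rewrite -(sum_shift (F := fun j => j%:R * z k j)) ?mul0r ?zW ?mulr0//.
apply/eqP; rewrite addrC -subr_eq -sumrB; apply/eqP.
transitivity (- lam * \sum_(0 <= j < W)
    ((j.+1%:R * g (z k j.+1) - j%:R * g (z k j)) - g (z k j))).
  rewrite mulr_sumr; apply: eq_bigr => j _; rewrite z_step -natr1; ring.
rewrite sumrB (telescope_sumr (fun j => j%:R * g (z k j)) (leq0n W)).
by rewrite zW// g0 mulr0 mul0r subrr sub0r mulrNN.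
Qed.

Let dissipation k := \sum_(0 <= j < W)
  (z k j.+1 - z k j) ^+ 2 * (z k j.+1 + z k j).

Lemma upwind_energy_step k : (k < N)%N ->
  \sum_(0 <= j < W) g (z k.+1 j) <=
  \sum_(0 <= j < W) g (z k j) - kappa * dissipation k.
Proof.
move=> kN; have kN' := ltnW kN; have kappa0 : 0 <= kappa.
  by rewrite /dissipation_rate divr_ge0// mulr_ge0 ?(ltW lam0)// exprn_ge0// ltW.
rewrite -(sum_shift (F := fun j => g (z k.+1 j))) ?z_left ?zW//.
apply: (@le_trans _ _ (\sum_(0 <= j < W) (g (z k j.+1)
    - lam * (Q (z k j.+1) - Q (z k j))
    - kappa * ((z k j.+1 - z k j) ^+ 2 * (z k j.+1 + z k j))))).
  apply: ler_sum => j _; rewrite z_step.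
  apply: (le_trans (upwind_dissipation lam0 alpha0 g_derive Q_derive dg_convex dg0 cfl
    (z_range k j) (z_range k j.+1))).
  (* The weight [r + 2 p] is lowered to the symmetric [r + p], as [p >= 0]. *)
  rewrite lerD2l lerN2 ler_wpM2l// ler_wpM2l ?sqr_ge0// lerD2l.
  by rewrite ler_peMl ?ler1n//; case/andP: (z_range k j).
rewrite !sumrB -!mulr_sumr (telescope_sumr (fun j => Q (z k j)) (leq0n W)).
by rewrite (zW kN') z_left subrr mulr0 subr0 (sum_shift (F := fun j => g (z k j))) ?z_left ?zW.
Qed.

(* The square of the largest value is at most the sum of [|dz| (z' + z)]; this
   sum is bounded by the weighted inequality [|d| s <= d^2 s / (2 t) + t s / 2]. *)
Lemma upwind_dissipation_ge k (S : R) : (k <= N)%N -> 0 < S ->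
  \sum_(0 <= j < W) z k j = S ->
  S ^+ 3 / (2 * W%:R ^+ 4) <= dissipation k.
Proof.
move=> kN S0 SE.
have W0 : (0 < W)%N.
  by rewrite lt0n; apply/eqP => W0; move: S0; rewrite -SE W0 big_geq// ltxx.
have WR : (0 : R) < W%:R by rewrite ltr0n.
have [j jW zj] : exists2 j, (j < W)%N & S / W%:R <= z k j.
  have [[j jW zj]|no] := pselect (exists2 j, (j < W)%N & S / W%:R <= z k j).
    by exists j.
  have : \sum_(0 <= j < W) z k j < \sum_(0 <= j < W) (S / W%:R).
    apply: ltr_sum_nat => //.
    move=> j /andP[_ jW]; rewrite ltNge; apply/negP => zj.
    by apply: no; exists j.
  by rewrite SE sumr_const_nat subn0 -(mulr_natr (S / W%:R)) divfK ?ltxx// gt_eqF.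
(* This [t] maximises the resulting bound [2 t ((S / W)^2 - t S)]. *)
pose t := S / (2 * W%:R ^+ 2).
have t0 : 0 < t by rewrite divr_gt0// mulr_gt0// exprn_gt0.
have zsum0 i : 0 <= z k i.+1 + z k i.
  by apply: addr_ge0; [case/andP: (z_range k i.+1)|case/andP: (z_range k i)].
have step i : z k i.+1 ^+ 2 - z k i ^+ 2 <=
    (z k i.+1 - z k i) ^+ 2 * (z k i.+1 + z k i) / (2 * t) +
    t * (z k i.+1 + z k i) / 2.
  rewrite subr_sqr; move: (z k i.+1 - z k i) (z k i.+1 + z k i) (zsum0 i) => d s s0.
  rewrite -subr_ge0.
  have -> : d ^+ 2 * s / (2 * t) + t * s / 2 - d * s = (d - t) ^+ 2 * s / (2 * t).
    by field; rewrite gt_eqF.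
  by rewrite divr_ge0//; [rewrite mulr_ge0// sqr_ge0|rewrite mulr_ge0// ltW].
have step0 i : 0 <= (z k i.+1 - z k i) ^+ 2 * (z k i.+1 + z k i) / (2 * t) +
    t * (z k i.+1 + z k i) / 2.
  have t2 : 0 <= 2 * t by rewrite mulr_ge0// ltW.
  apply: addr_ge0; first by rewrite divr_ge0// mulr_ge0// sqr_ge0.
  by rewrite divr_ge0// mulr_ge0// ltW.
have : (S / W%:R) ^+ 2 <= dissipation k / (2 * t) + t * S.
  apply: (@le_trans _ _ (z k j ^+ 2)).
    by rewrite ler_sqr// nnegrE ?divr_ge0 ?(ltW S0) ?(ltW WR)//; case/andP: (z_range k j).
  have -> : z k j ^+ 2 = \sum_(0 <= i < j) (z k i.+1 ^+ 2 - z k i ^+ 2).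
    by rewrite (telescope_sumr (fun i => z k i ^+ 2) (leq0n j)) z_left expr0n subr0.
  apply: (@le_trans _ _ (\sum_(0 <= i < W)
     ((z k i.+1 - z k i) ^+ 2 * (z k i.+1 + z k i) / (2 * t) +
      t * (z k i.+1 + z k i) / 2))).
    rewrite (@big_cat_nat _ _ _ j 0 W)//=; last exact: ltnW.
    rewrite -[leLHS]addr0; apply: lerD; first by apply: ler_sum.
    by apply: sumr_ge0.
  rewrite big_split/= -!mulr_suml -mulr_sumr big_split/= sum_shift ?z_left ?zW// SE.
  by rewrite lerD2l le_eqVlt; apply/orP; left; apply/eqP; field.
have -> : S ^+ 3 / (2 * W%:R ^+ 4) = ((S / W%:R) ^+ 2 - t * S) * (2 * t).
  by rewrite /t; field; rewrite gt_eqF.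
have t2 : 0 < 2 * t by apply: mulr_gt0.
by move=> H; rewrite -ler_pdivlMr// lerBlDr.
Qed.

(** At step [k] the sum of [g] is at least [k d] below its initial value; the moment adds these sums
    over the steps, whence the triangular number [n (n - 1) / 2]. *)
Lemma upwind_moment_bound (S : R) n : (n <= N)%N -> 0 < S ->
  \sum_(0 <= j < W) z 0%N j = S ->
  \sum_(0 <= j < W) j%:R * z n j <= \sum_(0 <= j < W) j%:R * z 0%N j
    + lam * (n%:R * (\sum_(0 <= j < W) g (z 0%N j))
       - kappa * (S ^+ 3 / (2 * W%:R ^+ 4)) * (n%:R * (n%:R - 1) / 2)).
Proof.
move=> nN S0 SE; set d := kappa * _.
have kappa0 : 0 <= kappa.
  by rewrite /dissipation_rate divr_ge0// mulr_ge0 ?(ltW lam0)// exprn_ge0// ltW.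
have mass k : (k <= N)%N -> \sum_(0 <= j < W) z k j = S.
  by elim: k => // k IH kN; rewrite upwind_mass// IH// ltnW.
have energy k : (k <= N)%N ->
    \sum_(0 <= j < W) g (z k j) <= \sum_(0 <= j < W) g (z 0%N j) - k%:R * d.
  elim: k => [_|k IH kN]; first by rewrite mul0r subr0.
  apply: (le_trans (upwind_energy_step kN)).
  have := IH (ltnW kN).
  have : d <= kappa * dissipation k.
    by rewrite ler_wpM2l// upwind_dissipation_ge// ?mass// ltnW.
  rewrite -natr1; lra.
elim: n nN => [_|n IH nN]; first by rewrite !mul0r mulr0 subrr mulr0 addr0.
rewrite upwind_moment//.
have h1 := IH (ltnW nN); have := energy n (ltnW nN).
rewrite -(ler_pM2l lam0) => h2; apply: (le_trans (lerD h1 h2)).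
by rewrite le_eqVlt; apply/orP; left; apply/eqP; rewrite -natr1; field.
Qed.

End upwind_sequence.

(** * First moments and the lower bound *)

Section moment_lower_bound.
Variable R : realType.
Notation mu := (@lebesgue_measure R).
Notation mu2 := (mu \x mu)%E.

(** Fubini on the triangle [y <= x] inside [[A, B[]: the slice at [y] has length [B - y]. The
    function [h] is the primitive set to zero outside [[A, B[], since right of [B] the primitive
    stays constant, equal to the total integral. *)
Lemma integral_double_primitive (g : R -> R) (A B K : R) : A <= B ->
  measurable_fun setT g -> (forall x, `|g x| <= K) ->
  (forall x, ~ (A <= x < B) -> g x = 0) ->
  exists h : R -> \bar R, [/\ measurable_fun setT h,
    (forall x, `|h x| <= `|\int[mu]_(y in [set` `]-oo, x]]) (g y)%:E|)%E &
    (\int[mu]_x h x = (\int[mu]_(x in [set` `[A, B[]) ((B - x) * g x))%R%:E)%E].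
Proof.
move=> AB mg gK g0.
have K0 : 0 <= K by apply: le_trans (gK A).
pose F (p : R * R) := \1_[set` `[A, B[] p.1 * ((0 + 1 * p.2 <= p.1)%R%:R * g p.2).
have mAB : measurable ([set` `[A, B[] : set R) by exact: measurable_itv.
have indE (x : R) : \1_[set` `[A, B[] x = (A <= x < B)%R%:R :> R.
  rewrite indicE; congr ((nat_of_bool _)%:R); apply/idP/idP => H.
    by move: H; rewrite inE /= in_itv.
  by rewrite inE /= in_itv.
have mF : measurable_fun setT F.
  apply: measurable_funM.
    have mi : measurable_fun setT (\1_[set` `[A, B[] : R -> R) by exact: measurable_indic.
    exact: (measurableT_comp mi measurable_fst).
  by apply: measurable_funM; [exact: measurable_halfplane|apply: measurableT_comp].
have iF : mu2.-integrable setT (EFin \o F).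
  apply: (@integrable_compact_support _ F (`|A| + `|B| + 1) K) => //.
    move=> x t nxt; rewrite /F /= indE.
    have [xAB|] := boolP (A <= x < B); last by rewrite mul0r.
    have [tAB|] := pselect (A <= t < B); last by move=> /g0 ->; rewrite !mulr0.
    exfalso; apply: nxt; move: xAB tAB => /andP[h1 h2] /andP[h3 h4].
    have := ler_norm B; have := ler_norm (- A); rewrite normrN.
    have := normr_ge0 A; have := normr_ge0 B => h5 h6 h7 h8.
    by split; apply/andP; split; move: h1 h2 h3 h4 h5 h6 h7 h8; lra.
  move=> p; rewrite /F indE mulrA -natrM normrM.
  case: (_ && _) => /=; case: (_ + _ <= _) => /=;
    by rewrite ?mul0n ?muln0 ?mul1n ?normr0 ?normr1 ?mul0r ?mul1r.
exists (fubini_F mu (EFin \o F)); split.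
- exact: measurable_fubini_F iF.
- move=> x; rewrite /fubini_F.
  have [xAB|xAB] := boolP (A <= x < B); last first.
    rewrite integral0_eq ?abse0// => y _.
    by rewrite /F /= indE (negbTE xAB) mul0r.
  rewrite le_eqVlt; apply/orP; left; apply/eqP; congr (`|_|)%E.
  rewrite [RHS]integral_mkcond; apply: eq_integral => y _.
  rewrite /F /= indE xAB mul1r add0r mul1r patchE; case: ifPn => H.
    by move: H; rewrite inE/= in_itv/= => ->; rewrite mul1r.
  by move: H; rewrite notin_setE/= in_itv/= => /negP/negPf->; rewrite mul0r.
rewrite (integral12_prod_meas1 iF) -(integral21_prod_meas1 iF).
have ig : mu.-integrable [set` `[A, B[] (EFin \o (fun x => (B - x) * g x)).
  apply: (@bounded_integrable_window _ _ _ AB _ ((B - A) * K)).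
    by apply: measurable_funTS; apply: measurable_funM => //; exact: measurable_funB.
  move=> x; rewrite /= in_itv/= => /andP[Ax xB]; rewrite normrM ler_pM//.
  rewrite ger0_norm ?subr_ge0 ?(ltW xB)// lerB//.
rewrite /Rintegral fineK; last by apply: integrable_fin_num ig.
rewrite [RHS]integral_mkcond; apply: eq_integral => y _; rewrite patchE /fubini_G.
case: ifPn => H.
  move: H; rewrite inE/= in_itv/= => /andP[Ay yB].
  have E (x : R) : (EFin \o F) (x, y) =
      ((g y)%:E * (\1_([set` `[y, B[]) x)%:E)%E.
    rewrite -EFinM /F /= indE; congr EFin.
    have -> : \1_([set` `[y, B[]) x = (y <= x < B)%R%:R :> R.
      rewrite indicE; congr ((nat_of_bool _)%:R); apply/idP/idP => H.
        by move: H; rewrite inE /= in_itv.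
      by rewrite inE /= in_itv.
    rewrite add0r mul1r; have [yx|xy] := leP y x; last by rewrite mul0r !mulr0.
    by rewrite (le_trans Ay yx)/= mul1r mulrC.
  transitivity (\int[mu]_x ((g y)%:E * (\1_[set` `[y, B[] x)%:E))%E.
    by apply: eq_integral => x _; exact: E.
  have myB : measurable ([set` `[y, B[] : set R) by exact: measurable_itv.
  have mE : mu [set` `[y, B[] = (B - y)%:E.
    by rewrite lebesgue_measure_itv/= lte_fin yB -EFinB.
  rewrite integralZl//.
    by rewrite integral_indic// setIT [X in (_ * X)%E]mE -EFinM mulrC.
  exact: integrable_indic_itv.
move: H; rewrite notin_setE/= in_itv/= => /g0 gy.
by apply: integral0_eq => x _; rewrite /F /= gy !mulr0.
Qed.

(** Pulling the absolute value out of the outer integral in W_1 leaves a first moment. *)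
Lemma wasserstein1_moment (u v : R -> R) (A B K : R) : A <= B ->
  measurable_fun setT (u \- v) -> (forall x, `|u x - v x| <= K) ->
  (forall x, ~ (A <= x < B) -> u x = v x) ->
  (`|\int[mu]_(x in [set` `[A, B[]) ((B - x) * (u x - v x))|%:E
    <= wasserstein1 u v)%E.
Proof.
move=> AB mg gK g0.
have [|h [mh hle hE]] := integral_double_primitive AB mg gK.
  by move=> x /g0 /= ->; rewrite subrr.
have -> : (`|\int[mu]_(x in [set` `[A, B[]) ((B - x) * (u x - v x))|%:E =
  `|\int[mu]_x h x|)%E by rewrite hE.
apply: le_trans; first by apply: le_abse_integral.
apply: ge0_le_integral => //.
- by apply: measurableT_comp.
- by apply: measurableT_comp => //; exact: measurable_primitive.
Qed.

End moment_lower_bound.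

(** * First moment of a continuous solution *)

Section moment_of_solution.
Variable R : realType.
Notation mu := (@lebesgue_measure R).

Lemma antiderivative (g : R -> R) (a : R) : continuous g ->
  exists Q : R -> R, forall x, a < x -> is_derive x 1 Q (g x).
Proof.
move=> cg; exists (fun x => \int[mu]_(t in [set` `[a, x]]) g t) => x ax.
have xx1 : x < x + 1 by rewrite ltrDl.
have ig : mu.-integrable [set` `[a, x + 1]] (EFin \o g).
  apply: continuous_compact_integrable; first exact: segment_compact.
  exact: continuous_subspaceT.
have [dF F'] := continuous_FTC1_closed xx1 ig ax (cg x).
by split => //; rewrite -derive1E.
Qed.

Variable f : R -> R.
Hypothesis f_derivable : forall x : R, derivable f x 1.
Hypothesis f'_homo : {homo derive1 f : x y / x <= y}.

(** Production of the entropy [f] across a jump. The derivative of [s f - Q] is [f' (s - f')], and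
    both [s] and [f' c] lie between [f' a] and [f' b]. Summed over fronts with [smooth] true, the
    bound tends to zero. *)
Lemma flux_square_production (Q : R -> R) (m M K a b s : R) :
  (forall x, m <= x <= M -> is_derive x 1 Q (derive1 f x ^+ 2)) ->
  (forall x, m <= x <= M -> `|derive1 f x| <= K) ->
  m <= a <= M -> m <= b <= M -> s * (b - a) = f b - f a ->
  `|s * (f b - f a) - (Q b - Q a)| <= K * ((b - a) * (derive1 f b - derive1 f a)).
Proof.
move=> dQ fK.
wlog ab : a b / a < b => [H|aM bM].
  have [ab|ba|->] := ltgtP a b; first exact: H.
    move=> aM bM sE.
    have -> : s * (f b - f a) - (Q b - Q a) = - (s * (f a - f b) - (Q a - Q b)) by ring.
    have -> : (b - a) * (derive1 f b - derive1 f a) = (a - b) * (derive1 f a - derive1 f b).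
      by ring.
    by rewrite normrN; apply: H => //; rewrite -opprB mulrN sE opprB.
  by move=> _ _ _; rewrite !subrr mulr0 subrr normr0 mul0r mulr0.
move=> sE; have [s' [s'E /andP[s1 s2]]] := chord_slope_le f_derivable f'_homo (ltW ab).
have ss' : s = s'.
  by apply: (mulIf (x := b - a)); rewrite ?subr_eq0 ?gt_eqF// sE s'E.
rewrite -ss' in s1 s2.
have inM x : a <= x <= b -> m <= x <= M.
  case/andP: aM => ma _; case/andP: bM => _ bM /andP[ax xb].
  by rewrite (le_trans ma) ?(le_trans xb).
have dH x : a <= x <= b ->
    is_derive x 1 (fun v => s * f v - Q v) (s * derive1 f x - derive1 f x ^+ 2).
  move=> /inM xM; have Qx := dQ x xM.
  have fx : is_derive x 1 f (derive1 f x) by rewrite derive1E; exact: derivableP.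
  by apply: is_derive_eq.
have [||c cab E] := @MVT_segment _ (fun v => s * f v - Q v)
    (fun x => s * derive1 f x - derive1 f x ^+ 2) a b (ltW ab).
- by move=> x; rewrite in_itv/= => /andP[/ltW ax /ltW xb]; apply: dH; rewrite ax.
- apply: derivable_within_continuous => x; rewrite in_itv/= => xab.
  by have := dH x xab; move=> ?; exact: ex_derive.
move: cab; rewrite in_itv/= => cab; have /andP[ac cb] := cab.
have -> : s * (f b - f a) - (Q b - Q a) = s * f b - Q b - (s * f a - Q a) by ring.
rewrite E expr2 -mulrBl !normrM -mulrA mulrC -mulrA.
apply: ler_pM => //; rewrite ?mulr_ge0//; first exact/fK/inM.
rewrite ger0_norm ?subr_ge0 ?(ltW ab)// ler_wpM2l ?subr_ge0 ?(ltW ab)//.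
by rewrite ler_norml; have := f'_homo ac; have := f'_homo cb; move: s1 s2; lra.
Qed.

Lemma flux_lipschitz (m M K v w : R) :
  (forall x, m <= x <= M -> `|derive1 f x| <= K) ->
  m <= v <= M -> m <= w <= M -> `|f v - f w| <= K * `|v - w|.
Proof.
move=> fK; wlog wv : v w / w <= v => [H vM wM|vM wM].
  by have [/H->//|/ltW/H h] := leP w v; rewrite distrC (distrC v) h.
have [||c cab ->] := @MVT_segment _ f (derive1 f) w v wv.
- by move=> x _; rewrite derive1E; exact: derivableP.
- by apply: derivable_within_continuous => x _; exact: f_derivable.
rewrite normrM ler_wpM2r// fK//; move: cab; rewrite in_itv/= => /andP[wc cv].
by case/andP: vM wM => _ vM /andP[mw _]; rewrite (le_trans mw) ?(le_trans cv).
Qed.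

(** The quadratic weight gives a term linear in [tau], with the jumps of [f] at time 0, and a term
    in [tau ^+ 2] with the sum [P] of speed times jump of [f]. Up to a vanishing error [P] is the
    sum of the jumps of [Q], which is zero since both end states are [l]. *)
Lemma front_approx_moment (Q : R -> R) (m M K tau lo hi l : R) (u : R -> R -> R) :
  (forall x, m <= x <= M -> is_derive x 1 Q (derive1 f x ^+ 2)) ->
  (forall x, m <= x <= M -> `|derive1 f x| <= K) ->
  lo <= hi -> 0 <= tau -> m <= l <= M ->
  front_approx f true m M tau lo hi l l u ->
  \int[mu]_(x in [set` `[lo, hi[]) ((hi - x) * u x tau) =
  \int[mu]_(x in [set` `[lo, hi[]) ((hi - x) * u x 0)
   - tau * (\int[mu]_(x in [set` `[lo, hi[]) (f (u x 0)) - f l * (hi - lo)).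
Proof.
move=> dQ fK lohi tau0 lM uP.
have K0 : 0 <= K by apply: le_trans (fK l lM).
pose psi := moment_weight hi.
have psiK2 (x : R) : lo <= x <= hi -> `|derive1 psi x| <= hi - lo.
  by move=> /andP[h1 h2]; rewrite derive1_moment_weight ger0_norm ?subr_ge0// lerB.
have cf : continuous f.
  by move=> x; apply/differentiable_continuous/derivable1_diffP.
have lid (v w : R) : m <= v <= M -> m <= w <= M -> `|v - w| <= 1 * `|v - w|.
  by rewrite mul1r.
have tt : 0 <= tau <= tau by rewrite tau0 lexx.
have t0 : ((0 : R) <= 0) && (0 <= tau) by rewrite lexx.
apply/eqP; rewrite -subr_eq0; apply/eqP.
apply: (@norm_le_eps_eq0 _ _ (2 * ((hi - lo) * (hi - lo)) + tau * (K * (hi - lo))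
   + tau ^+ 2 / 2 * K)) => e e0.
have [L [L1 L2 L3 L4 L5]] := uP _ e0.
have dist (psi' : R -> R) (k : R) (d : forall x : R, derivable psi' x 1) (c : continuous (derive1 psi'))
    (b : forall x : R, lo <= x <= hi -> `|derive1 psi' x| <= k) (eta : R -> R) (C : R) ce le C0 (t : R) (ht : 0 <= t <= tau) :=
  @front_weighted_distance _ psi' lo hi k lohi d c b f true m M tau l l u lM uP L e eta C t
  L1 (fun x xD => L3 x t xD ht) (fun eta x => L4 eta x t ht) ce le C0 ht.
have := dist _ _ (@derivable_moment_weight _ hi)
  (@continuous_derive1_moment_weight _ hi) psiK2 id 1 (@continuous_id_line _) lid ler01 tau tt.
have := dist _ _ (@derivable_moment_weight _ hi)
  (@continuous_derive1_moment_weight _ hi) psiK2 id 1 (@continuous_id_line _) lid ler01 0 t0.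
have := dist _ _ (@derivable_id_line _) (@continuous_derive1_id _)
  (@derive1_id_le1 _ lo hi) f K cf (fun v w => flux_lipschitz fK) K0 0 t0.
under eq_Rintegral do rewrite derive1_idE mul1r.
under [in X in _ -> X -> _]eq_Rintegral do rewrite derive1_moment_weight.
under [in X in _ -> _ -> X -> _]eq_Rintegral do rewrite derive1_moment_weight.
set J := \int[mu]_(x in _) f (u x 0).
set I0 := \int[mu]_(x in _) (_ * id (u x 0)).
set I1 := \int[mu]_(x in _) (_ * id (u x tau)).
set Sf := \sum_(p <- L) (f _ - f _) * _.
pose P := \sum_(p <- L) p.1.2 * (f p.2.2 - f p.2.1).
have SE : \sum_(p <- L) (id p.2.2 - id p.2.1) * (psi hi - psi (front_pos p tau)) =
    \sum_(p <- L) (id p.2.2 - id p.2.1) * (psi hi - psi (front_pos p 0))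
    - tau * Sf + tau ^+ 2 / 2 * P.
  rewrite /Sf /P !mulr_sumr -sumrB -big_split/= big_seq [RHS]big_seq.
  apply: eq_bigr => p /L1[h _ _ _].
  by rewrite -h /psi /moment_weight /front_pos/=; field.
have PB : `|P| <= K * e.
  have -> : P = \sum_(p <- L) (p.1.2 * (f p.2.2 - f p.2.1) - (Q p.2.2 - Q p.2.1)).
    rewrite sumrB; suff -> : \sum_(p <- L) (Q p.2.2 - Q p.2.1) = 0 by rewrite subr0.
    by have := L5 Q; rewrite -{1}[Q l]addr0 => /addrI.
  apply: (le_trans (ler_norm_sum _ _ _)).
  apply: (@le_trans _ _ (\sum_(p <- L) K * front_cost f true p)).
    rewrite big_seq [leRHS]big_seq; apply: ler_sum => p /L1[h h1 h2 _].
    exact: flux_square_production.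
  by rewrite -mulr_sumr ler_wpM2l.
rewrite SE; set S := \sum_(p <- L) _ * (psi hi - _).
have tP : `|tau ^+ 2 / 2 * P| <= tau ^+ 2 / 2 * (K * e).
  by rewrite normrM ger0_norm ?divr_ge0 ?sqr_ge0// ler_wpM2l// divr_ge0// sqr_ge0.
move=> hJ h0 h1.
have hJ' : `|tau * (J - (f l * (hi - lo) + Sf))| <= tau * (1 * (K * e) * (hi - lo)).
  by rewrite normrM (ger0_norm tau0) ler_wpM2l.
have -> : I1 - (I0 - tau * (J - f l * (hi - lo))) =
    (I1 - (id l * (psi hi - psi lo) + (S - tau * Sf + tau ^+ 2 / 2 * P)))
    - (I0 - (id l * (psi hi - psi lo) + S))
    + tau * (J - (f l * (hi - lo) + Sf)) + tau ^+ 2 / 2 * P by ring.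
apply: (le_trans (ler_normD _ _)); apply: (@le_trans _ _ (
   (hi - lo) * (1 * e) * (hi - lo) + (hi - lo) * (1 * e) * (hi - lo)
   + tau * (1 * (K * e) * (hi - lo)) + tau ^+ 2 / 2 * (K * e))).
  apply: lerD => //; apply: (le_trans (ler_normD _ _)); apply: lerD => //.
  by apply: (le_trans (ler_normB _ _)); apply: lerD.
by rewrite le_eqVlt; apply/orP; left; apply/eqP; field.
Qed.

End moment_of_solution.

(** * Moments and Jensen's inequality on the grid *)

Section window_sums.
Variables (R : realType) (o dx : R).
Hypothesis dx0 : 0 < dx.
Notation mu := (@lebesgue_measure R).
Notation gp := (grid_point o dx).

Lemma Rintegral_window (h : R -> R) (K : R) i (n : nat) :
  measurable_fun setT h ->
  (forall x, gp i <= x < gp (i + n%:Z) -> `|h x| <= K) ->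
  \int[mu]_(x in [set` `[gp i, gp (i + n%:Z)[]) h x =
  \sum_(0 <= k < n) \int[mu]_(x in cell o dx (i + k%:Z)) h x.
Proof.
move=> mh; elim: n => [|n IH] hK.
  by rewrite addr0 set_itvco0 Rintegral_set0 big_geq.
have le1 := grid_point_le o dx0 i n.
have an : i + n.+1%:Z = i + n%:Z + 1 by rewrite -addrA -natz -natz -(natrD _ n 1) addn1.
have le2 : gp (i + n%:Z) <= gp (i + n.+1%:Z) by rewrite an ltW// grid_point_lt.
have ih : mu.-integrable [set` `[gp i, gp (i + n.+1%:Z)[] (EFin \o h).
  apply: (@bounded_integrable_window _ _ _ (le_trans le1 le2) _ K).
    exact: measurable_funTS.
  by move=> x; rewrite /= in_itv/=; exact: hK.
rewrite windowS// in ih *; rewrite Rintegral_setU//; last 2 first.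
- exact: measurable_cell.
- exact: window_cell_disjoint.
rewrite big_nat_recr//= IH// => x /andP[x1 x2].
by apply: hK; rewrite x1 (lt_le_trans x2).
Qed.

Lemma moment_piecewise_constant (c : int -> R) (K : R) i (n : nat) :
  (forall j, `|c j| <= K) ->
  \int[mu]_(x in [set` `[gp i, gp (i + n%:Z)[])
    ((gp (i + n%:Z) - x) * piecewise_constant o dx c x) =
  dx ^+ 2 * \sum_(0 <= k < n) (n%:R - k%:R - 2^-1) * c (i + k%:Z).
Proof.
move=> cK; set B := gp (i + n%:Z).
have mpc := measurable_piecewise_constant o dx0 c.
have AB : gp i <= B by exact: grid_point_le.
rewrite (@Rintegral_window _ ((B - gp i) * K)).
- rewrite mulr_sumr; apply: eq_bigr => k _.
  transitivity (\int[mu]_(x in cell o dx (i + k%:Z)) (c (i + k%:Z) * (B - x))).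
    apply: eq_Rintegral => x; rewrite inE => xk.
    by rewrite (piecewise_constant_cell dx0 _ xk) mulrC.
  have le1 := ltW (grid_point_lt o dx0 (i + k%:Z)).
  rewrite RintegralZl//; last 2 first.
    exact: measurable_cell.
    apply: (@bounded_integrable_window _ _ _ le1 _ (`|B| + `|gp (i + k%:Z)| + `|gp (i + k%:Z + 1)|)).
      exact: measurable_funB.
    move=> x; rewrite /= in_itv/= => /andP[x1 x2].
    apply: (le_trans (ler_normB _ _)); rewrite -addrA lerD2l normr_le_endpoints//.
    by rewrite x1 ltW.
  have psiK (x : R) : gp (i + k%:Z) <= x <= gp (i + k%:Z + 1) ->
      `|derive1 (moment_weight B) x| <= `|B - gp (i + k%:Z)| + `|B - gp (i + k%:Z + 1)|.
    move=> /andP[x1 x2]; rewrite derive1_moment_weight [leRHS]addrC normr_le_endpoints//.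
    by rewrite !lerD2l !lerN2 x1 x2.
  have /= := integral_weight le1 (@derivable_moment_weight _ B)
    (@continuous_derive1_moment_weight _ B) psiK.
  under eq_Rintegral do rewrite derive1_moment_weight.
  rewrite /cell -!/(grid_point _ _ _) => ->.
  rewrite /moment_weight /B /grid_point !intrD -!pmulrn; by field.
- by apply: measurable_funM => //; exact: measurable_funB.
- move=> x /andP[x1 x2]; rewrite normrM ler_pM//; last exact: cK.
  by rewrite ger0_norm ?subr_ge0 ?(ltW x2)// lerB.
Qed.

Section cell_averages.
Variables (f : R -> R) (m M : R) (v : R -> R).
Hypothesis f_derivable : forall x : R, derivable f x 1.
Hypothesis f'_homo : {homo derive1 f : x y / x <= y}.
Hypothesis mv : measurable_fun setT v.
Hypothesis vM : forall x, m <= v x <= M.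

Let vB x : `|v x| <= `|m| + `|M|.
Proof. exact: normr_le_endpoints. Qed.

Lemma sum_cell_average i (n : nat) :
  dx * \sum_(0 <= k < n) cell_average o dx v (i + k%:Z) =
  \int[mu]_(x in [set` `[gp i, gp (i + n%:Z)[]) v x.
Proof.
rewrite (@Rintegral_window _ (`|m| + `|M|))// mulr_sumr; apply: eq_bigr => k _.
by rewrite /cell_average mulrA divff ?mul1r// gt_eqF.
Qed.

Let cf : continuous f.
Proof. by move=> x; apply/differentiable_continuous/derivable1_diffP. Qed.

Lemma tangent_le (a b : R) : f a + derive1 f a * (b - a) <= f b.
Proof.
have [ab|/ltW ba] := leP a b.
  have [s [sE /andP[s1 _]]] := chord_slope_le f_derivable f'_homo ab.
  rewrite -lerBrDl -sE ler_wpM2r// subr_ge0//.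
have [s [sE /andP[_ s2]]] := chord_slope_le f_derivable f'_homo ba.
have : s * (a - b) <= derive1 f a * (a - b) by rewrite ler_wpM2r// subr_ge0.
rewrite sE; lra.
Qed.

(** Jensen's inequality on each cell, by integrating the tangent to [f] at the average. Averaging
    the datum thus lowers the initial energy, which favours the gap. *)
Lemma sum_flux_cell_average i (n : nat) :
  dx * \sum_(0 <= k < n) f (cell_average o dx v (i + k%:Z)) <=
  \int[mu]_(x in [set` `[gp i, gp (i + n%:Z)[]) f (v x).
Proof.
have mfv : measurable_fun setT (fun x => f (v x)).
  by apply: (measurableT_comp (f := f)) => //; exact: continuous_measurable_fun.
pose K := `|derive1 f m| + `|derive1 f M|.
have fK (x : R) : m <= x <= M -> `|derive1 f x| <= K.
  by move=> /andP[mx xM]; apply: normr_le_endpoints; rewrite !f'_homo.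
pose L := `|f m| + K * (M - m).
have fvL x : `|f (v x)| <= L.
  have -> : f (v x) = f m + (f (v x) - f m) by ring.
  have mM : m <= m <= M by have /andP[h1 h2] := vM x; rewrite lexx (le_trans h1).
  apply: (le_trans (ler_normD _ _)); rewrite lerD2l.
  apply: (le_trans (flux_lipschitz f_derivable fK (vM x) mM)).
  have K0 : 0 <= K by rewrite addr_ge0.
  have /andP[h1 h2] := vM x.
  by rewrite ler_wpM2l// ger0_norm ?subr_ge0// lerB.
rewrite (@Rintegral_window _ L)// mulr_sumr; apply: ler_sum => k _.
set j := i + k%:Z; set a := cell_average o dx v j.
have le1 := ltW (grid_point_lt o dx0 j).
have mc := measurable_cell o dx j.
have iv : mu.-integrable (cell o dx j) (EFin \o v).
  apply: (@bounded_integrable_window _ _ _ le1 _ (`|m| + `|M|)) => //.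
  exact: measurable_funTS.
have icst (r : R) : mu.-integrable (cell o dx j) (EFin \o cst r).
  by apply: (@bounded_integrable_window _ _ _ le1 _ `|r|).
have cstE (r : R) : \int[mu]_(x in cell o dx j) r = r * dx.
  rewrite Rintegral_cst//.
  by have /= -> := lebesgue_measure_cell o dx0 j.
pose s := derive1 f a; pose b := f a - s * a.
have iT : mu.-integrable (cell o dx j) (EFin \o (fun x => s * v x)).
  rewrite (_ : _ \o _ = fun x => (s%:E * (EFin \o v) x)%E)//.
  exact: integrableZl.
have -> : dx * f a = \int[mu]_(x in cell o dx j) (s * v x + b).
  rewrite RintegralD//; last exact: icst.
  rewrite cstE RintegralZl//.
  have -> : \int[mu]_(x in cell o dx j) v x = dx * a.
    by rewrite /a /cell_average mulrA divff ?mul1r// gt_eqF.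
  by rewrite /b; ring.
apply: le_Rintegral => //.
- rewrite (_ : _ \o _ = ((EFin \o (fun x => s * v x)%R) \+ (EFin \o cst b))%E)//.
  by apply: integrableD => //; exact: icst.
- apply: (@bounded_integrable_window _ _ _ le1 _ L) => //.
  exact: measurable_funTS.
- move=> x _; apply: le_trans (tangent_le a (v x)); rewrite -/s /b.
  by rewrite le_eqVlt; apply/orP; left; apply/eqP; ring.
Qed.

End cell_averages.
End window_sums.

(** * Gap between the changes of the two moments *)

Section scheme_moment.
Variables (R : realType) (g dg Q : R -> R) (lam alpha M T dx Lc : R).
Hypotheses (lam0 : 0 < lam) (alpha0 : 0 < alpha) (T0 : 0 < T) (dx0 : 0 < dx).
Hypothesis g_derive : forall x : R, is_derive x 1 g (dg x).
Hypothesis Q_derive : forall x : R, 0 <= x <= M -> is_derive x 1 Q (dg x ^+ 2).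
Hypothesis dg_convex : forall a b : R, 0 <= a -> a <= b -> b <= M ->
  alpha * (b - a) <= dg b - dg a.
Hypothesis dg0 : 0 <= dg 0.
Hypothesis cfl : forall x : R, 0 <= x <= M -> lam * dg x <= 2^-1.
Hypothesis g0 : g 0 = 0.
Variables (z : nat -> nat -> R) (W : nat).
Let n := Num.truncn (T / (lam * dx)).
Hypothesis z_step : forall k j, z k.+1 j.+1 = z k j.+1 - lam * (g (z k j.+1) - g (z k j)).
Hypothesis z_left : forall k, z k 0%N = 0.
Hypothesis z_right : forall k j, (k <= n)%N -> (W <= j)%N -> z k j = 0.
Hypothesis z_range : forall k j, 0 <= z k j <= M.

(* The factor 2 / dx below is a lower bound for the mass in units of dx; for
   [X := T / (lam dx) >= 6] one has [n (n - 1) >= (X - 1) (X - 2) >= X^2 / 2]. *)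
Lemma scheme_moment_gap (q J : R) : 6 * (lam * dx) <= T ->
  2 <= dx * \sum_(0 <= j < W) z 0%N j -> W%:R * dx <= Lc ->
  dx * \sum_(0 <= j < W) g (z 0%N j) <= J ->
  dissipation_rate lam alpha * T ^+ 2 / (lam * Lc ^+ 4) * dx <=
  dx ^+ 2 * (q * \sum_(0 <= j < W) z n j - \sum_(0 <= j < W) j%:R * z n j)
  - dx ^+ 2 * (q * \sum_(0 <= j < W) z 0%N j - \sum_(0 <= j < W) j%:R * z 0%N j)
  + T * J.
Proof.
move=> TX; set S := \sum_(0 <= j < W) z 0%N j => S2 WL EJ.
have ldx : 0 < lam * dx by rewrite mulr_gt0.
have S0 : 0 < S by rewrite -(pmulr_rgt0 _ dx0); apply: lt_le_trans S2.
(* Conservation of mass cancels the terms in [q], which encodes the point from which moments are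
   measured. *)
have mass k : (k <= n)%N -> \sum_(0 <= j < W) z k j = S.
  by elim: k => // k IH kn; rewrite (upwind_mass z_step z_left z_right kn) IH// ltnW.
rewrite (mass n (leqnn n)).
have mom := upwind_moment_bound lam0 alpha0 g_derive Q_derive dg_convex dg0 cfl g0
  z_step z_left z_right z_range (leqnn n) S0 erefl.
have W0 : (0 < W)%N.
  by rewrite lt0n; apply/eqP => W0; move: S0; rewrite /S W0 big_geq// ltxx.
have WR : (0 : R) < W%:R by rewrite ltr0n.
set kappa := dissipation_rate lam alpha in mom *.
have kappa0 : 0 <= kappa.
  by rewrite /kappa /dissipation_rate divr_ge0// mulr_ge0 ?(ltW lam0)// exprn_ge0// ltW.
set E0 := \sum_(0 <= j < W) g _ in mom EJ.
pose X := T / (lam * dx).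
have X6 : 6 <= X by rewrite /X ler_pdivlMr.
have nX : n%:R <= X /\ X < n%:R + 1.
  have X0 : 0 <= X by apply: le_trans X6.
  by have /andP[h1 h2] := truncn_itv X0; rewrite natr1.
have E00 : 0 <= E0.
  apply: sumr_ge0 => j _; have /andP[z0 zM] := z_range 0%N j.
  have [s /andP[s0 _] gE] := g_slope lam0 alpha0 g_derive dg_convex dg0 cfl (lexx 0) z0 zM.
  rewrite g0 !subr0 in gE; rewrite gE mulr_ge0//.
  by move: s0; rewrite pmulr_rge0.
have nE : dx ^+ 2 * (lam * (n%:R * E0)) <= T * J.
  have -> : dx ^+ 2 * (lam * (n%:R * E0)) = (n%:R * (lam * dx)) * (dx * E0) by ring.
  apply: ler_pM => //.
  - by rewrite mulr_ge0// ltW.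
  - by rewrite mulr_ge0// ltW.
  - by case: nX => h _; move: h; rewrite /X ler_pdivlMr.
have nn : X ^+ 2 / 4 <= n%:R * (n%:R - 1) / 2.
  case: nX => h1 h2; have h3 : 0 <= (n%:R - (X - 1)) * n%:R.
    by rewrite mulr_ge0// ltW//; move: h2; lra.
  have h4 : 0 <= (X - 2) * (n%:R - (X - 1)).
    by rewrite mulr_ge0//; [move: X6; lra|rewrite ltW//; move: h2; lra].
  have h5 : 0 <= X * (X - 6) by rewrite mulr_ge0//; move: X6; lra.
  move: h3 h4 h5 X6 h1 h2; rewrite !expr2; lra.
(* From [S >= 2 / dx] and [W <= Lc / dx]: this makes the loss per step of order [dx]. *)
have SW : 4 / Lc ^+ 4 * dx <= S ^+ 3 / (2 * W%:R ^+ 4).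
  have L0 : 0 < Lc by apply: lt_le_trans WL; rewrite mulr_gt0.
  have -> : S ^+ 3 / (2 * W%:R ^+ 4) = (dx * S) ^+ 3 / (2 * (W%:R * dx) ^+ 4) * dx.
    by field; rewrite !gt_eqF.
  rewrite ler_wpM2r ?(ltW dx0)//.
  have -> : 4 / Lc ^+ 4 = 2 ^+ 3 / (2 * Lc ^+ 4) :> R by field; rewrite gt_eqF.
  apply: ler_pM.
  - by rewrite exprn_ge0.
  - by rewrite invr_ge0 mulr_ge0// exprn_ge0// ltW.
  - by rewrite lerXn2r// ?nnegrE// (le_trans _ S2).
  rewrite lef_pV2 ?posrE ?mulr_gt0 ?exprn_gt0 ?mulr_gt0//.
  by rewrite ler_pM2l// lerXn2r// nnegrE ltW// mulr_gt0.
have gain : kappa * T ^+ 2 / (lam * Lc ^+ 4) * dx <=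
    dx ^+ 2 * (lam * (kappa * (S ^+ 3 / (2 * W%:R ^+ 4)) * (n%:R * (n%:R - 1) / 2))).
  have L0 : 0 < Lc by apply: lt_le_trans WL; rewrite mulr_gt0.
  have -> : kappa * T ^+ 2 / (lam * Lc ^+ 4) * dx =
      dx ^+ 2 * (lam * (kappa * (4 / Lc ^+ 4 * dx) * (X ^+ 2 / 4))).
    by rewrite /X; field; rewrite !gt_eqF.
  rewrite ler_wpM2l ?exprn_ge0 ?(ltW dx0)// ler_wpM2l ?(ltW lam0)//.
  apply: ler_pM => //.
  - by rewrite mulr_ge0// mulr_ge0 ?(ltW dx0)// divr_ge0// exprn_ge0// ltW.
  - by rewrite divr_ge0// sqr_ge0.
  - by rewrite ler_wpM2l.
move: mom; rewrite -subr_ge0 -(pmulr_rge0 _ (_ : 0 < dx ^+ 2)) ?exprn_gt0//.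
by move: gain nE; lra.
Qed.

End scheme_moment.

(** * Shape of a fan: monotonicity and one-sided Lipschitz bound *)

Section fan_shape.
Variables (R : realType) (f : R -> R) (alpha : R).
Hypothesis alpha0 : 0 < alpha.
Hypothesis f'_convex : forall a b : R, a <= b -> alpha * (b - a) <= derive1 f b - derive1 f a.

Let S (p q xc tc x t : R) : set R := [set w | 0 <= w <= 1 /\
    (w = 0 \/ xc + (t - tc) * derive1 f (p + (q - p) * w) <= x)].

Let S0 p q xc tc x t : S p q xc tc x t 0.
Proof. by split; [rewrite lexx ler01|left]. Qed.

Let S1 p q xc tc x t : ubound (S p q xc tc x t) 1.
Proof. by move=> w [/andP[]]. Qed.

Let sup_ge p q xc tc x t w : S p q xc tc x t w -> w <= sup (S p q xc tc x t).
Proof. by apply: ub_le_sup; exists 1. Qed.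

Let sup01 p q xc tc x t : 0 <= sup (S p q xc tc x t) <= 1.
Proof. by rewrite sup_ge//= ge_sup//; exists 0. Qed.

Let sup_mono p q xc tc x y t : x <= y ->
  sup (S p q xc tc x t) <= sup (S p q xc tc y t).
Proof.
move=> xy; apply: ge_sup; first by exists 0.
by move=> w [w01 h]; apply: sup_ge; split => //; case: h => h; [left|right; exact: le_trans xy].
Qed.

Lemma fan_before p q xc tc x t :
  (forall w, 0 <= w <= 1 -> x < xc + (t - tc) * derive1 f (p + (q - p) * w)) ->
  fan f p q xc tc x t = p.
Proof.
move=> H; rewrite /fan -/(S p q xc tc x t).
have -> : S p q xc tc x t = [set 0].
  apply/seteqP; split => w /=; last by move=> ->; exact: S0.
  by move=> [w01 [//|]]; rewrite leNgt H.
by rewrite sup1 mulr0 addr0.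
Qed.

Lemma fan_after p q xc tc x t :
  xc + (t - tc) * derive1 f q <= x -> fan f p q xc tc x t = q.
Proof.
move=> H; rewrite /fan -/(S p q xc tc x t).
have -> : sup (S p q xc tc x t) = 1; last by rewrite mulr1 subrKC.
apply/le_anti; have /andP[_ ->] := sup01 p q xc tc x t; apply: sup_ge.
by split; [rewrite ler01 lexx|right; rewrite mulr1 subrKC].
Qed.

Lemma fan_nondecreasing p q xc tc t x y : p <= q -> x <= y ->
  fan f p q xc tc x t <= fan f p q xc tc y t.
Proof. by move=> pq xy; rewrite lerD2l ler_wpM2l ?subr_ge0//; exact: sup_mono. Qed.

Lemma fan_nonincreasing p q xc tc t x y : q <= p -> x <= y ->
  fan f p q xc tc y t <= fan f p q xc tc x t.
Proof. by move=> qp xy; rewrite lerD2l ler_wnM2l ?subr_le0//; exact: sup_mono. Qed.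

Lemma fan_distance p q xc tc t x y :
  `|fan f p q xc tc x t - fan f p q xc tc y t| <= `|q - p|.
Proof.
rewrite /fan -!/(S p q xc tc _ t).
have := sup01 p q xc tc x t; have := sup01 p q xc tc y t.
move: (sup _) (sup _) => v w /andP[v0 v1] /andP[w0 w1].
rewrite opprD addrACA subrr add0r -mulrBr normrM ler_piMr// ler_norml.
by move: v0 v1 w0 w1; lra.
Qed.

(** States at distance [e] have speeds at least [alpha e] apart, so after time [t - tc] they are
    separated by at least [(t - tc) alpha e]; this limits the rise over a length [d]. *)
Lemma fan_lip_plus p q xc tc t x d : p <= q -> 0 < t - tc -> 0 <= d ->
  fan f p q xc tc (x + d) t - fan f p q xc tc x t <= d / ((t - tc) * alpha).
Proof.
move=> pq c0 d0; have ca : 0 < (t - tc) * alpha by rewrite mulr_gt0.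
have [->|npq] := eqVneq p q.
  by rewrite /fan subrr !mul0r addr0 subrr divr_ge0// ltW.
have {}pq : 0 < q - p by rewrite subr_gt0 lt_neqAle npq.
rewrite /fan -!/(S p q xc tc _ t) opprD addrACA subrr add0r -mulrBr.
rewrite mulrC -ler_pdivlMr// lerBlDr -mulrA -invfM.
set e := d / _; have e0 : 0 <= e by rewrite divr_ge0// mulr_ge0// ltW.
apply: ge_sup; first by exists 0.
move=> w [/andP[w0 w1] h].
have [we|ew] := leP w e.
  by rewrite (le_trans we)// lerDl; case/andP: (sup01 p q xc tc x t).
rewrite -lerBlDl; apply: sup_ge; split.
  by rewrite subr_ge0 (ltW ew) lerBlDr (le_trans w1)// lerDl.
right; case: h => [w00|h].
  by move: ew; rewrite w00 ltNge e0.
have le : p + (q - p) * (w - e) <= p + (q - p) * w.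
  by rewrite lerD2l ler_pM2l// gerBl.
have := f'_convex le; rewrite -(ler_pM2l c0).
have -> : (t - tc) * (alpha * (p + (q - p) * w - (p + (q - p) * (w - e)))) = d.
  by rewrite /e; field; rewrite !gt_eqF.
by move: h; lra.
Qed.

End fan_shape.

(** * The initial datum and its solution *)

Section datum.
Variables (R : realType) (f : R -> R) (alpha T : R) (right : bool).
Hypotheses (alpha0 : 0 < alpha) (T0 : 0 < T).
Hypothesis f_derivable : forall x : R, derivable f x 1.
Hypothesis f'_convex : forall a b : R, a <= b -> alpha * (b - a) <= derive1 f b - derive1 f a.
Notation mu := (@lebesgue_measure R).

Let f'_homo : {homo derive1 f : x y / x <= y}.
Proof.
move=> x y xy; rewrite -subr_ge0; apply: le_trans (f'_convex xy).
by rewrite mulr_ge0 ?subr_ge0// ltW.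
Qed.

Definition plateau : R := if right then 1 else -1.
Definition datum_min : R := if right then 0 else -1.
Definition datum_max : R := if right then 1 else 0.
Definition speed_bound : R := `|derive1 f datum_min| + `|derive1 f datum_max|.
(** On [[0, T]] the time to a centre is at most [T + 1], so waves centred at [- D] and [D] are
    displaced by at most [D - 1]: the plateau on [[-1, 1[] persists and the support stays in
    [[- 2 D, 2 D]]. *)
Definition datum_radius : R := (T + 1) * speed_bound + 1.
Local Notation E := plateau.
Local Notation m := datum_min.
Local Notation M := datum_max.
Local Notation B := speed_bound.
Local Notation D := datum_radius.

(* A rarefaction wave that started at time -1 and a compression wave that
   focuses at time T, so that no entropy is lost on [0, T]. *)
Definition smooth_wave (x t : R) : R :=
  fan f 0 E (- D) (if right then -1 else T) x t
  + fan f E 0 D (if right then T else -1) x t - E.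
Local Notation u := smooth_wave.

Lemma speed_bound_ge0 : 0 <= B. Proof. by rewrite addr_ge0. Qed.

Lemma speed_boundP v : m <= v <= M -> `|derive1 f v| <= B.
Proof.
by move=> /andP[mv vM]; apply: normr_le_endpoints; rewrite !f'_homo.
Qed.

Lemma datum_radius_gt0 : 0 < D.
Proof. by rewrite ltr_wpDl// mulr_ge0 ?speed_bound_ge0// addr_ge0// ltW. Qed.

Let mM : m <= 0 <= M. Proof. by rewrite /m /M; case: right; rewrite ?lexx ?ler01 ?lerN10. Qed.
Let EM : m <= E <= M.
Proof. by rewrite /m /M /E; case: right; rewrite ?lexx ?ler01 ?lerN10. Qed.

Let state w : 0 <= w <= 1 ->
  m <= 0 + (E - 0) * w <= M /\ m <= E + (0 - E) * w <= M.
Proof.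
move=> /andP[w0 w1]; rewrite /m /M /E; case: right; split; apply/andP; split;
  by move: w0 w1; lra.
Qed.

Let displacement c v : `|c| <= T + 1 -> m <= v <= M -> - (D - 1) <= c * derive1 f v <= D - 1.
Proof.
move=> cT /speed_boundP vB; rewrite -ler_norml normrM /D addrK.
by rewrite ler_pM.
Qed.

Let delay t : 0 <= t <= T -> `|t - (if right then -1 else T)| <= T + 1 /\
  `|t - (if right then T else -1)| <= T + 1.
Proof.
move=> /andP[t0 tT]; case: right; split; rewrite ler_norml; apply/andP; split;
  by move: t0 tT; lra.
Qed.

Lemma left_wave_before x t : 0 <= t <= T -> x < - D - (D - 1) ->
  fan f 0 E (- D) (if right then -1 else T) x t = 0.
Proof.
move=> tT xD; apply: fan_before => w w01; apply: (lt_le_trans xD).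
by rewrite lerD2l; case/andP: (displacement (delay tT).1 (state w01).1).
Qed.

Lemma left_wave_after x t : 0 <= t <= T -> -1 <= x ->
  fan f 0 E (- D) (if right then -1 else T) x t = E.
Proof.
move=> tT xD; apply: fan_after; apply: le_trans xD.
have /andP[_] := displacement (delay tT).1 EM; lra.
Qed.

Lemma right_wave_before x t : 0 <= t <= T -> x < 1 ->
  fan f E 0 D (if right then T else -1) x t = E.
Proof.
move=> tT xD; apply: fan_before => w w01; apply: (lt_le_trans xD).
have /andP[+ _] := displacement (delay tT).2 (state w01).2; lra.
Qed.

Lemma right_wave_after x t : 0 <= t <= T -> D + (D - 1) <= x ->
  fan f E 0 D (if right then T else -1) x t = 0.
Proof.
move=> tT xD; apply: fan_after; apply: le_trans xD.
by rewrite lerD2l; case/andP: (displacement (delay tT).2 mM).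
Qed.

Let D1 : 1 <= D.
Proof. by rewrite lerDr mulr_ge0 ?speed_bound_ge0// addr_ge0// ltW. Qed.

Lemma smooth_wave_left x t : 0 <= t <= T -> x < - (2 * D) -> u x t = 0.
Proof.
move=> tT xD; rewrite /u left_wave_before//; last by move: xD; lra.
by rewrite right_wave_before ?add0r ?subrr//; move: xD D1; lra.
Qed.

Lemma smooth_wave_right x t : 0 <= t <= T -> 2 * D <= x -> u x t = 0.
Proof.
move=> tT xD; rewrite /u right_wave_after//; last by move: xD; lra.
by rewrite left_wave_after ?addr0 ?subrr//; move: xD D1; lra.
Qed.

Lemma smooth_wave_plateau x t : 0 <= t <= T -> -1 <= x < 1 -> u x t = E.
Proof.
move=> tT /andP[x1 x2]; rewrite /u left_wave_after// right_wave_before//.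
by rewrite addrK.
Qed.

Lemma smooth_wave_approx lo hi : lo <= - (2 * D) -> 2 * D <= hi ->
  front_approx f true m M T lo hi 0 0 u.
Proof.
move=> loD hiD.
have lo0 : lo <= 0 <= hi by apply/andP; split; move: loD hiD D1; lra.
apply: (front_approx_cat lo0 (q := E)).
  apply: (@front_approx_eq _ _ _ _ _ _ _ _ _ _
      (fun x t => fan f 0 E (- D) (if right then -1 else T) x t)).
    move=> x t /andP[_ x0] tT; rewrite /u right_wave_before ?addrK//.
    by rewrite (lt_trans x0).
  apply: fan_approx => // t tT.
  have /andP[h1 h2] := displacement (delay tT).1 mM.
  have /andP[h3 h4] := displacement (delay tT).1 EM.
  split; [|by move: h1 loD D1; lra|by move: h4 D1; lra].
  by case/andP: tT => t0 tT; rewrite /E; case: right; move: t0 tT; lra.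
apply: (@front_approx_eq _ _ _ _ _ _ _ _ _ _
    (fun x t => fan f E 0 D (if right then T else -1) x t)).
  move=> x t /andP[x0 _] tT; rewrite /u left_wave_after//.
    by rewrite addrAC subrr add0r.
  by rewrite (le_trans _ x0)// lerN10.
apply: fan_approx => // t tT.
have /andP[h1 h2] := displacement (delay tT).2 mM.
have /andP[h3 h4] := displacement (delay tT).2 EM.
split; [|by move: h3 D1; lra|by move: h2 hiD D1; lra].
by case/andP: tT => t0 tT; rewrite /E; case: right; move: t0 tT; lra.
Qed.

Lemma smooth_wave_range x t : 0 <= t <= T -> m <= u x t <= M.
Proof.
move=> tT; apply: (front_approx_range mM
  (smooth_wave_approx (lexx _) (lexx _))) => // y s.
  by move=> yD sT; exact: smooth_wave_left.
by move=> yD sT; exact: smooth_wave_right.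
Qed.

Let t0T : ((0 : R) <= 0) && (0 <= T). Proof. by rewrite lexx ltW. Qed.

(** At time 0 the rarefaction has age 1, hence slope at most [1 / alpha]; the compression is
    nonincreasing. *)
Lemma smooth_wave_lip_plus : lip_plus_bounded (fun x => u x 0).
Proof.
have pos x d : 0 < d -> u (x + d) 0 - u x 0 <= d / alpha.
  move=> d0; have xd : x <= x + d by rewrite lerDl ltW.
  rewrite /u; have -> (a b c d' e : R) : a + b - e - (c + d' - e) = (a - c) + (b - d') by ring.
  rewrite -[leRHS]addr0 /E; case: right.
    apply: lerD; last by rewrite subr_le0; apply: fan_nonincreasing => //; exact: ler01.
    have := @fan_lip_plus _ f alpha alpha0 f'_convex 0 1 (- D) (-1) 0 x d ler01.
    by rewrite opprK add0r mul1r => /(_ ltr01 (ltW d0)).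
  rewrite addrC; apply: lerD; last first.
    by rewrite subr_le0; apply: fan_nonincreasing => //; exact: lerN10.
  have := @fan_lip_plus _ f alpha alpha0 f'_convex (-1) 0 D (-1) 0 x d (lerN10 _).
  by rewrite opprK add0r mul1r => /(_ ltr01 (ltW d0)).
exists alpha^-1 => x d; rewrite neq_lt => /orP[dn|dp]; last first.
  by rewrite ler_pdivrMr// mulrC pos.
rewrite ler_ndivrMr//.
have := pos (x + d) (- d); rewrite oppr_gt0 addrK => /(_ dn).
by rewrite mulNr mulrC; lra.
Qed.

Lemma smooth_wave_admissible : admissible_datum (fun x => u x 0).
Proof.
split; last exact: smooth_wave_lip_plus.
apply: (@subclosed_compact _ _ ([set` `[- (2 * D), 2 * D]] : set R)).
- exact: closed_closure.
- exact: segment_compact.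
- have closedI : closed ([set` `[- (2 * D), 2 * D]] : set R) by exact: interval_closed.
  rewrite [X in _ `<=` X]((closure_id _).1 closedI); apply: closure_subset.
  move=> x /= ux; rewrite in_itv/=; apply/andP; split.
    by rewrite leNgt; apply: contra ux => xD; rewrite smooth_wave_left.
  by rewrite leNgt; apply: contra ux => /ltW xD; rewrite smooth_wave_right.
Qed.

Lemma monotone_total_variation (v : R -> R) (a b K : R) : a <= b ->
  {homo v : x y / x <= y} \/ {homo v : x y / x <= y >-> y <= x} ->
  (forall x y, `|v x - v y| <= K) -> (total_variation a b v <= K%:E)%E.
Proof.
move=> ab vmono vK.
have up (w : R -> R) : {homo w : x y / x <= y} -> (forall x y, `|w x - w y| <= K) ->
    (total_variation a b w <= K%:E)%E.
  move=> wm wK; rewrite nondecreasing_total_variation//.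
    by rewrite lee_fin (le_trans (ler_norm _))//.
  by move=> x y _ _; exact: wm.
case: vmono => vm; first exact: up.
rewrite -total_variationN; apply: up => x y.
  by move=> /vm; rewrite lerN2.
by rewrite /= -opprD normrN.
Qed.

(** Each wave is monotone of height 1. The bound enters the W_1 error of averaging the datum. *)
Lemma smooth_wave_variation : (total_variationR (fun x => u x 0) <= 2%:E)%E.
Proof.
apply: ge_ereal_sup => _ [[a b] /= ab <-].
pose v1 x := fan f 0 E (- D) (if right then -1 else T) x 0.
pose v2 x := fan f E 0 D (if right then T else -1) x 0 - E.
have -> : (fun x => u x 0) = v1 \+ v2 by apply/funext => x; rewrite /u /v1 /v2 /=; ring.
apply: (le_trans (total_variation_le _ _ ab)).
have E1 : `|E - 0| = 1 /\ `|0 - E| = 1.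
  by rewrite subr0 sub0r normrN /E; case: right; split; rewrite ?normrN normr1.
have -> : 2%:E = (1%:E + 1%:E)%E :> \bar R by rewrite -EFinD; congr EFin; ring.
apply: leeD; apply: monotone_total_variation => //.
- rewrite /v1 /E; case: right; [left|right] => x y xy.
    by apply: fan_nondecreasing => //; exact: ler01.
  by apply: fan_nonincreasing => //; exact: lerN10.
- by move=> x y; rewrite /v1 (le_trans (fan_distance _ _ _ _ _ _ _ _))// E1.1.
- rewrite /v2 /E; case: right; [right|left] => x y xy; rewrite lerD2r.
    by apply: fan_nonincreasing => //; exact: ler01.
  by apply: fan_nondecreasing => //; exact: lerN10.
- move=> x y; rewrite /v2 opprB addrA subrK (le_trans (fan_distance _ _ _ _ _ _ _ _))//.
  by rewrite E1.2.
Qed.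

End datum.

(** * The scheme run on this datum *)

Section lower_bound.
Variables (R : realType) (f : R -> R) (alpha T : R) (right : bool).
Hypotheses (alpha0 : 0 < alpha) (T0 : 0 < T).
Hypothesis f_derivable : forall x : R, derivable f x 1.
Hypothesis f'_continuous : continuous (derive1 f).
Hypothesis f'_convex : forall a b : R, a <= b -> alpha * (b - a) <= derive1 f b - derive1 f a.
Hypothesis f'_sign : if right then 0 <= derive1 f 0 else derive1 f 0 <= 0.
Notation mu := (@lebesgue_measure R).
Local Notation E := (plateau R right).
Local Notation m := (datum_min R right).
Local Notation M := (datum_max R right).
Local Notation B := (speed_bound f right).
Local Notation D := (datum_radius f T right).
Local Notation u := (smooth_wave f T right).

Let f'_homo : {homo derive1 f : x y / x <= y}.
Proof.
move=> x y xy; rewrite -subr_ge0; apply: le_trans (f'_convex xy).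
by rewrite mulr_ge0 ?subr_ge0// ltW.
Qed.

(** Charging the decreasing jumps as well only raises the total, as their costs are nonnegative by
    convexity. *)
Lemma front_approx_admissible_shocks m' M' tau lo hi l r v :
  front_approx f true m' M' tau lo hi l r v -> front_approx f false m' M' tau lo hi l r v.
Proof.
move=> vP e e0; have [L [L1 L2 L3 L4 L5]] := vP e e0; exists L; split => //.
apply: le_trans L2; apply: ler_sum => p _; rewrite /front_cost/=.
case: ifPn => //; rewrite -ltNge => rl.
by rewrite mulr_le0 ?subr_le0 ?f'_homo// ltW.
Qed.

Let m0 : m <= 0. Proof. by rewrite /m; case: right; rewrite ?lerN10. Qed.
Let M0 : 0 <= M. Proof. by rewrite /M; case: right; rewrite ?ler01. Qed.
Let zM : m <= 0 <= M. Proof. by rewrite m0 M0. Qed.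

Let uapp lo hi : lo <= - (2 * D) -> 2 * D <= hi -> front_approx f true m M T lo hi 0 0 u.
Proof. exact: smooth_wave_approx alpha0 T0 f_derivable f'_convex _ _. Qed.
Let uleft (x t : R) : 0 <= t <= T -> x < - (2 * D) -> u x t = 0.
Proof. exact: smooth_wave_left alpha0 T0 f'_convex _ _. Qed.
Let uright (x t : R) : 0 <= t <= T -> 2 * D <= x -> u x t = 0.
Proof. exact: smooth_wave_right alpha0 T0 f'_convex _ _. Qed.
Let urange (x t : R) : 0 <= t <= T -> m <= u x t <= M.
Proof. exact: (smooth_wave_range right alpha0 T0 f_derivable f'_convex x). Qed.

Lemma smooth_wave_entropy : entropy_evolution f T (fun x => u x 0) (fun x => u x T).
Proof.
exists u; split => //.
have uP := uapp (lexx _) (lexx _).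
apply: (front_approx_entropy_solution f_derivable f'_homo zM
  (front_approx_admissible_shocks uP)) => x t xD tT.
  exact: uleft.
exact: uright.
Qed.

(** Gives [lam |f'| <= 1/2] on the data, the margin on which the dissipation estimate relies. *)
Definition upwind_ratio : R := (2 * (B + 1))^-1.
Local Notation lam := upwind_ratio.

Let B1 : 0 < B + 1. Proof. by rewrite ltr_wpDl// speed_bound_ge0. Qed.

Lemma upwind_ratio_gt0 : 0 < lam.
Proof. by rewrite invr_gt0 mulr_gt0. Qed.

Let lam0 := upwind_ratio_gt0.

Let speed2 v : m <= v <= M -> `|lam * derive1 f v| <= 2^-1.
Proof.
move=> /(speed_boundP alpha0 f'_convex) vB; rewrite normrM (gtr0_norm lam0) /lam.
rewrite mulrC ler_pdivrMr ?mulr_gt0// mulrA mulVf// mul1r.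
by rewrite (le_trans vB)// lerDl.
Qed.

Let sign v : m <= v <= M -> 0 <= E * derive1 f v.
Proof.
move: f'_sign; rewrite /m /M /E; case: right => f0 /andP[v0 v1].
  by rewrite mul1r (le_trans f0)// f'_homo.
by rewrite mulN1r oppr_ge0 (le_trans _ f0)// f'_homo.
Qed.

Lemma upwind_ratio_cfl v : m <= v <= M ->
  if right then 0 <= lam * derive1 f v <= 1 else -1 <= lam * derive1 f v <= 0.
Proof.
move=> vM; have := speed2 vM; have := sign vM; rewrite /E ler_norml.
rewrite -(pmulr_rge0 _ lam0).
case: right => h /andP[h1 h2]; apply/andP; split; move: h h1 h2; lra.
Qed.

Let EE : E * E = 1. Proof. by rewrite /E; case: right; rewrite ?mul1r// mulN1r opprK. Qed.

(** Reflected by [E], the states lie in [[0, 1]] and the speeds are nonnegative in both cases;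
    subtracting [f 0] lets empty cells contribute nothing. *)
Let g (v : R) : R := f (E * v) - f 0.
Let dg (v : R) : R := E * derive1 f (E * v).

Let Ev v : 0 <= v <= 1 -> m <= E * v <= M.
Proof.
rewrite /m /M /E => /andP[v0 v1]; case: right; apply/andP; split; move: v0 v1; lra.
Qed.

Let vE v : m <= v <= M -> 0 <= E * v <= 1.
Proof.
rewrite /m /M /E; case: right => /andP[v0 v1]; apply/andP; split; move: v0 v1; lra.
Qed.

Let scaled_derive (h : R -> R) (x d : R) : is_derive (E * x) 1 h d ->
  is_derive x 1 (fun v => h (E * v)) (E * d).
Proof.
move=> hd; have inner : is_derive x 1 (fun v : R => E * v) E.
  by apply: is_derive_eq; rewrite /GRing.scale/=; ring.
have := @is_derive1_comp _ h (fun v : R => E * v) x _ _ hd inner.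
by rewrite mulrC.
Qed.

Let g_derive (x : R) : is_derive x 1 g (dg x).
Proof.
have fd : is_derive (E * x) 1 f (derive1 f (E * x)) by rewrite derive1E; exact: derivableP.
have sd := scaled_derive fd.
by rewrite /g; apply: is_derive_eq; rewrite subr0.
Qed.

Let g_square_antiderivative : exists Q Q' : R -> R,
  (forall x : R, m <= x <= M -> is_derive x 1 Q (derive1 f x ^+ 2)) /\
  (forall x : R, 0 <= x <= 1 -> is_derive x 1 Q' (dg x ^+ 2)).
Proof.
have cf2 : continuous (fun x => derive1 f x ^+ 2 : R).
  by move=> x; apply: (@continuous_comp _ _ _ (derive1 f) (fun y : R => y ^+ 2));
    [exact: f'_continuous|exact: exprn_continuous].
(* Any start left of -1 would do: the derivative is available strictly to the right of it, and
   [datum_min] is 0 or -1. *)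
have [Q HQ] := antiderivative (-2) cf2.
have dQ (x : R) : m <= x <= M -> is_derive x 1 Q (derive1 f x ^+ 2).
  move=> /andP[mx _]; apply: HQ; apply: lt_le_trans mx.
  by rewrite /m; case: right; lra.
exists Q, (fun v => E * Q (E * v)); split => // x /Ev/dQ Qd.
have sd := scaled_derive Qd.
apply: is_derive_eq; rewrite /GRing.scale/= /dg exprMn expr2.
by rewrite mulrA -!expr2.
Qed.

Let dg_convex a b : 0 <= a -> a <= b -> b <= 1 -> alpha * (b - a) <= dg b - dg a.
Proof.
move=> _ ab _; rewrite /dg /E; case: right.
  by rewrite !mul1r; exact: f'_convex.
have /f'_convex : - b <= - a by rewrite lerN2.
by rewrite !mulN1r; lra.
Qed.

Let dg0 : 0 <= dg 0. Proof. by rewrite /dg mulr0; exact: sign. Qed.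

Let cfl x : 0 <= x <= 1 -> lam * dg x <= 2^-1.
Proof.
move=> /Ev/speed2; rewrite /dg mulrCA; apply: le_trans.
rewrite -[leRHS]mul1r; have <- : `|E| = 1 by rewrite /E; case: right; rewrite ?normrN normr1.
by rewrite -normrM ler_norm.
Qed.

Let g0 : g 0 = 0. Proof. by rewrite /g mulr0 subrr. Qed.

(** Support [4 D], spreading by one cell per step of at most [T / lam] on each side, and 3 for
    rounding to the grid and two spare cells, as [dx <= 1]. *)
Definition window_length : R := 4 * D + 2 * T / lam + 3.
(** Half of the gain in [scheme_moment_gap]; the other half absorbs the error of averaging the
    datum. *)
Definition gap_constant : R :=
  dissipation_rate lam alpha * T ^+ 2 / (lam * window_length ^+ 4) / 2.
Local Notation Lc := window_length.
Local Notation c := gap_constant.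

Let D0 : 0 < D. Proof. exact: datum_radius_gt0. Qed.

Let Lc0 : 0 < Lc.
Proof.
rewrite /Lc ltr_wpDl// addr_ge0//; first by rewrite mulr_ge0// ltW.
by rewrite divr_ge0 ?mulr_ge0// ltW.
Qed.

Lemma gap_constant_gt0 : 0 < c.
Proof.
have kappa0 : 0 < dissipation_rate lam alpha.
  by rewrite divr_gt0// mulr_gt0// exprn_gt0.
by rewrite /c !divr_gt0// mulr_gt0// exprn_gt0.
Qed.

Section mesh.
Variables (o dx : R).
Hypotheses (dx0 : 0 < dx) (dx1 : dx <= 1) (dxT : 6 * (lam * dx) <= T) (dxc : dx <= c / 2).
Notation gp := (grid_point o dx).

Let n := Num.truncn (T / (lam * dx)).
Let a := Num.floor ((- (2 * D) - o) / dx).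
Let b := Num.floor ((2 * D - o) / dx).
(** Up to step [n] the cells [i0] and [i0 + W], which is [b + n + 1], are empty; one of them becomes
    index 0 of [z], depending on the direction. *)
Let i0 : int := a - n%:Z - 1.
Let W : nat := absz (b - a + (n + n).+2%:Z)%R.
Let C k := fv_values (upwind_flux f right) lam o dx (fun x => u x 0) k.
Let lo := gp i0.
Let hi := gp (i0 + W%:Z).

Let t0T : ((0 : R) <= 0) && (0 <= T). Proof. by rewrite lexx ltW. Qed.
Let TT : 0 <= T <= T. Proof. by rewrite lexx ltW. Qed.

Let mu0 : measurable_fun setT (fun x => u x 0).
Proof. by apply: lip_plus_measurable; exact: smooth_wave_lip_plus alpha0 f'_convex. Qed.

Let u0M x : m <= u x 0 <= M.
Proof. by exact: urange. Qed.

Let CM k i : m <= C k i <= M.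
Proof. by apply: fv_values_range => //; exact: upwind_ratio_cfl. Qed.

Let C0_support i : (i < a)%R || (b < i)%R -> C 0 i = 0.
Proof.
apply: cell_average_support => // x xD.
have [xl|xl] := ltP x (- (2 * D)); first exact: uleft.
have [xr|xr] := ltP (2 * D) x; last by exfalso; apply: xD; rewrite xl.
by apply: uright => //; exact: ltW.
Qed.

Let C_support k i : (i < a - k%:Z)%R || (b + k%:Z < i)%R -> C k i = 0.
Proof. by apply: fv_values_support; exact: C0_support. Qed.

(* Nothing enters the upwind side of the support. *)
Let C_upwind k i : (if right then (i < a)%R else (b < i)%R) -> C k i = 0.
Proof.
elim: k i => [|k IH] i ii.
  by apply: C0_support; move: ii; case: right => ->; rewrite ?orbT.
rewrite /C/= upwind_updateE -/(C k); move: IH ii; case: right => IH ii.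
  by rewrite !IH// ?subrr ?mulr0 ?subr0// (lt_trans _ ii)// gtrBl.
by rewrite !IH// ?subrr ?mulr0 ?subr0// (lt_trans ii)// ltrDl.
Qed.

Let ab : (a <= b)%R.
Proof.
rewrite /a /b le_floor// ler_pM2r ?invr_gt0// lerD2r.
by move: D0; lra.
Qed.

Let WE : i0 + W%:Z = b + n%:Z + 1.
Proof. by rewrite /i0 /W; move: (a) (b) (n) ab; clear; lia. Qed.

Let gp_mono i j : (i <= j)%R -> gp i <= gp j.
Proof. by move=> ij; rewrite /grid_point lerD2l ler_pM2r// ler_int. Qed.

Let lo_le : lo <= - (2 * D).
Proof.
apply: (@le_trans _ _ (gp a)).
  by apply: gp_mono; rewrite /i0; clear; lia.
rewrite /grid_point -lerBrDl -ler_pdivlMr//.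
by have /andP[] := floor_itv ((- (2 * D) - o) / dx).
Qed.

Let hi_ge : 2 * D <= hi.
Proof.
apply: (@le_trans _ _ (gp (b + 1))); last first.
  by apply: gp_mono; rewrite WE; clear; lia.
rewrite /grid_point -lerBlDl -ler_pdivrMr// ltW//.
by have /andP[] := floor_itv ((2 * D - o) / dx).
Qed.

Let lohi : lo <= hi. Proof. exact: grid_point_le. Qed.

(** Numbered from the upwind end and signed to be nonnegative, both directions obey the same
    recursion. *)
Let z (k j : nat) : R :=
  if right then C k (i0 + j%:Z) else - C k (i0 + W%:Z - j%:Z).

Let z_step k j : z k.+1 j.+1 = z k j.+1 - lam * (g (z k j.+1) - g (z k j)).
Proof.
rewrite /z /g /E /C /= !upwind_updateE; case: right.
  have -> : i0 + j.+1%:Z - 1 = i0 + j%:Z by clear; lia.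
  by rewrite !mul1r; ring.
have -> : i0 + W%:Z - j.+1%:Z + 1 = i0 + W%:Z - j%:Z by clear; lia.
by rewrite !mulN1r !opprK; ring.
Qed.

Let z_left k : z k 0%N = 0.
Proof.
have := @C_upwind k; rewrite /z; case: right => H.
  by rewrite H// /i0; clear; lia.
by rewrite H ?oppr0// WE; clear; lia.
Qed.

Let z_right k j : (k <= n)%N -> (W <= j)%N -> z k j = 0.
Proof.
move=> kn Wj; rewrite /z; case: right.
  apply: C_support; have := WE; move: (b) (i0) (a) (n) (W) kn Wj; clear; lia.
rewrite C_support ?oppr0//; have := WE; rewrite {2}/i0.
move: (b) (i0) (a) (n) (W) kn Wj; clear; lia.
Qed.

Let z_range k j : 0 <= z k j <= 1.
Proof.
rewrite /z; have := CM k; rewrite /m /M; case: right => H.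
  exact: H.
have /andP[h1 h2] := H (i0 + W%:Z - j%:Z).
by rewrite oppr_ge0 h2 lerNl h1.
Qed.

(** In the reflected case index [j] is cell [i0 + W - j], so reversing the sum is off by one;
    [sum_shift] corrects this since both end terms vanish. *)
Let sum_z (F : nat -> R -> R) k : (forall j, F j 0 = 0) -> (k <= n)%N ->
  \sum_(0 <= j < W) F j (z k j) =
  \sum_(0 <= j < W) F (if right then j else (W - j)%N) (E * C k (i0 + j%:Z)).
Proof.
move=> F0 kn; rewrite /z /E; have := z_left k; have := z_right kn (leqnn W).
rewrite /z; case: right => zl zr; first by under [RHS]eq_bigr do rewrite mul1r.
rewrite -(sum_shift (F := fun j => F j (- C k (i0 + W%:Z - j%:Z)))) ?zr ?zl ?F0//.
rewrite big_nat_rev /= add0n big_nat [RHS]big_nat; apply: eq_bigr => j /andP[_ jW].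
rewrite subnSK// mulN1r; congr (F _ (- C k _)).
by move: (W) jW; clear; lia.
Qed.

Let moment_C k : (k <= n)%N ->
  \int[mu]_(x in [set` `[lo, hi[]) ((hi - x) * piecewise_constant o dx (C k) x) =
  dx ^+ 2 * ((if right then W%:R - 2^-1 else 2^-1) * \sum_(0 <= j < W) z k j
    - \sum_(0 <= j < W) j%:R * z k j).
Proof.
move=> kn; rewrite (@moment_piecewise_constant _ o dx dx0 _ 1); last first.
  by move=> j; have := CM k j; rewrite /m /M ler_norml; case: right => /andP[h1 h2];
    apply/andP; split; move: h1 h2; lra.
congr (_ * _); rewrite mulr_sumr -sumrB.
rewrite (@sum_z (fun j v => (if right then W%:R - 2^-1 else 2^-1) * v - j%:R * v) k)//;
  last by move=> j; rewrite !mulr0 subrr.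
rewrite big_nat [RHS]big_nat; apply: eq_bigr => j /andP[_ jW]; rewrite /E.
case: right; first by ring.
by rewrite natrB ?(ltnW jW)//; ring.
Qed.

(** The plateau of height 1 on [[-1, 1[] already carries mass 2; its indicator is a difference of
    two steps. *)
Let mass_z : 2 <= dx * \sum_(0 <= j < W) z 0%N j.
Proof.
rewrite (@sum_z (fun _ v => v) 0)// -mulr_sumr mulrCA.
rewrite (sum_cell_average o dx0 mu0 u0M) -/lo -/hi.
have D1 : 1 <= D by rewrite lerDr mulr_ge0 ?speed_bound_ge0// addr_ge0// ltW.
have inm : lo <= -1 <= hi by apply/andP; split; move: lo_le hi_ge D1; lra.
have inp : lo <= 1 <= hi by apply/andP; split; move: lo_le hi_ge D1; lra.
have im := integral_weight_step lohi (@derivable_id_line _) (@continuous_derive1_id _)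
  (@derive1_id_le1 _ lo hi) inm.
have ip := integral_weight_step lohi (@derivable_id_line _) (@continuous_derive1_id _)
  (@derive1_id_le1 _ lo hi) inp.
move: im ip; under eq_Rintegral do rewrite derive1_idE mul1r.
under [in X in _ -> X -> _]eq_Rintegral do rewrite derive1_idE mul1r.
rewrite /= => im ip.
have istep (r : R) : mu.-integrable [set` `[lo, hi[] (EFin \o (fun x : R => (r <= x)%R%:R : R)).
  apply: (@bounded_integrable_window _ _ _ lohi _ 1).
    by apply: measurable_funTS; exact: measurable_step.
  by move=> x _; case: (r <= x); rewrite ?normr0 ?normr1.
have iu : mu.-integrable [set` `[lo, hi[] (EFin \o (fun x => u x 0)).
  apply: (@bounded_integrable_window _ _ _ lohi _ 1); first exact: measurable_funTS.
  move=> x _; have := u0M x; rewrite /m /M ler_norml; case: right => /andP[h1 h2];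
    by apply/andP; split; move: h1 h2; lra.
have mI : measurable ([set` `[lo, hi[] : set R) by exact: measurable_itv.
rewrite -RintegralZl//.
have -> : (2 : R) = hi - -1 - (hi - 1) by ring.
rewrite -im -ip -RintegralB//.
apply: le_Rintegral => //.
- rewrite (_ : _ \o _ = ((EFin \o (fun x : R => (-1 <= x)%R%:R)) \-
     (EFin \o (fun x : R => (1 <= x)%R%:R)))%E)//.
  exact: integrableB.
- rewrite (_ : _ \o _ = fun x => (E%:E * (EFin \o (fun x => u x 0)) x)%E)//.
  exact: integrableZl.
move=> x _; have uE : 0 <= E * u x 0 by case/andP: (vE (u0M x)).
have [x1|x1] := leP (-1) x; last first.
  by have [x2|x2] := leP 1 x; [move: x1 x2; lra|rewrite subrr].
have [x2|x2] := leP 1 x; first by rewrite subrr.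
by rewrite subr0 (smooth_wave_plateau right alpha0 f'_convex t0T) ?EE// x1.
Qed.

Let WL : W%:R * dx <= Lc.
Proof.
have -> : W%:R = (b%:~R - a%:~R) + (n%:R + n%:R + 2) :> R.
  have : W%:Z = b - a + (n + n).+2%:Z by move: WE; rewrite /i0; clear; lia.
  move=> /(congr1 (fun i : int => i%:~R : R)); rewrite -pmulrn => ->.
  by rewrite intrD intrB -pmulrn -!natr1 natrD; ring.
have n1 : n%:R * (lam * dx) <= T.
  have X0 : 0 <= T / (lam * dx) by rewrite divr_ge0// ?ltW// mulr_gt0.
  by have /andP[h _] := truncn_itv X0; move: h; rewrite ler_pdivlMr// mulr_gt0.
have n2 : n%:R * dx <= T / lam.
  by rewrite ler_pdivlMr// -mulrA (mulrC dx).
have ba : (b%:~R - a%:~R) * dx <= 4 * D + dx.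
  have /andP[h1 _] := floor_itv ((2 * D - o) / dx).
  have /andP[_ h2] := floor_itv ((- (2 * D) - o) / dx).
  rewrite -/b -/a intrD in h1 h2; rewrite ler_pdivlMr// in h1.
  rewrite ltr_pdivrMr// in h2; move: h1 h2; lra.
rewrite /Lc; move: n2 ba dx1; lra.
Qed.

Let J := \int[mu]_(x in [set` `[lo, hi[]) f (u x 0) - f 0 * (hi - lo).

Let energy_z : dx * \sum_(0 <= j < W) g (z 0%N j) <= J.
Proof.
rewrite (@sum_z (fun _ v => g v) 0)//.
have gC j : g (E * C 0 (i0 + j%:Z)) = f (C 0 (i0 + j%:Z)) - f 0.
  by rewrite /g mulrA EE mul1r.
under eq_bigr do rewrite gC.
rewrite sumrB mulrBr /J lerB//.
  exact: (sum_flux_cell_average o dx0 f_derivable f'_homo mu0 u0M).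
rewrite sumr_const_nat subn0 /hi /lo grid_pointD -mulr_natr.
by rewrite le_eqVlt; apply/orP; left; apply/eqP; ring.
Qed.

Let muT : measurable_fun setT (fun x => u x T).
Proof.
apply: (front_approx_measurable (f := f) zM
  (uapp (lexx _) (lexx _))) => // x t xD tT.
  exact: uleft.
exact: uright.
Qed.

Let abs1 v : m <= v <= M -> `|v| <= 1.
Proof.
by rewrite /m /M ler_norml; case: right => /andP[h1 h2]; apply/andP; split; move: h1 h2; lra.
Qed.

Let pcM k x : m <= piecewise_constant o dx (C k) x <= M. Proof. exact: CM. Qed.

(** One order of the arguments serves the comparison at time [T], the other that of the averaged
    datum with the datum. *)
Let moment_distance (v : R -> R) k : (k <= n)%N -> measurable_fun setT v ->
  (forall x, m <= v x <= M) -> (forall x, ~ (lo <= x < hi) -> v x = 0) ->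
  (`|\int[mu]_(x in [set` `[lo, hi[]) ((hi - x) * v x)
   - \int[mu]_(x in [set` `[lo, hi[]) ((hi - x) * piecewise_constant o dx (C k) x)|%:E
  <= wasserstein1 v (piecewise_constant o dx (C k)))%E /\
  (`|\int[mu]_(x in [set` `[lo, hi[]) ((hi - x) * piecewise_constant o dx (C k) x)
   - \int[mu]_(x in [set` `[lo, hi[]) ((hi - x) * v x)|%:E
  <= wasserstein1 (piecewise_constant o dx (C k)) v)%E.
Proof.
move=> kn mv vM v0; have mpc := measurable_piecewise_constant o dx0 (C k).
have iw (h : R -> R) : measurable_fun setT h -> (forall x, m <= h x <= M) ->
    mu.-integrable [set` `[lo, hi[] (EFin \o (fun x => (hi - x) * h x)).
  move=> mh hM; apply: (@bounded_integrable_window _ _ _ lohi _ (hi - lo)).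
    by apply: measurable_funTS; apply: measurable_funM => //; exact: measurable_funB.
  move=> x; rewrite /= in_itv/= => /andP[x1 x2].
  rewrite normrM ger0_norm ?subr_ge0 ?(ltW x2)// -[leRHS]mulr1 ler_pM ?abs1//.
    by rewrite subr_ge0 ltW.
  by rewrite lerB.
have v_out x : ~ (lo <= x < hi) -> v x = piecewise_constant o dx (C k) x.
  move=> xD; rewrite v0//; apply/esym; rewrite /piecewise_constant.
  have xi := mem_cell_floor o dx0 x; set i := Num.floor _ in xi *.
  apply: C_support; apply/orP; move: xi => /cellE/andP[x1 x2].
  have [ii|ii] := ltP i i0.
    by left; move: ii; rewrite /i0; move: (a) (n) kn; clear; lia.
  right; have [i2|i2] := ltP i (i0 + W%:Z).
    exfalso; apply: xD; rewrite /lo /hi (le_trans (gp_mono ii) x1)/=.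
    apply: (lt_le_trans x2); apply: gp_mono.
    by move: i2; move: (i) (i0) (W); clear; lia.
  by move: i2; rewrite WE; move: (b) (n) (i) kn; clear; lia.
have d2 x : `|v x| <= 1 /\ `|piecewise_constant o dx (C k) x| <= 1.
  by split; apply: abs1.
split; (rewrite -RintegralB//; [|exact: iw|exact: iw]);
  under eq_Rintegral do rewrite -mulrBr;
  apply: (@wasserstein1_moment _ _ _ _ _ (1 + 1)) => //.
- exact: measurable_funB.
- by move=> x; have [h1 h2] := d2 x; apply: (le_trans (ler_normB _ _)); apply: lerD.
- exact: measurable_funB.
- by move=> x; have [h1 h2] := d2 x; apply: (le_trans (ler_normB _ _)); apply: lerD.
- by move=> x xD; rewrite v_out.
Qed.

Let outside t : 0 <= t <= T -> forall x, ~ (lo <= x < hi) -> u x t = 0.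
Proof.
move=> tT x xD; have [xl|xl] := ltP x lo.
  by apply: uleft => //; exact: lt_le_trans lo_le.
have [xr|xr] := ltP x hi; first by exfalso; apply: xD; rewrite xl.
by apply: uright => //; exact: le_trans xr.
Qed.

Let iu0 : mu.-integrable setT (EFin \o (fun x => u x 0)).
Proof.
have -> : EFin \o (fun x => u x 0) = (EFin \o (fun x => u x 0)) \_ [set` `[lo, hi[].
  apply/funext => x; rewrite patchE; case: ifPn => // nD.
  rewrite /= outside// => xD; move: nD; rewrite notin_setE; apply.
  by rewrite /= in_itv.
have [+ _] := integrable_mkcond (mu := mu) (EFin \o (fun x => u x 0))
  (measurable_itv `[lo, hi[); apply.
apply: (@bounded_integrable_window _ _ _ lohi _ 1); first exact: measurable_funTS.
by move=> x _; exact: abs1.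
Qed.

Lemma smooth_wave_scheme_gap : ((c * dx)%:E <= wasserstein1 (fun x => u x T)
  (fun x => fv_approximation (upwind_flux f right) lam o dx (fun x => u x 0) x T))%E.
Proof.
have [Q [Q' [dQ dQ']]] := g_square_antiderivative.
have gap := scheme_moment_gap lam0 alpha0 dx0 g_derive dQ' dg_convex dg0 cfl g0
  z_step z_left z_right z_range (if right then W%:R - 2^-1 else 2^-1) dxT mass_z WL energy_z.
rewrite -(moment_C (leqnn n)) -(moment_C (leq0n n)) in gap.
have momT := front_approx_moment f_derivable f'_homo dQ (@speed_boundP _ f alpha right alpha0 f'_convex)
  lohi (ltW T0) zM (uapp lo_le hi_ge).
rewrite -/J in momT.
have [dT _] := moment_distance (leqnn n) muT (fun x => urange x TT) (outside TT).
have [_ d0] := moment_distance (leq0n n) mu0 u0M (outside t0T).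
have avg := wasserstein1_average o dx0 iu0.
have var : ((dx ^+ 2)%:E * total_variationR (fun x => u x 0) <= (2 * dx ^+ 2)%:E)%E.
  have -> : (2 * dx ^+ 2)%:E = ((dx ^+ 2)%:E * 2%:E)%E by rewrite -EFinM; congr EFin; ring.
  apply: lee_wpmul2l; first by rewrite lee_fin sqr_ge0.
  exact: smooth_wave_variation.
have {avg var}d0 := le_trans d0 (le_trans avg var).
rewrite lee_fin in d0.
apply: le_trans dT; rewrite lee_fin.
(* Here [dx <= c / 2] enters: the averaging error [2 dx^2] takes at most half of the gain
   [2 c dx]. *)
have small : 2 * dx ^+ 2 <= c * dx.
  by rewrite expr2 mulrA ler_wpM2r ?(ltW dx0)// mulrC -ler_pdivlMr.
have -> : \int[mu]_(x in [set` `[lo, hi[]) ((hi - x) * u x T) =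
  \int[mu]_(x in [set` `[lo, hi[]) ((hi - x) * u x 0) - T * J by exact: momT.
have cE : dissipation_rate lam alpha * T ^+ 2 / (lam * Lc ^+ 4) * dx = 2 * (c * dx).
  by rewrite /c; field; rewrite !gt_eqF.
rewrite cE in gap; rewrite distrC; apply: le_trans (ler_norm _).
move: d0; rewrite ler_norml => /andP[d0 _].
move: gap small d0; lra.
Qed.

End mesh.
End lower_bound.

Theorem theorem3p1 (R : realType) (f : R -> R) (alpha : R)
    (alpha_gt0 : 0 < alpha)
    (f_derivable : forall x : R, derivable f x 1)
    (f'_derivable : forall x : R, derivable (derive1 f) x 1)
    (f_convex : forall x : R, alpha <= derive1 (derive1 f) x)
    (T : R) (T_gt0 : 0 < T) :
  exists (F : R -> R -> R) (lam m M : R) (u0 uT : R -> R) (c delta : R),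
    [/\ 0 < lam,
        fv_class f F lam m M,
        admissible_datum u0 /\ (forall x : R, m <= u0 x <= M),
        entropy_evolution f T u0 uT &
        [/\ 0 < c, 0 < delta &
          forall o dx : R, 0 < dx < delta ->
            ((c * dx)%:E <=
              wasserstein1 uT (fun x => fv_approximation F lam o dx u0 x T))%E]].
Proof.
have f'_convex (a b : R) : a <= b -> alpha * (b - a) <= derive1 f b - derive1 f a.
  move=> ab; have [||c _ ->] :=
      @MVT_segment _ (derive1 f) (derive1 (derive1 f)) a b ab.
  - by move=> x _; rewrite [X in is_derive _ _ _ X]derive1E; exact: derivableP.
  - by apply: derivable_within_continuous => x _; exact: f'_derivable.
  by rewrite ler_wpM2r ?subr_ge0// f_convex.
have f'_continuous : continuous (derive1 f).
  by move=> x; apply/differentiable_continuous/derivable1_diffP.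
have f'_homo : {homo derive1 f : x y / x <= y}.
  move=> x y xy; rewrite -subr_ge0; apply: le_trans (f'_convex x y xy).
  by rewrite mulr_ge0 ?subr_ge0// ltW.
(* Since [f'] is monotone, its sign at 0 persists on [[0, 1]] or on [[-1, 0]]. *)
pose right := 0 <= derive1 f 0.
have f'_sign : if right then 0 <= derive1 f 0 else derive1 f 0 <= 0.
  by rewrite /right; case: ifPn => //; rewrite -ltNge => /ltW.
pose lam := upwind_ratio f right; pose c := gap_constant f alpha T right.
have lam0 : 0 < lam by exact: upwind_ratio_gt0.
have c0 : 0 < c by exact: gap_constant_gt0.
exists (upwind_flux f right), lam, (datum_min R right), (datum_max R right).
exists (fun x => smooth_wave f T right x 0), (fun x => smooth_wave f T right x T).
(* The 1 bounds the window, [c / 2] absorbs the averaging error, and [T / (6 lam)] guarantees at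
   least six time steps. *)
exists c, (Num.min 1 (Num.min (c / 2) (T / (6 * lam)))).
split => //.
- apply: upwind_class => //.
  + by rewrite /datum_min; case: (right); rewrite ?lerN10.
  + by rewrite /datum_max; case: (right); rewrite ?ler01.
  + exact: upwind_ratio_cfl alpha_gt0 f'_convex f'_sign.
- split; first exact: smooth_wave_admissible alpha_gt0 T_gt0 f'_convex.
  move=> x; apply: (smooth_wave_range right alpha_gt0) => //.
  by rewrite lexx ltW.
- exact: smooth_wave_entropy alpha_gt0 T_gt0 f_derivable f'_convex.
- split => //; first by rewrite !lt_min ltr01 (divr_gt0 c0)//= divr_gt0// mulr_gt0.
  move=> o dx /andP[dx0]; rewrite !lt_min => /and3P[/ltW dx1 /ltW dxc dxT].
  apply: (smooth_wave_scheme_gap alpha_gt0 T_gt0) => //.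
  by move: dxT; rewrite ltr_pdivlMr ?mulr_gt0// => /ltW; rewrite mulrC mulrA.
Qed.
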